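(* For every finitely generated group $\Gamma$ and every complex reductive algebraic group $G$, the set of irreducible $G$-representations of $\Gamma$ is Zariski open in $Hom(\Gamma,G)$.
   Context: Reductive groups are connected complex affine algebraic groups whose radical is an algebraic torus. $Hom(\Gamma,G)$ is the algebraic set of all homomorphisms $\Gamma\to G$. $\rho:\Gamma\to G$ is irreducible if $\rho(\Gamma)$ is not contained in any proper parabolic subgroup of $G$. *)

(* Defs.v *)
From HB Require Import structures.
From mathcomp Require Import all_boot all_order all_algebra.
From mathcomp Require Export mpoly complex.
From mathcomp Require Export boolp classical_sets reals.

Set Implicit Arguments.
Unset Strict Implicit.
Unset Printing Implicit Defensive.

Import GRing.Theory.

Local Open Scope classical_set_scope.
Local Open Scope ring_scope.

Section Zariski.
Variable K : fieldType.

Definition evalrow m (p : {mpoly K[m]}) (v : 'rV[K]_m) : K :=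
  p.@[fun i => v 0 i].

Definition zero_locus m (S : set {mpoly K[m]}) : set 'rV[K]_m :=
  [set v | forall p, S p -> evalrow p v = 0].

Definition algebraic_set m (V : set 'rV[K]_m) : Prop :=
  exists S, V = zero_locus S.

(* A type [X] is given its variety structure by a (typically injective)
   coordinate map [c : X -> K^m]; [zclosed c] is the topology induced on [X] by
   the Zariski topology of K^m. *)
Definition zclosed X m (c : X -> 'rV[K]_m) (A : set X) : Prop :=
  exists S, A = c @^-1` zero_locus S.

Definition zopen X m (c : X -> 'rV[K]_m) (A : set X) : Prop :=
  zclosed c (~` A).

(* Connectedness of the subspace [A] of [X]. *)
Definition zconnected X m (c : X -> 'rV[K]_m) (A : set X) : Prop :=
  forall C D : set X, zclosed c C -> zclosed c D ->
    A `<=` C `|` D -> A `&` C `&` D = set0 -> A `<=` C \/ A `<=` D.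

Definition regular_on X Y m n (cX : X -> 'rV[K]_m) (cY : Y -> 'rV[K]_n)
    (A : set X) (f : X -> Y) : Prop :=
  exists P : 'I_n -> {mpoly K[m]},
    forall x, A x -> forall j, cY (f x) 0 j = evalrow (P j) (cX x).

End Zariski.

Section AbstractGroups.
Variable G : groupType.
Local Open Scope group_scope.
Implicit Types A H N : set G.

Definition is_subgroup H : Prop :=
  [/\ H 1, forall x y, H x -> H y -> H (x * y) & forall x, H x -> H x^-1].

Definition is_normal N : Prop := forall x g, N x -> N (x ^ g).

Definition subgroup_gen A : set G :=
  [set x | forall H, is_subgroup H -> A `<=` H -> H x].

Definition derived A : set G :=
  subgroup_gen [set z | exists x y, [/\ A x, A y & z = [~ x, y]]].

Definition is_solvable H : Prop := exists n, iter n derived H `<=` [set 1].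

Definition generates k (gamma : 'I_k -> G) : Prop :=
  subgroup_gen (range gamma) = setT.

End AbstractGroups.

(* An affine algebraic group: a group whose underlying set is identified with
   an algebraic subset of some affine space K^m, with polynomial
   multiplication and inversion. *)
Record affine_group (K : fieldType) := AffineGroup {
  ag_group :> groupType;
  ag_dim : nat;
  ag_coord : ag_group -> 'rV[K]_ag_dim;
  ag_coord_inj : injective ag_coord;
  ag_closed : algebraic_set (range ag_coord);
  ag_mul_regular :
    regular_on (fun gh => row_mx (ag_coord gh.1) (ag_coord gh.2)) ag_coord
      setT (fun gh : ag_group * ag_group => (gh.1 * gh.2)%g);
  ag_inv_regular :
    regular_on ag_coord ag_coord setT (fun g : ag_group => (g^-1)%g) }.

Section AlgebraicGroups.
Variables (K : fieldType) (G : affine_group K).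
Implicit Types H N T B P : set G.

Definition closed_subgroup H : Prop :=
  is_subgroup H /\ zclosed (@ag_coord K G) H.

Definition connected_solvable H : Prop :=
  [/\ closed_subgroup H, zconnected (@ag_coord K G) H & is_solvable H].

Definition is_radical N : Prop :=
  [/\ connected_solvable N, is_normal N &
      forall M : set G, connected_solvable M -> is_normal M -> M `<=` N].

Definition Gm_pow r : set 'rV[K]_r := [set t | forall i, t 0 i != 0].

(* Regular functions on (K^* )^r are the Laurent polynomials, that is, the
   polynomials in the t_i and the t_i^-1. *)
Definition Gm_coord r (t : 'rV[K]_r) : 'rV[K]_(r + r) :=
  row_mx t (map_mx GRing.inv t).

(* [T] is isomorphic, as an algebraic group, to some (K^* )^r. *)
Definition is_torus T : Prop :=
  exists r (phi : 'rV[K]_r -> G) (psi : G -> 'rV[K]_r),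
  [/\ [/\ forall t, Gm_pow t -> T (phi t),
          forall g, T g -> Gm_pow (psi g),
          forall t, Gm_pow t -> psi (phi t) = t &
          forall g, T g -> phi (psi g) = g],
      forall s t, Gm_pow s -> Gm_pow t ->
        phi (map2_mx *%R s t) = (phi s * phi t)%g,
      regular_on (@Gm_coord r) (@ag_coord K G) (@Gm_pow r) phi &
      regular_on (@ag_coord K G) (@Gm_coord r) T psi].

Definition reductive : Prop :=
  zconnected (@ag_coord K G) setT /\
  exists N : set G, is_radical N /\ is_torus N.

Definition is_borel B : Prop :=
  connected_solvable B /\
  forall M : set G, connected_solvable M -> B `<=` M -> M = B.

(* The closed subgroups containing a Borel subgroup, i.e. those for which G/P is
   a complete variety. *)
Definition is_parabolic P : Prop :=
  closed_subgroup P /\ exists2 B : set G, is_borel B & B `<=` P.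

End AlgebraicGroups.

Section Representations.
Variables (K : fieldType) (Gamma : groupType) (G : affine_group K).

Definition irreducible_rep (rho : {multiplicative Gamma -> G}) : Prop :=
  forall P : set G, is_parabolic P -> P <> setT -> ~ range rho `<=` P.

(* Coordinates on Hom(Gamma, G): once gamma_1, ..., gamma_k generate Gamma,
   rho |-> (rho gamma_1, ..., rho gamma_k) identifies Hom(Gamma, G) with an
   algebraic subset of G^k. *)
Definition hom_coord k (gamma : 'I_k -> Gamma)
    (rho : {multiplicative Gamma -> G}) : 'rV[K]_(k * ag_dim G) :=
  mxvec (\matrix_(i < k, j < ag_dim G) ag_coord (rho (gamma i)) 0 j).

End Representations.

(* Main.v *)
(* By Lie-Kolchin and Borel's fixed point theorem, a Borel subgroup stabilises a
   full flag x of a faithful linear representation K^n of G, and it is determined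
   by its Lie algebra b_x, the elements of Lie G that preserve x; the Borel
   subgroups correspond to the flags x for which dim b_x is maximal. A
   representation is therefore reducible if and only if there are such a flag x
   and a subspace W of matrices, of dimension less than dim G, which contains
   b_x, is normalised by b_x and is stable under conjugation by the images of the
   generators: given a proper parabolic subgroup P take W = Lie P, and given W
   take for P its stabiliser. (P is proper: if W were G-stable then, by Borel's
   theorem applied to one-parameter subgroups, each element of Lie G would lie in
   some b_y contained in W.) These are closed conditions on x, on frames of b_x
   and W and on the images of the generators; x and the frames range over flag
   varieties, which are complete, so reducibility is closed.

   The correspondence between connected closed subgroups and their Lie algebras
   rests on the Nullstellensatz, proved here over an uncountable field, and on
   Krull's intersection theorem, which replaces smoothness and dimension theory. *)

From HB Require Import structures.
Require Import Defs.
From mathcomp Require Import all_boot all_order all_algebra.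
From mathcomp Require Import ring lra zify.

Set Implicit Arguments.
Unset Strict Implicit.
Unset Printing Implicit Defensive.

Import boolp classical_sets.
Import Order.TTheory GRing.Theory.
Local Open Scope classical_set_scope.
Local Open Scope ring_scope.

(** * Polynomial functions and closed sets *)

(** Quotients such as G/B are never formed: a flag or a subspace is carried by an invertible matrix
    modulo lower triangular ones, so that a single completeness theorem eliminates every quantifier
    over them. The equations speak of the Borel subgroup only through its Lie algebra, where
    membership is linear; this is why [W] is asked to be normalised infinitesimally. Maximality of
    dim b_x serves twice: having dimension at least [d] is a closed condition on the flag, and a
    frame of length [d] inside b_x must then span b_x. Characteristic 0 enters because natural
    equations of a subgroup need not generate a radical ideal: derivations still preserve the
    radical, and the Euler identity on powers of the maximal ideal at 1 can be divided by the
    degree. Uncountability enters by counting: among the inverses modulo an ideal of the X_i - a,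
    infinitely many have the same degree bound, hence they are linearly dependent. *)

(* Products of matrix spaces and groups occur throughout, so a space is just a
   type with a distinguished set of coordinate functions. *)
Class space (K : fieldType) (T : Type) := coords : set (T -> K).

Inductive pol (K : fieldType) (T : Type) {s : space K T} : (T -> K) -> Prop :=
| pol_cst a : pol (fun=> a)
| pol_coord f : coords f -> pol f
| pol_add f g : pol f -> pol g -> pol (fun t => f t + g t)
| pol_mul f g : pol f -> pol g -> pol (fun t => f t * g t).

#[export] Instance base_space (K : fieldType) : space K K := [set id].
#[export] Instance mx_space (K : fieldType) m n : space K 'M[K]_(m, n) :=
  [set f | exists i j, f = fun M : 'M[K]_(m, n) => M i j].
#[export] Instance prod_space (K : fieldType) T1 T2 (s1 : space K T1)
    (s2 : space K T2) : space K (T1 * T2) :=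
  [set f | (exists2 g, coords g & f = g \o fst) \/
           (exists2 g, coords g & f = g \o snd)].

Section Pol.
Variable K : fieldType.

Definition polmap T1 T2 {s1 : space K T1} {s2 : space K T2} (phi : T1 -> T2) :=
  forall f : T2 -> K, pol f -> pol (f \o phi).

(** Closedness as separation, one function for each point outside. This amounts to being a zero
    locus and spares the choice of a set of equations. *)
Definition closedp T {s : space K T} (A : set T) :=
  forall t, ~ A t -> exists f : T -> K,
    [/\ pol f, forall a, A a -> f a = 0 & f t != 0].

Definition conn T {s : space K T} (A : set T) :=
  forall C D : set T, closedp C -> closedp D ->
    A `<=` C `|` D -> A `&` C `&` D = set0 -> A `<=` C \/ A `<=` D.

Section OneSpace.
Context {T : Type} {s : space K T}.
Implicit Types (f g : T -> K) (A B C D : set T).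

Lemma eq_pol f g : f =1 g -> pol f -> pol g.
Proof. by move=> /funext ->. Qed.

Lemma pol_opp f : pol f -> pol (fun t => - f t).
Proof.
move=> pf; apply: eq_pol (pol_mul (pol_cst (-1)) pf) => t.
by rewrite mulN1r.
Qed.

Lemma pol_sub f g : pol f -> pol g -> pol (fun t => f t - g t).
Proof. by move=> pf /pol_opp; exact: pol_add. Qed.

Lemma pol_exp f k : pol f -> pol (fun t => f t ^+ k).
Proof.
move=> pf; elim: k => [|k IH].
  by apply: eq_pol (pol_cst 1) => t; rewrite expr0.
by apply: eq_pol (pol_mul pf IH) => t; rewrite exprS.
Qed.

Lemma pol_sum I (r : seq I) (P : pred I) (F : I -> T -> K) :
  (forall i, P i -> pol (F i)) -> pol (fun t => \sum_(i <- r | P i) F i t).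
Proof.
move=> pF; elim: r => [|i r IH].
  by apply: eq_pol (pol_cst 0) => t; rewrite big_nil.
case Pi : (P i); last by apply: eq_pol IH => t; rewrite big_cons Pi.
by apply: eq_pol (pol_add (pF i Pi) IH) => t; rewrite big_cons Pi.
Qed.

Lemma pol_prod I (r : seq I) (P : pred I) (F : I -> T -> K) :
  (forall i, P i -> pol (F i)) -> pol (fun t => \prod_(i <- r | P i) F i t).
Proof.
move=> pF; elim: r => [|i r IH].
  by apply: eq_pol (pol_cst 1) => t; rewrite big_nil.
case Pi : (P i); last by apply: eq_pol IH => t; rewrite big_cons Pi.
by apply: eq_pol (pol_mul (pF i Pi) IH) => t; rewrite big_cons Pi.
Qed.

Lemma polmap_coords T2 {s2 : space K T2} (phi : T -> T2) :
  (forall f : T2 -> K, coords f -> pol (f \o phi)) -> polmap phi.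
Proof.
move=> h f; elim => [a|g cg|g1 g2 _ p1 _ p2|g1 g2 _ p1 _ p2] //=.
- exact: pol_cst.
- exact: h.
- exact: pol_add.
- exact: pol_mul.
Qed.

Lemma polmap_mx m n (phi : T -> 'M[K]_(m, n)) :
  (forall i j, pol (fun t => phi t i j)) -> polmap phi.
Proof. by move=> h; apply: polmap_coords => _ [i [j ->]]; exact: h. Qed.

Lemma pol_entry m n (phi : T -> 'M[K]_(m, n)) i j :
  polmap phi -> pol (fun t => phi t i j).
Proof. by move=> h; apply: (h (fun M => M i j)); apply: pol_coord; exists i, j. Qed.

Lemma polmap_id : polmap (@id T). Proof. by []. Qed.

Lemma pol_comp T2 {s2 : space K T2} (phi : T -> T2) (f : T2 -> K) :
  polmap phi -> pol f -> pol (fun t => f (phi t)).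
Proof. by move=> h; exact: h. Qed.

Lemma polmap_comp T1 T2 {s1 : space K T1} {s2 : space K T2} (phi : T -> T1)
    (psi : T1 -> T2) : polmap phi -> polmap psi -> polmap (psi \o phi).
Proof. by move=> h1 h2 f /h2 /h1. Qed.

Lemma polmap_base f : pol f -> polmap f.
Proof. by move=> pf; apply: polmap_coords => _ ->. Qed.

Lemma polmap_pol f : polmap f -> pol f.
Proof. by move=> h; apply: (h id); apply: pol_coord. Qed.

Lemma polmap_cst T2 {s2 : space K T2} (x : T2) : polmap (fun _ : T => x).
Proof. by apply: polmap_coords => f _; exact: pol_cst. Qed.

Lemma polmap_pair T1 T2 {s1 : space K T1} {s2 : space K T2} (phi : T -> T1)
    (psi : T -> T2) :
  polmap phi -> polmap psi -> polmap (fun t => (phi t, psi t)).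
Proof.
move=> h1 h2; apply: polmap_coords => f [] [g cg ->].
  exact: (h1 g (pol_coord cg)).
exact: (h2 g (pol_coord cg)).
Qed.

Lemma polmap_fst T1 T2 {s1 : space K T1} {s2 : space K T2} (phi : T -> T1 * T2) :
  polmap phi -> polmap (fun t => (phi t).1).
Proof.
move=> h; apply: polmap_coords => f cf.
by apply: (h (f \o fst)); apply: pol_coord; left; exists f.
Qed.

Lemma polmap_snd T1 T2 {s1 : space K T1} {s2 : space K T2} (phi : T -> T1 * T2) :
  polmap phi -> polmap (fun t => (phi t).2).
Proof.
move=> h; apply: polmap_coords => f cf.
by apply: (h (f \o snd)); apply: pol_coord; right; exists f.
Qed.

Lemma polmap_mulmx m n p (phi : T -> 'M[K]_(m, n)) (psi : T -> 'M[K]_(n, p)) :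
  polmap phi -> polmap psi -> polmap (fun t => phi t *m psi t).
Proof.
move=> h1 h2; apply: polmap_mx => i j.
under eq_fun do rewrite mxE.
by apply: pol_sum => k _; apply: pol_mul; exact: pol_entry.
Qed.

Lemma polmap_addmx m n (phi psi : T -> 'M[K]_(m, n)) :
  polmap phi -> polmap psi -> polmap (fun t => phi t + psi t).
Proof.
move=> h1 h2; apply: polmap_mx => i j; under eq_fun do rewrite mxE.
by apply: pol_add; exact: pol_entry.
Qed.

Lemma polmap_oppmx m n (phi : T -> 'M[K]_(m, n)) :
  polmap phi -> polmap (fun t => - phi t).
Proof.
move=> h1; apply: polmap_mx => i j; under eq_fun do rewrite mxE.
by apply: pol_opp; exact: pol_entry.
Qed.

Lemma polmap_submx m n (phi psi : T -> 'M[K]_(m, n)) :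
  polmap phi -> polmap psi -> polmap (fun t => phi t - psi t).
Proof. by move=> h1 /polmap_oppmx; exact: polmap_addmx. Qed.

Lemma polmap_scalemx m n f (phi : T -> 'M[K]_(m, n)) :
  pol f -> polmap phi -> polmap (fun t => f t *: phi t).
Proof.
move=> h1 h2; apply: polmap_mx => i j; under eq_fun do rewrite mxE.
by apply: pol_mul => //; exact: pol_entry.
Qed.

Lemma polmap_trmx m n (phi : T -> 'M[K]_(m, n)) :
  polmap phi -> polmap (fun t => (phi t)^T).
Proof.
move=> h1; apply: polmap_mx => i j; under eq_fun do rewrite mxE.
exact: pol_entry.
Qed.

Lemma polmap_row m n (phi : T -> 'M[K]_(m, n)) i :
  polmap phi -> polmap (fun t => row i (phi t)).
Proof.
move=> h1; apply: polmap_mx => k j; under eq_fun do rewrite mxE.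
exact: pol_entry.
Qed.

Lemma polmap_vec_mx m n (phi : T -> 'rV[K]_(m * n)) :
  polmap phi -> polmap (fun t => vec_mx (phi t)).
Proof.
move=> h1; apply: polmap_mx => k j; under eq_fun do rewrite mxE.
exact: pol_entry.
Qed.

Lemma polmap_mxvec m n (phi : T -> 'M[K]_(m, n)) :
  polmap phi -> polmap (fun t => mxvec (phi t)).
Proof.
move=> h1; apply: polmap_mx => k j; case/mxvec_indexP: j => i j.
rewrite [k]ord1; under eq_fun do rewrite mxvecE.
exact: pol_entry.
Qed.

Lemma polmap_row_mx m n1 n2 (phi : T -> 'M[K]_(m, n1)) (psi : T -> 'M[K]_(m, n2)) :
  polmap phi -> polmap psi -> polmap (fun t => row_mx (phi t) (psi t)).
Proof.
move=> h1 h2; apply: polmap_mx => i j; under eq_fun do rewrite mxE.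
by case: split => k; exact: pol_entry.
Qed.

Lemma polmap_col_mx m1 m2 n (phi : T -> 'M[K]_(m1, n)) (psi : T -> 'M[K]_(m2, n)) :
  polmap phi -> polmap psi -> polmap (fun t => col_mx (phi t) (psi t)).
Proof.
move=> h1 h2; apply: polmap_mx => i j; under eq_fun do rewrite mxE.
by case: split => k; exact: pol_entry.
Qed.

Lemma pol_det n (phi : T -> 'M[K]_n) :
  polmap phi -> pol (fun t => \det (phi t)).
Proof.
move=> h; rewrite /determinant; apply: pol_sum => p _.
by apply: pol_mul; [exact: pol_cst|apply: pol_prod => i _; exact: pol_entry].
Qed.

Lemma polmap_adj n (phi : T -> 'M[K]_n) :
  polmap phi -> polmap (fun t => \adj (phi t)).
Proof.
move=> h; apply: polmap_mx => i j; under eq_fun do rewrite mxE.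
rewrite /cofactor; apply: pol_mul; first exact: pol_cst.
apply: pol_det; apply: polmap_mx => k l.
under eq_fun do rewrite !mxE.
exact: pol_entry.
Qed.

Lemma closedp_ext A B : A `<=>` B -> closedp A -> closedp B.
Proof. by move=> /seteqP ->. Qed.

Lemma closedp0 f : pol f -> closedp [set t | f t = 0].
Proof. by move=> pf t /eqP ft; exists f. Qed.

Lemma closedpI (I : Type) (F : I -> set T) :
  (forall i, closedp (F i)) -> closedp [set t | forall i, F i t].
Proof.
move=> cF t /existsNP[i /cF [f [pf f0 ft]]]; exists f; split=> // a Fa.
exact: f0.
Qed.

Lemma closedp_imp (P : Prop) A : (P -> closedp A) -> closedp [set t | P -> A t].
Proof.
move=> cA; case: (pselect P) => p; last by move=> t; case.
by apply: closedp_ext (cA p); split=> t; [move=> ?|apply].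
Qed.

Lemma closedp_and A B : closedp A -> closedp B -> closedp (A `&` B).
Proof.
move=> cA cB; apply: (closedp_ext _ (closedpI (F := fun b => if b then A else B) _)).
  split=> t /=; first by move=> h; split; [exact: h true|exact: h false].
  by case=> ? ? [].
by case.
Qed.

Lemma closedpU A B : closedp A -> closedp B -> closedp (A `|` B).
Proof.
move=> cA cB t /not_orP[/cA[f [pf f0 ft]] /cB[g [pg g0 gt]]].
exists (fun t => f t * g t); split; first exact: pol_mul.
  by move=> a [/f0->|/g0->]; rewrite ?mul0r ?mulr0.
by rewrite mulf_neq0.
Qed.

Lemma closedp_bigU n (F : 'I_n -> set T) :
  (forall i, closedp (F i)) -> closedp [set t | exists i, F i t].
Proof.
move=> cF; elim: n F cF => [|n IH] F cF.
  by move=> t _; exists (fun=> 1); split; [exact: pol_cst|move=> a [[]]|exact: oner_neq0].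
apply: (closedp_ext _ (closedpU (cF ord0) (IH (fun i => F (lift ord0 i)) (fun i => cF _)))).
split=> t /=; first by case=> [h|[i h]]; eexists; exact: h.
by case=> i; case: (unliftP ord0 i) => [j|] ->; [right; exists j|left].
Qed.

Lemma closedp_preimage T2 {s2 : space K T2} (phi : T -> T2) (B : set T2) :
  polmap phi -> closedp B -> closedp (phi @^-1` B).
Proof.
move=> pphi cB t /cB[f [pf f0 ft]]; exists (f \o phi); split=> //.
  exact: pphi.
by move=> a; exact: f0.
Qed.

Lemma closedp_eqmx m n (phi psi : T -> 'M[K]_(m, n)) :
  polmap phi -> polmap psi -> closedp [set t | phi t = psi t].
Proof.
move=> h1 h2; apply: (@closedp_ext [set t | forall ij, phi t ij.1 ij.2 - psi t ij.1 ij.2 = 0]).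
  split=> t /=; last by move=> -> ij; rewrite subrr.
  by move=> h; apply/matrixP => i j; have /= := h (i, j); move/subr0_eq.
apply: closedpI => ij; apply: closedp0; apply: pol_sub; exact: pol_entry.
Qed.

Lemma conn_image T2 {s2 : space K T2} (phi : T -> T2) A :
  polmap phi -> conn A -> conn (phi @` A).
Proof.
move=> pphi cA C D cC cD sub dis.
have [||h|h] := cA (phi @^-1` C) (phi @^-1` D) (closedp_preimage pphi cC)
  (closedp_preimage pphi cD).
- by move=> a Aa; apply: sub; exists a.
- rewrite -subset0 => a [[Aa Ca] Da].
  by have : (set0 : set T2) (phi a) by rewrite -dis; split=> //; split=> //; exists a.
- by left=> _ [a Aa <-]; exact: h.
- by right=> _ [a Aa <-]; exact: h.
Qed.

Lemma closedp_fin f (r : seq K) : pol f -> closedp [set t | f t \in r].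
Proof.
move=> pf; apply: (@closedp_ext [set t | \prod_(c <- r) (f t - c) = 0]).
  split=> t /=.
    by move=> /eqP; rewrite prodf_seq_eq0 => /hasP[c cr /=]; rewrite subr_eq0 => /eqP ->.
  move=> ftr; apply/eqP; rewrite prodf_seq_eq0; apply/hasP; exists (f t) => //=.
  by rewrite subrr.
by apply: closedp0; apply: pol_prod => c _; apply: pol_sub => //; exact: pol_cst.
Qed.

(** The fibre over [f a] and the union of the fibres over the other members of [r] are disjoint and
    cover [A]; the second is closed because [r] is finite. *)
Lemma conn_finite_value f (r : seq K) A a b :
  pol f -> conn A -> (forall t, A t -> f t \in r) -> A a -> A b -> f a = f b.
Proof.
move=> pf cA fr Aa Ab; apply/eqP; apply: contraT => nab.
have [||||h|h] := cA [set t | f t = f a] [set t | f t \in [seq c <- r | c != f a]].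
- apply: (@closedp_ext [set t | f t - f a = 0]).
    by split=> t /=; [move/subr0_eq|move->; rewrite subrr].
  by apply: closedp0; apply: pol_sub => //; exact: pol_cst.
- exact: closedp_fin.
- move=> t At /=; have := fr t At; case: (eqVneq (f t) (f a)) => [->|ne h]; [by left|right].
  by rewrite /= mem_filter ne.
- by rewrite -subset0 => t [[_ /= ->]]; rewrite mem_filter eqxx.
- by have /= e := h b Ab; rewrite -e eqxx in nab.
- by have := h a Aa; rewrite /= mem_filter eqxx.
Qed.

End OneSpace.
End Pol.

(** * Elimination theory *)

Section HomogeneousValue.
Variable K : fieldType.
Implicit Types (p q : {poly K}) (s t : K).

(* [hev d p] is the binary form of degree [d] with dehomogenisation [p]. *)
Definition hev d p s t := \sum_(i < d.+1) p`_i * s ^+ i * t ^+ (d - i).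

Lemma hev_horner d p s t : (size p <= d.+1)%N -> t != 0 ->
  hev d p s t = t ^+ d * p.[s / t].
Proof.
move=> sp t0; rewrite (horner_coef_wide _ sp) mulr_sumr; apply: eq_bigr => i _.
have id : (i <= d)%N by rewrite -ltnS.
rewrite -mulrA [RHS]mulrCA; congr (_ * _); rewrite expr_div_n [RHS]mulrCA; congr (_ * _).
have -> : t ^+ d = t ^+ (d - i) * t ^+ i by rewrite -exprD subnK.
by rewrite mulfK // expf_neq0.
Qed.

Lemma hev0 d p s : hev d p s 0 = p`_d * s ^+ d.
Proof.
rewrite /hev (bigD1 ord_max) //= subnn expr0 mulr1 big1 ?addr0 // => i ni.
have : (i < d)%N by rewrite ltn_neqAle -ltnS ltn_ord andbT; apply: contraNneq ni => e; apply/eqP/val_inj.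
by rewrite -subn_gt0 => h; rewrite expr0n eqn0Ngt h mulr0.
Qed.

(** Raising the formal degree adds a zero at infinity, the point [t = 0]. *)
Lemma hev_lift d p s t : (size p <= d.+1)%N -> hev d.+1 p s t = t * hev d p s t.
Proof.
move=> sp; rewrite /hev big_ord_recr /= nth_default // !mul0r addr0 mulr_sumr.
by apply: eq_bigr => i _; rewrite subSn; [rewrite exprS mulrCA|rewrite -ltnS].
Qed.

Lemma hev_mul d e p q s t : (size p <= d.+1)%N -> (size q <= e.+1)%N ->
  hev (d + e) (p * q) s t = hev d p s t * hev e q s t.
Proof.
move=> sp sq.
have spq : (size (p * q)%R <= (d + e).+1)%N.
  apply: leq_trans (size_polyMleq _ _) _; rewrite -addnS -subn1 leq_subLR add1n -addSn.
  exact: leq_add.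
have [->|t0] := eqVneq t 0; last first.
  rewrite !hev_horner // hornerM exprD; ring.
rewrite !hev0 coefM exprD.
rewrite (bigD1 (inord d)) //= inordK ?ltnS ?leq_addr // addKn big1 ?addr0; first by ring.
move=> i ni; have [h|h] := ltnP d i; first by rewrite nth_default ?mul0r // (leq_trans sp).
have {ni}h : (i < d)%N.
  rewrite ltn_neqAle h andbT; apply: contraNneq ni => e1.
  by apply/eqP/val_inj; rewrite /= inordK ?e1 // ltnS leq_addr.
by rewrite [X in _ * X]nth_default ?mulr0 // (leq_trans sq) // ltn_subRL ltn_add2r.
Qed.

Lemma hev_add d p q s t : hev d (p + q) s t = hev d p s t + hev d q s t.
Proof.
by rewrite /hev -big_split; apply: eq_bigr => i _; rewrite coefD !mulrDl.
Qed.

Lemma hev_sum d (I : finType) (P : pred I) (F : I -> {poly K}) s t :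
  hev d (\sum_(i | P i) F i) s t = \sum_(i | P i) hev d (F i) s t.
Proof.
elim/big_rec2: _ => [|i x y _ IH]; last by rewrite hev_add IH.
by rewrite /hev big1 // => i _; rewrite coef0 !mul0r.
Qed.

Lemma hev_scale d p s t c : hev d p (c * s) (c * t) = c ^+ d * hev d p s t.
Proof.
rewrite /hev mulr_sumr; apply: eq_bigr => i _.
have id : (i <= d)%N by rewrite -ltnS.
have -> : c ^+ d = c ^+ (d - i) * c ^+ i by rewrite -exprD subnK.
rewrite !exprMn; ring.
Qed.

Lemma hevXn d p i s t : (size p <= d.+1)%N ->
  hev (i + d) ('X^i * p) s t = s ^+ i * hev d p s t.
Proof.
move=> sp; rewrite hev_mul ?size_polyXn //; congr (_ * _).
rewrite /hev big_ord_recr /= big1 ?add0r => [|j _]; last first.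
  by rewrite coefXn (ltn_eqF (ltn_ord j)) !mul0r.
by rewrite coefXn eqxx subnn expr0 mulr1 mul1r.
Qed.

End HomogeneousValue.

Section Elimination.
Variable K : closedFieldType.

Lemma big_unitE (F : unit -> K) : \sum_i F i = F tt.
Proof. by rewrite (bigD1 tt) //= big1 ?addr0 // => -[]. Qed.

Lemma poly_eq0_all_roots (p : {poly K}) : (forall x, x != 0 -> p.[x] = 0) -> p = 0.
Proof.
move=> h; apply/eqP; apply: contraT => p0.
have /closed_nonrootP[x] : p * 'X != 0 by rewrite mulf_neq0 ?polyX_eq0.
rewrite rootE hornerM hornerX mulf_eq0 => /norP[px x0].
by rewrite h ?eqxx in px.
Qed.

Section Plane.
Context {Y : Type} {sY : space K Y}.

(** A family of binary forms, dehomogenised, with coefficients polynomial in [y]. The degree [d] is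
    formal: the size of [P y] may drop at some [y]. *)
Definition form d (P : Y -> {poly K}) :=
  (forall y, (size (P y) <= d.+1)%N) /\ (forall i, pol (fun y => (P y)`_i)).

Lemma form_mul d e P Q : form d P -> form e Q -> form (d + e) (fun y => P y * Q y).
Proof.
move=> [sP pP] [sQ pQ]; split=> [y|i].
  apply: leq_trans (size_polyMleq _ _) _; rewrite -addnS -subn1 leq_subLR add1n -addSn.
  exact: leq_add.
under eq_fun do rewrite coefM.
by apply: pol_sum => j _; apply: pol_mul.
Qed.

Lemma form_sum d (I : finType) (A : pred I) (F : I -> Y -> {poly K}) :
  (forall i, A i -> form d (F i)) -> form d (fun y => \sum_(i | A i) F i y).
Proof.
move=> h; split=> [y|j].
  apply: (big_ind (fun p : {poly K} => (size p <= d.+1)%N)).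
  - by rewrite size_poly0.
  - by move=> p q sp sq; rewrite (leq_trans (size_polyD _ _)) // geq_max sp.
  - by move=> i /h[].
under eq_fun do rewrite coef_sum.
by apply: pol_sum => i /h[].
Qed.

Lemma form_cst d (p : {poly K}) : (size p <= d.+1)%N -> form d (fun=> p).
Proof. by move=> sp; split=> // i; exact: pol_cst. Qed.

Lemma pol_forms (f : K * K * Y -> K) : pol f ->
  exists (I : finType) (d : I -> nat) (P : I -> Y -> {poly K}),
    (forall i, form (d i) (P i)) /\
    (forall s t y, f (s, t, y) = \sum_i hev (d i) (P i y) s t).
Proof.
elim=> {f} [a|f|f g _ [I [d [P [fP eP]]]] _ [J [e [Q [fQ eQ]]]]
               |f g _ [I [d [P [fP eP]]]] _ [J [e [Q [fQ eQ]]]]].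
- exists unit, (fun=> 0%N), (fun _ _ => a%:P); split=> [_|s t y].
    by apply: form_cst; exact: size_polyC_leq1.
  rewrite big_unitE /=.
  by rewrite /hev big_ord1 coefC /= !expr0 !mulr1.
- case=> [[g [[h -> ->]|[h -> ->]] ->]|[g cg ->]].
  + exists unit, (fun=> 1%N), (fun _ _ => 'X); split=> [_|s t y].
      by apply: form_cst; rewrite size_polyX.
    rewrite big_unitE /=.
    by rewrite /hev big_ord_recl big_ord1 /= !coefX /=; ring.
  + exists unit, (fun=> 1%N), (fun _ _ => 1); split=> [_|s t y].
      by apply: form_cst; rewrite size_poly1.
    rewrite big_unitE /=.
    by rewrite /hev big_ord_recl big_ord1 /= !coef1 /=; ring.
  + exists unit, (fun=> 0%N), (fun _ y => (g y)%:P); split=> [_|s t y].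
      split=> [y|i]; first exact: size_polyC_leq1.
      under eq_fun do rewrite coefC.
      by case: (i == 0%N); [exact: pol_coord|exact: pol_cst].
    rewrite big_unitE /=.
  by rewrite /hev big_ord1 coefC /= !expr0 !mulr1.
- exists (I + J)%type, (fun x => match x with inl i => d i | inr j => e j end),
    (fun x => match x with inl i => P i | inr j => Q j end).
  by split=> [[]//|s t y]; rewrite big_sumType eP eQ.
- exists (I * J)%type, (fun x => d x.1 + e x.2)%N, (fun x y => P x.1 y * Q x.2 y).
  split=> [x|s t y]; first exact: form_mul.
  rewrite eP eQ big_distrlr pair_big; apply: eq_bigr => x _ /=.
  by rewrite hev_mul //; [case: (fP x.1)|case: (fQ x.2)].
Qed.

Variable Z : set (K * K * Y).
Hypothesis cZ : closedp Z.
Hypothesis coneZ : forall (c s t : K) y, c != 0 -> Z (s, t, y) -> Z (c * s, c * t, y).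

Definition vanishing d P := form d P /\
  forall s t y, Z (s, t, y) -> hev d (P y) s t = 0.

(** The homogeneous components of a function vanishing on a cone vanish there too: along a ray they
    are the coefficients of a polynomial in the scalar [c] that is 0 for all nonzero [c]. One
    component must be nonzero at the given point. *)
Lemma separating_form s t y : ~ Z (s, t, y) ->
  exists d P, vanishing d P /\ hev d (P y) s t != 0.
Proof.
move=> /cZ[f [/pol_forms[I [d [P [fP eP]]]] f0 ft]].
pose Q n y := \sum_(i | d i == n) P i y.
have fQ n : form n (Q n) by apply: form_sum => i /eqP <-.
have Q0 n s' t' y' : Z (s', t', y') -> hev n (Q n y') s' t' = 0.
  move=> z; pose p := \sum_i (hev (d i) (P i y') s' t')%:P * 'X^(d i).
  have p0 : p = 0.
    apply: poly_eq0_all_roots => c c0; rewrite -(f0 _ (coneZ c0 z)) eP.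
    rewrite horner_sum; apply: eq_bigr => i _.
    by rewrite !hornerE hev_scale mulrC.
  have := coef0 K n; rewrite -p0 coef_sum => <-.
  rewrite hev_sum big_mkcond; apply: eq_bigr => i _.
  by rewrite coefCM coefXn eq_sym; case: eqP => [->|_]; rewrite ?mulr1 ?mulr0.
have [n hn] : exists n, hev n (Q n y) s t != 0.
  apply: contrapT => /forallNP h; case/eqP: ft; rewrite eP.
  rewrite (partition_big (fun i => inord (d i) : 'I_(\max_i d i).+1) xpredT) //=.
  apply: big1 => n _; have := h n => /negP; rewrite negbK hev_sum => /eqP hn; rewrite -[RHS]hn {hn}.
  apply: eq_big => [i|i /eqP <-]; last by rewrite inordK // ltnS leq_bigmax.
  apply/eqP/eqP => [<-|e]; first by rewrite inordK // ltnS leq_bigmax.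
  by apply: val_inj; rewrite /= inordK // ltnS leq_bigmax.
by exists n, (Q n); split=> //; split=> //; exact: Q0.
Qed.

Lemma vanishing_lift d P k : vanishing d P -> vanishing (d + k) P.
Proof.
move=> v; elim: k => [|k [[sP pP] P0]]; rewrite ?addn0 // addnS.
split; first by split=> // y; rewrite ltnW // ltnS.
by move=> s t y /P0 h; rewrite hev_lift // h mulr0.
Qed.

Definition vanishing_at y := [set q | exists d P, vanishing d P /\ P y = q].

Lemma vanishing_at_ideal y q r c d :
  vanishing_at y q -> vanishing_at y r -> vanishing_at y (c * q + d * r).
Proof.
have aux q1 c1 : vanishing_at y q1 -> vanishing_at y (c1 * q1).
  move=> [n [P [[fP P0] <-]]]; have fc : form (size c1) (fun=> c1) by exact: form_cst.
  exists (size c1 + n)%N, (fun y => c1 * P y); split=> //; split; first exact: form_mul.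
  by move=> s t z /P0 h; rewrite hev_mul ?h ?mulr0 //; case: fP.
move=> /(aux _ c)[n [P [vP <-]]] /(aux _ d)[m [Q [vQ <-]]].
have [[sP pP] P0] := vanishing_lift m vP.
have [[sQ pQ] Q0] := vanishing_lift n vQ; rewrite addnC in sQ Q0.
exists (n + m)%N, (fun y => P y + Q y); split=> //; split.
  split=> [z|i]; first by rewrite (leq_trans (size_polyD _ _)) // geq_max sP sQ.
  by under eq_fun do rewrite coefD; apply: pol_add.
by move=> s t z h; rewrite hev_add P0 ?Q0 ?addr0.
Qed.

(** [vanishing_at y] is an ideal of [K[X]] without common root. An element of least degree divides
    all the others, and a root of it would be common to all, so it is constant. *)
Lemma vanishing_at1 y : (forall s, ~ Z (s, 1, y)) -> vanishing_at y 1.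
Proof.
move=> nZ.
have nz x : exists q, vanishing_at y q /\ q.[x] != 0.
  have [d [P [vP]]] := separating_form (nZ x); rewrite hev_horner ?oner_eq0 //.
    by rewrite divr1 expr1n mul1r; exists (P y); split=> //; exists d, P.
  by case: vP => [[]].
have [q0 [Iq0 q00]] := nz 0.
have {}q00 : q0 != 0 by apply: contraNneq q00 => ->; rewrite horner0.
pose S n := `[< exists q, [/\ vanishing_at y q, q != 0 & size q = n] >].
have exS : exists n, S n by exists (size q0); apply/asboolP; exists q0.
case: (ex_minnP exS) => n /asboolP[q [Iq qn0 sq]] minn.
have dvd r : vanishing_at y r -> q %| r.
  move=> Ir; apply: contraT => nd.
  have : S (size (r %% q)).
    apply/asboolP; exists (r %% q); split=> //.
    have -> : r %% q = 1 * r + (- (r %/ q)) * q.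
      by rewrite {2}(divp_eq r q) mul1r mulNr addrC addKr.
    exact: vanishing_at_ideal.
  by move/minn; rewrite -sq leqNgt ltn_modp qn0.
have : size q == 1%N.
  rewrite eqn_leq [X in _ && X]lt0n size_poly_eq0 qn0 andbT leqNgt.
  apply/negP => sq1; have /closed_rootP[x rx] : size q != 1%N by rewrite gtn_eqF.
  have [r [/dvd/dvdpP[u ->]]] := nz x.
  by rewrite hornerM (rootP rx) mulr0 eqxx.
move=> /size_poly1P[c c0 qc].
have -> : 1 = (c^-1)%:P * q + 0 * q by rewrite qc -polyCM mulVf // mul0r addr0.
exact: vanishing_at_ideal.
Qed.

(** If no point of [Z] lies over [y0], there are vanishing forms [F], nonzero at infinity over [y0],
    and [G], equal to a power of [t] over [y0]. Their resultant is polynomial in [y], nonzero at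
    [y0], and 0 wherever they have a common zero. *)
Lemma elimination_plane :
  closedp [set y | exists s t : K, (s != 0) || (t != 0) /\ Z (s, t, y)].
Proof.
move=> y0 nZ.
have nZ' s t : (s != 0) || (t != 0) -> ~ Z (s, t, y0).
  by move=> st z; apply: nZ; exists s, t.
have [d [F [[[sF pF] F0] Fy]]] : exists d P, vanishing d P /\ hev d (P y0) 1 0 != 0.
  by apply: separating_form; apply: nZ'; rewrite oner_eq0.
rewrite hev0 expr1n mulr1 in Fy.
have [e' [G [vG Gy]]] : vanishing_at y0 1.
  by apply: vanishing_at1 => s; apply: nZ'; rewrite oner_eq0 orbT.
(* Formal degree at least 1 keeps the Sylvester matrix nonempty, so that monomials of degree
   [d + e - 1] make sense. *)
have [[sG pG] G0] := vanishing_lift 1 vG; set e := (e' + 1)%N in sG G0.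
have de : (d + e = (d + e').+1)%N by rewrite /e addnA addn1.
(* The Sylvester matrix; triangular at [y0], where [G] is [1]. *)
pose row_poly y (i : 'I_(d + e)) : {poly K} :=
  if (i < d)%N then 'X^i * G y else 'X^(i - d) * F y.
pose M y : 'M[K]_(d + e) := \matrix_(i, j) (row_poly y i)`_j.
exists (fun y => \det (M y)); split.
- apply: pol_det; apply: polmap_mx => i j; case: (ltnP i d) => id.
    apply: (@eq_pol _ _ _ (fun y => if (j < i)%N then 0 else (G y)`_(j - i))).
      by move=> y; rewrite mxE /row_poly id coefXnM.
    by case: (j < i)%N; [exact: pol_cst|].
  apply: (@eq_pol _ _ _ (fun y => if (j < i - d)%N then 0 else (F y)`_(j - (i - d)))).
    by move=> y; rewrite mxE /row_poly [(i < d)%N]ltnNge id coefXnM.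
  by case: (j < i - d)%N; [exact: pol_cst|].
- move=> y [s [t [st z]]]; apply/eqP/det0P.
  suff : exists2 v : 'cV_(d + e), v != 0 & M y *m v = 0.
    case=> v v0 Mv; apply/det0P; rewrite -det_tr; apply/det0P; exists v^T.
      by rewrite trmx_eq0.
    by rewrite -trmx_mul Mv trmx0.
  (* Paired with this vector of monomials, a row of [M y] gives the value at [(s, t)] of a multiple
     of [F y] or [G y]. *)
  exists (\col_j (s ^+ j * t ^+ (d + e' - j))).
    apply/eqP => /matrixP v0; case/orP: st => /negP; apply.
      have := v0 (cast_ord (esym de) ord_max) 0; rewrite !mxE /= subnn expr0 mulr1.
      by move/eqP; rewrite expf_eq0 => /andP[].
    have := v0 (cast_ord (esym de) ord0) 0; rewrite !mxE /= subn0 expr0 mul1r.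
    by move/eqP; rewrite expf_eq0 => /andP[].
  apply/matrixP => i k; rewrite !mxE.
  have -> : \sum_j M y i j * (\col_j (s ^+ j * t ^+ (d + e' - j))) j k =
            hev (d + e') (row_poly y i) s t.
    rewrite /hev; pose H j := (row_poly y i)`_j * s ^+ j * t ^+ (d + e' - j).
    rewrite -(big_mkord xpredT H) -de big_mkord; apply: eq_bigr => j _.
    by rewrite !mxE mulrA.
  have lift k1 n (p : {poly K}) : (size p <= n.+1)%N -> hev n p s t = 0 -> hev (n + k1) p s t = 0.
    move=> sp h; elim: k1 => [|k1 IH]; rewrite ?addn0 // addnS hev_lift ?IH ?mulr0 //.
    by rewrite (leq_trans sp) // ltnS leq_addr.
  rewrite /row_poly; case: ltnP => id.
    have -> : (d + e' = i + e + (d - i.+1))%N.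
      by move: (nat_of_ord i) id de => m; lia.
    apply: lift; last by rewrite hevXn // G0 ?mulr0.
    by rewrite (leq_trans (size_polyMleq _ _)) // size_polyXn /= -addnS leq_add2l.
  have ie : (i - d <= e')%N by have := ltn_ord i; lia.
  have -> : (d + e' = (i - d) + d + (e' - (i - d)))%N.
    by move: (nat_of_ord i) id ie de => m; lia.
  apply: lift; last by rewrite hevXn // F0 ?mulr0.
  by rewrite (leq_trans (size_polyMleq _ _)) // size_polyXn /= -addnS leq_add2l.
- have Mtrig : is_trig_mx (M y0).
    apply/is_trig_mxP => i j ij; rewrite mxE /row_poly; case: ltnP => id.
      by rewrite Gy mulr1 coefXn gtn_eqF.
    rewrite coefXnM; case: ifP => // jd; rewrite nth_default //.
    apply: leq_trans (sF y0) _; rewrite ltn_subRL.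
    by rewrite subnK.
  rewrite det_trig //; apply/prodf_neq0 => i _; rewrite mxE /row_poly; case: ltnP => id.
    by rewrite Gy mulr1 coefXn eqxx oner_eq0.
  by rewrite coefXnM ltnNge leq_subr /= subKn.
Qed.

End Plane.

Lemma row_mxS_neq0 n (u : 'M[K]_1) (v : 'rV[K]_n) :
  ((row_mx u v : 'rV[K]_n.+1) != 0) = (u != 0) || (v != 0).
Proof. by rewrite -negb_and -row_mx_eq0. Qed.

(** Completeness of projective space, phrased for cones: projecting from a point removes one
    coordinate, and the position on the projecting line is eliminated by [elimination_plane]. *)
Lemma elimination n Y {sY : space K Y} (Z : set ('rV[K]_n.+1 * Y)) :
  closedp Z -> (forall c a y, c != 0 -> Z (a, y) -> Z (c *: a, y)) ->
  closedp [set y | exists2 a, a != 0 & Z (a, y)].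
Proof.
elim: n Y sY Z => [|n IH] Y sY Z cZ coneZ.
  apply: (@closedp_ext _ _ _ ((fun y => (const_mx 1, y)) @^-1` Z)); last first.
    by apply: closedp_preimage => //; apply: polmap_pair; [exact: polmap_cst|exact: polmap_id].
  split=> y /=.
    move=> z; exists (const_mx 1) => //; apply/eqP => /matrixP/(_ 0 0)/eqP.
    by rewrite !mxE oner_eq0.
  case=> a a0 z; have a00 : a 0 0 != 0.
    by apply: contraNneq a0 => e; apply/eqP/matrixP => i j; rewrite !ord1 mxE.
  have -> : const_mx 1 = (a 0 0)^-1 *: a; last by apply: coneZ; rewrite ?invr_eq0.
  by apply/matrixP => i j; rewrite !ord1 !mxE mulVf.
(* A point of P^(n+1) other than (1, 0) lies on the line joining it to (1, 0). *)
pose phi (x : K * K * ('rV[K]_n.+1 * Y)) : 'rV[K]_(1 + n.+1) * Y :=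
  (row_mx x.1.1%:M (x.1.2 *: x.2.1), x.2.2).
have pphi : polmap phi.
  apply: polmap_pair; last by apply: polmap_snd; apply: polmap_snd; exact: polmap_id.
  have p1 : polmap (fun x : K * K * ('rV[K]_n.+1 * Y) => x.1.1).
    by do 2!apply: polmap_fst; exact: polmap_id.
  have p2 : polmap (fun x : K * K * ('rV[K]_n.+1 * Y) => x.1.2).
    by apply: polmap_snd; apply: polmap_fst; exact: polmap_id.
  apply: polmap_row_mx.
    apply: polmap_mx => i j; under eq_fun do rewrite mxE.
    by rewrite !ord1; exact: polmap_pol.
  apply: polmap_scalemx; first exact: polmap_pol.
  by apply: polmap_fst; apply: polmap_snd; exact: polmap_id.
have cphi := closedp_preimage pphi cZ.
have coneP (c s t : K) y : c != 0 -> (phi @^-1` Z) (s, t, y) ->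
    (phi @^-1` Z) (c * s, c * t, y).
  move=> c0 /= z; rewrite /phi /=.
  have -> : row_mx (c * s)%:M ((c * t) *: y.1) = c *: row_mx s%:M (t *: y.1).
    by rewrite scale_row_mx scale_scalar_mx scalerA.
  exact: coneZ.
have := IH _ _ _ (elimination_plane cphi coneP).
set W := [set y | _] => cW.
apply: closedp_ext (cW _) => [|c x y c0].
- split=> y /=.
    case=> x x0 [s [t [st z]]]; exists (row_mx s%:M (t *: x)) => //.
    rewrite row_mxS_neq0 scaler_eq0 (negbTE x0) orbF; case/orP: st => [s0|->]; last exact: orbT.
    by apply/orP; left; apply: contraNneq s0 => /matrixP/(_ 0 0); rewrite !mxE mulr1n => ->.
  case=> a; rewrite -[a](@hsubmxK _ _ 1 n.+1); set s := lsubmx _; set x := rsubmx _.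
  have sE : s = (s 0 0)%:M by exact: mx11_scalar.
  (* For [x = 0] the point is the centre of projection, which lies on every projecting line, so any
     direction serves. *)
  move=> a0 z; have [x0|x0] := eqVneq x 0.
    exists (const_mx 1).
      by apply/eqP => /matrixP/(_ 0 0)/eqP; rewrite !mxE oner_eq0.
    exists (s 0 0), 0; split.
      move: a0; rewrite row_mxS_neq0 x0. rewrite eqxx orbF => s0; apply/orP; left.
      by apply: contraNneq s0 => s0; rewrite sE s0 -scalemx1 scale0r.
    by rewrite /phi /= scale0r -sE -x0.
  exists x => //; exists (s 0 0), 1; split; first by rewrite oner_eq0 orbT.
  by rewrite /phi /= scale1r -sE.
- case=> s [t [st z]]; exists s, (t / c); split.
    by rewrite mulf_eq0 invr_eq0 (negbTE c0) orbF.
  by rewrite /phi /= scalerA mulfVK.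
Qed.
End Elimination.

(** * Completeness of the flag variety *)

(* A flag of [K^n] is represented by an invertible matrix, up to left
   multiplication by lower triangular matrices: its [i]-th step is spanned by
   the first [i] rows. *)
Definition flag_set (K : fieldType) n Y (Z : set ('M[K]_n * Y)) :=
  forall l g y, l \in unitmx -> is_trig_mx l -> g \in unitmx ->
    Z (g, y) -> Z (l *m g, y).

Section Flags.
Variable K : closedFieldType.

Lemma homogenize n Y {sY : space K Y} (f : 'rV[K]_n * Y -> K) : pol f ->
  exists d (h : K * ('rV[K]_n * Y) -> K), pol h /\
    forall s a y, s != 0 -> h (s, (a, y)) = s ^+ d * f (s^-1 *: a, y).
Proof.
have p1 : pol (fun x : K * ('rV[K]_n * Y) => x.1).
  by apply: polmap_pol; apply: polmap_fst; exact: polmap_id.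
elim=> {f} [c|f|f g _ [d [F [pF eF]]] _ [e [G [pG eG]]]
               |f g _ [d [F [pF eF]]] _ [e [G [pG eG]]]].
- by exists 0%N, (fun=> c); split=> [|s a y s0]; rewrite ?mul1r //; exact: pol_cst.
- case=> [[_ [i [j ->]] ->]|[g cg ->]].
    exists 1%N, (fun x : K * ('rV[K]_n * Y) => x.2.1 i j); split=> [|s a y s0] /=.
      by apply: pol_entry; apply: polmap_fst; apply: polmap_snd; exact: polmap_id.
    by rewrite mxE mulrA mulfV // mul1r.
  exists 0%N, (fun x => g x.2.2); split=> [|s a y s0]; last by rewrite expr0 mul1r.
  have h : polmap (fun x : K * ('rV[K]_n * Y) => x.2.2).
    by do 2!apply: polmap_snd; exact: polmap_id.
  by apply: (h g); exact: pol_coord.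
- exists (d + e)%N, (fun x => x.1 ^+ e * F x + x.1 ^+ d * G x); split=> [|s a y s0].
    by apply: pol_add; apply: pol_mul => //; exact: pol_exp.
  by rewrite eF // eG //= exprD; ring.
- exists (d + e)%N, (fun x => F x * G x); split=> [|s a y s0]; first exact: pol_mul.
  by rewrite eF // eG //= exprD; ring.
Qed.

Lemma row0_complete n (a : 'rV[K]_n.+1) : a != 0 ->
  exists2 c : 'M[K]_n.+1, c \in unitmx & row 0 c = a.
Proof.
move=> a0; have ra : \rank a = 1%N by rewrite rank_rV a0.
have := mulmx_ebase a; rewrite ra => ea.
pose k := col_ebase a 0 0.
have kE : col_ebase a = k%:M by exact: mx11_scalar.
have k0 : k != 0.
  by have := col_ebase_unit a; rewrite unitmxE kE det_scalar expr1 unitfE.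
exists (k *: row_ebase a); first by rewrite unitmxZ ?unitfE // row_ebase_unit.
rewrite -[RHS]ea kE mul_scalar_mx -scalemxAl linearZ /=; congr (_ *: _).
rewrite rowE; congr (_ *m _); apply/matrixP => i j; rewrite !mxE !ord1.
by rewrite eqxx /= andbT eq_sym.
Qed.

Lemma unitmx_ublock1 n (a : 'rV[K]_n) (g : 'M[K]_n) :
  ((block_mx 1%:M a 0 g : 'M[K]_n.+1) \in unitmx) = (g \in unitmx).
Proof.
by rewrite !unitmxE (@det_ublock _ 1 n 1%:M a g) det1 mul1r.
Qed.

Lemma is_trig_lblock1 n (k : K) (u : 'cV[K]_n) (l : 'M[K]_n) :
  is_trig_mx l -> is_trig_mx (block_mx k%:M 0 u l : 'M[K]_n.+1).
Proof.
move=> lt; have := @is_trig_block_mx K 1 n 1 n k%:M 0 u l erefl.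
by rewrite eqxx scalar_mx_is_trig lt.
Qed.

Lemma row0_usubmx m n (A : 'M[K]_(1 + m, n)) : row 0 A = usubmx A.
Proof.
by apply/matrixP => i j; rewrite !mxE; congr (A _ _); apply: val_inj; rewrite /= ord1.
Qed.

Lemma delta_row_mx n : delta_mx 0 0 = row_mx 1%:M 0 :> 'rV[K]_(1 + n).
Proof.
by rewrite -row1 (@row0_usubmx n n.+1) (@scalar_mx_block _ 1 n 1) block_mxEv col_mxKu.
Qed.

Definition complete_flags n := forall Y (sY : space K Y) (Z : set ('M[K]_n * Y)),
  closedp Z -> flag_set Z -> closedp [set y | exists2 g, g \in unitmx & Z (g, y)].

(** After a change of basis [c] taking the first basis vector to [a0], a flag whose first line is
    near [a0] has a representative with first row [(1, a)] and first column cleared below. The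
    remaining block is a flag in one dimension less, and [complete_flags n] applies with [a] as a
    parameter. The equation so found in the chart is homogenised, then multiplied by the chart
    coordinate so as to vanish outside the chart. The value 0 is adjoined to obtain a closed
    cone. *)
Lemma first_row_closed n Y {sY : space K Y} (Z : set ('M[K]_n.+1 * Y)) :
  complete_flags n -> closedp Z -> flag_set Z ->
  closedp [set ay : 'rV[K]_n.+1 * Y | ay.1 = 0 \/
     exists g, [/\ g \in unitmx, row 0 g = ay.1 & Z (g, ay.2)]].
Proof.
move=> IH cZ fZ [a0 y0] /not_orP[/= /eqP a00 nZ].
have [c cu ca] := row0_complete a00.
pose phi (x : 'M[K]_n * ('rV[K]_n * Y)) : 'M[K]_(1 + n) * Y :=
  (block_mx 1%:M x.2.1 0 x.1 *m c, x.2.2).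
have pphi : polmap phi.
  apply: polmap_pair; last by do 2!apply: polmap_snd; exact: polmap_id.
  apply: polmap_mulmx; last exact: polmap_cst.
  apply: polmap_col_mx; apply: polmap_row_mx; try exact: polmap_cst.
    by apply: polmap_fst; apply: polmap_snd; exact: polmap_id.
  by apply: polmap_fst; exact: polmap_id.
have := IH _ _ _ (closedp_preimage pphi cZ); set W := [set y | _] => cW.
have {cW} /cW : flag_set (phi @^-1` Z).
  move=> l g [a y] lu lt gu /= z; rewrite /phi /=.
  have -> : block_mx 1%:M a 0 (l *m g) *m c =
            block_mx 1%:M 0 0 l *m (block_mx 1%:M a 0 g *m c).
    by rewrite mulmxA mulmx_block !mul1mx !mul0mx !mulmx0 !addr0 !add0r.
  apply: fZ => //.
  - by rewrite unitmx_ublock1.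
  - exact: is_trig_lblock1.
  - by rewrite unitmx_mul cu andbT unitmx_ublock1.
case/(_ (0, y0)).
  case=> g gu /= z; apply: nZ; exists ((block_mx (1%:M : 'M_1) 0 0 g : 'M[K]_n.+1) *m c); split=> //.
    by rewrite unitmx_mul cu andbT unitmx_ublock1.
  rewrite row_mul -[RHS]ca [RHS]rowE; congr (_ *m _).
  by rewrite (@row0_usubmx n n.+1) block_mxEv col_mxKu -delta_row_mx.
move=> f [/homogenize[d [h [ph eh]]] f0 fn0].
pose b (x : 'rV[K]_n.+1 * Y) : 'rV[K]_(1 + n) := x.1 *m invmx c.
have pb : polmap b.
  by apply: polmap_mulmx; [apply: polmap_fst; exact: polmap_id|exact: polmap_cst].
exists (fun x => b x 0 0 * h (b x 0 0, (rsubmx (b x), x.2))); split.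
- apply: pol_mul; first exact: pol_entry.
  apply: (pol_comp (phi := fun x => (b x 0 0, (rsubmx (b x), x.2))) _ ph).
  apply: polmap_pair; first by apply: polmap_base; exact: pol_entry.
  apply: polmap_pair; last by apply: polmap_snd; exact: polmap_id.
  by apply: polmap_mx => i j; under eq_fun do rewrite mxE; exact: pol_entry.
- case=> a y /= [->|[g [gu ga z]]]; first by rewrite /b /= mul0mx mxE mul0r.
  have [->|bn0] := eqVneq (b (a, y) 0 0) 0; first by rewrite mul0r.
  rewrite eh // (f0 (_, _)) ?mulr0 //=; rewrite /W /=.
  pose G : 'M_(1 + n) := g *m invmx c.
  have Gu : G \in unitmx by rewrite unitmx_mul gu unitmx_inv.
  set k := b (a, y) 0 0.
  have rG : usubmx G = b (a, y).
    by rewrite /b /= -ga -row_mul (@row0_usubmx n n.+1).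
  have ulG : ulsubmx G = k%:M.
    rewrite [LHS]mx11_scalar /ulsubmx rG [lsubmx _ _ _]mxE /k.
    by congr (fun_of_matrix _ _ _)%:M; exact: val_inj.
  have urG : ursubmx G = rsubmx (b (a, y)) by rewrite /ursubmx rG.
  (* Row operations that make the first row begin with 1 and clear the column below it; they do not
     change the flag. *)
  pose l : 'M[K]_(1 + n) := block_mx (k^-1)%:M 0 (- k^-1 *: dlsubmx G) 1%:M.
  have lu : l \in unitmx.
    by rewrite unitmxE det_lblock det1 mulr1 det_scalar expr1 unitfE invr_eq0.
  pose g' : 'M_n := - k^-1 *: dlsubmx G *m ursubmx G + drsubmx G.
  have lG : l *m G = block_mx 1%:M (k^-1 *: rsubmx (b (a, y))) 0 g'.
    rewrite -[G in LHS]submxK mulmx_block ulG urG !mul0mx !addr0 !mul1mx.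
    rewrite -scalar_mxM mulVf // mul_scalar_mx /g' urG; congr block_mx.
    by rewrite mul_mx_scalar scalerA mulrN mulfV // scaleN1r addNr.
  exists g'.
    have : l *m G \in unitmx by rewrite unitmx_mul lu.
    by rewrite lG unitmx_ublock1.
  rewrite /phi /= -lG -mulmxA mulmxKV //; apply: fZ => //.
  exact/is_trig_lblock1/scalar_mx_is_trig.
- have -> : b (a0, y0) = row_mx 1%:M 0.
    by rewrite /b /= -ca rowE -mulmxA mulmxV // mulmx1 -delta_row_mx.
  rewrite row_mxKr -delta_row_mx mxE eqxx mul1r eh ?oner_eq0 //.
  by rewrite expr1n mul1r scaler0.
Qed.

(** The flag variety fibres over projective space by the first line: [first_row_closed] treats the
    fibres and [elimination] the base. *)
Lemma flags_complete n : complete_flags n.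
Proof.
elim: n => [|n IH] Y sY Z cZ fZ.
  apply: (@closedp_ext _ _ _ ((fun y => (1%:M, y)) @^-1` Z)); last first.
    by apply: closedp_preimage => //; apply: polmap_pair; [exact: polmap_cst|exact: polmap_id].
  split=> y /=; first by exists 1%:M; rewrite ?unitmx1.
  by case=> g _; rewrite (_ : g = 1%:M) // [LHS]flatmx0 [RHS]flatmx0.
have /elimination := first_row_closed IH cZ fZ.
set W := [set y | _] => cW; apply: closedp_ext (cW _) => [|c a y c0 [/= ->|]].
- split=> y /=.
    by case=> a a0 [/= a0'|[g [gu _ z]]]; [rewrite a0' eqxx in a0|exists g].
  case=> g gu z; exists (row 0 g); last by right; exists g.
  by apply/eqP => g0; have := row_free_unit g; rewrite gu => /row_freeP[h gh];
     have /matrixP/(_ 0 0)/eqP := congr1 (row 0) gh; rewrite row_mul g0 mul0mx !mxE eq_sym oner_eq0.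
- by left; rewrite /= scaler0.
- case=> g [gu /= <- z]; right; exists (c%:M *m g); split.
  + by rewrite unitmx_mul gu unitmxE det_scalar unitfE expf_neq0.
  + by rewrite mul_scalar_mx linearZ.
  + apply: fZ; rewrite ?scalar_mx_is_trig //.
    by rewrite unitmxE det_scalar unitfE expf_neq0.
Qed.
End Flags.

(** * The theorems of Lie-Kolchin and Borel *)

Section FixedPoints.
Variables (K : closedFieldType) (G : groupType).
Context {sG : space K G}.
Hypothesis polM : polmap (K := K) (fun gh : G * G => gh.1 * gh.2)%g.
Hypothesis polV : polmap (K := K) (fun g : G => g^-1)%g.
Implicit Types H : set G.

Lemma polmap_mulg T {s : space K T} (phi psi : T -> G) :
  polmap phi -> polmap psi -> polmap (fun t => phi t * psi t)%g.
Proof. by move=> h1 h2; exact: (polmap_comp (polmap_pair h1 h2) polM). Qed.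

Lemma polmap_invg T {s : space K T} (phi : T -> G) :
  polmap phi -> polmap (fun t => (phi t)^-1)%g.
Proof. by move=> h; exact: (polmap_comp h polV). Qed.

Lemma subgroup_genP (A : set G) : is_subgroup (subgroup_gen A) /\ A `<=` subgroup_gen A.
Proof.
split; last by move=> x Ax N _; exact.
split=> [N [N1 _ _] _ //|x y hx hy N sN AN|x hx N sN AN].
  by case: (sN) => _ NM _; apply: (NM); [exact: hx|exact: hy].
by case: (sN) => _ _ NV; apply: NV; exact: hx.
Qed.

Lemma derived_comm H x y : H x -> H y -> derived H [~ x, y]%g.
Proof. by move=> Hx Hy; apply: (subgroup_genP _).2; exists x, y. Qed.

Lemma derived_subgroup H : is_subgroup (derived H).
Proof. exact: (subgroup_genP _).1. Qed.

Lemma derived_sub H N : is_subgroup N ->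
  (forall x y, H x -> H y -> N [~ x, y]%g) -> derived H `<=` N.
Proof. by move=> sN h z; apply=> // _ [x [y [Hx Hy ->]]]; exact: h. Qed.

Lemma subgroup_comm H x y : is_subgroup H -> H x -> H y -> H [~ x, y]%g.
Proof.
by case=> _ HM HV Hx Hy; rewrite /commg /conjg; apply: (HM _ _ (HV _ Hx)); apply: (HM _ _ (HV _ Hy)); exact: HM.
Qed.

Lemma derived_le H : is_subgroup H -> derived H `<=` H.
Proof. by move=> sH; apply: derived_sub => // x y; exact: subgroup_comm. Qed.

Lemma derived_conj H g z : is_subgroup H -> H g -> derived H z ->
  derived H (g * z * g^-1)%g.
Proof.
move=> sH Hg dz; have Hz := derived_le sH dz; case: (sH) => _ HM HV.
have -> : (g * z * g^-1 = z * [~ z, g^-1])%g.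
  by rewrite commgEl /conjg invgK !mulgA mulgV mul1g.
by case: (derived_subgroup H) => _ dM _; apply: (dM) => //; apply: derived_comm => //; exact: HV.
Qed.

(** The points [z] and [z [x, y]] lie in the connected image of [H] under [y |-> z [x, y]], hence in
    the same piece. So the elements whose right translations preserve the piece [C] form a subgroup
    containing all commutators. *)
Lemma derived_conn H : is_subgroup H -> conn H -> conn (derived H).
Proof.
move=> sH cH; have [d1 dM dV] := derived_subgroup H.
have [H1 HM HV] := sH.
suff aux C D : closedp (s := sG) C -> closedp (s := sG) D -> derived H `<=` C `|` D ->
    derived H `&` C `&` D = set0 -> C 1%g -> derived H `<=` C.
  move=> C D cC cD sub dis; have [C1|D1] := sub _ d1.
    by left; apply: (aux C D).
  right; apply: (aux D C) => //; first by rewrite setUC.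
  by rewrite setIAC.
move=> cC cD sub dis C1.
have step z x y : derived H z -> C z -> H x -> H y -> C (z * [~ x, y])%g.
  move=> dz Cz Hx Hy; pose phi y := (z * [~ x, y])%g.
  have pphi : polmap (K := K) phi.
    apply: polmap_mulg; first exact: polmap_cst.
    rewrite /commg; apply: polmap_mulg; first exact: polmap_cst.
    rewrite /conjg; apply: polmap_mulg; first exact: polmap_invg (@polmap_id _ _ _).
    by apply: polmap_mulg; [exact: polmap_cst|exact: polmap_id].
  have sub' : phi @` H `<=` derived H.
    by move=> _ [w Hw <-]; apply: (dM) => //; exact: derived_comm.
  have [|||h] := conn_image pphi cH cC cD.
  - by apply: subset_trans sub.
  - by rewrite -subset0 -dis => w [[/sub' dw Cw] Dw].
  - by apply; exists y.
  have Dz : D z by apply: h; exists 1%g => //; rewrite /phi commg1 mulg1.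
  by have : (set0 : set G) z by rewrite -dis.
pose N := [set w | derived H w /\ forall z, derived H z -> C z <-> C (z * w)%g].
suff sub1 : derived H `<=` N.
  by move=> w dw; have [_ /(_ 1%g d1)[/(_ C1)]] := sub1 w dw; rewrite mul1g.
apply: derived_sub; first split.
- by split=> // z; rewrite mulg1.
- move=> x y [dx hx] [dy hy]; split; first exact: dM.
  by move=> z dz; rewrite mulgA (hx z dz) (hy (z * x)%g) //; exact: dM.
- move=> x [dx hx]; split; first exact: dV.
  move=> z dz; rewrite (hx (z * x^-1)%g); first by rewrite mulgVK.
  by apply: (dM) => //; exact: dV.
move=> x y Hx Hy; split=> [|z dz]; first exact: derived_comm.
split=> [Cz|Cz]; first exact: step.
have -> : z = ((z * [~ x, y]) * [~ y, x])%g by rewrite -mulgA -(invgR x y) mulgV mulg1.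
by apply: step => //; apply: (dM) => //; exact: derived_comm.
Qed.

(** Polynomial on all of [G] but multiplicative only on [H]: a subspace stable under [H] alone then
    carries a [rep_on H] given by a formula on [G]. *)
Definition rep_on H n (phi : G -> 'M[K]_n) :=
  [/\ polmap phi, phi 1%g = 1%:M &
      forall g h, H g -> H h -> phi (g * h)%g = phi g *m phi h].

Lemma rep_on_sub H N n (phi : G -> 'M[K]_n) : N `<=` H -> rep_on H phi -> rep_on N phi.
Proof. by move=> NH [pp p1 pM]; split=> // g h /NH Hg /NH Hh; exact: pM. Qed.

Lemma rep_onV H n (phi : G -> 'M[K]_n) h : is_subgroup H -> rep_on H phi -> H h ->
  phi h *m phi h^-1%g = 1%:M /\ phi h^-1%g *m phi h = 1%:M.
Proof.
move=> [_ _ HV] [_ p1 pM] Hh; rewrite -!pM ?mulgV ?mulVg //; exact: HV.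
Qed.

Lemma rep_on_unit H n (phi : G -> 'M[K]_n) h : is_subgroup H -> rep_on H phi -> H h ->
  phi h \in unitmx.
Proof. by move=> sH rH /(rep_onV sH rH)[/mulmx1_unit[]]. Qed.

Lemma subrep_on H n m (phi : G -> 'M[K]_n) (B : 'M[K]_(m, n)) :
  rep_on H phi -> row_free B -> (forall h, H h -> (B *m phi h <= B)%MS) ->
  exists phi', rep_on H phi' /\ forall h, H h -> phi' h *m B = B *m phi h.
Proof.
move=> [pp p1 pM] fB sB; exists (fun h => B *m phi h *m pinvmx B).
have KB h : H h -> B *m phi h *m pinvmx B *m B = B *m phi h.
  by move=> /sB; exact: mulmxKpV.
split=> //; split.
- by do 2!apply: polmap_mulmx => //; exact: polmap_cst.
- by rewrite p1 mulmx1 mulmxVp.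
- by move=> g h Hg Hh /=; rewrite pM //; move: (pinvmx B) KB => P KB; rewrite !mulmxA KB.
Qed.

(** [U] is a subspace of largest dimension inside [P]; a vector of [P] outside it could be added. *)
Lemma linear_set_mx n (P : set 'rV[K]_n) : P 0 -> (forall c u v, P u -> P v -> P (c *: u + v)) ->
  exists U : 'M[K]_n, forall v, P v <-> (v <= U)%MS.
Proof.
move=> P0 PD.
pose good r := `[< exists U : 'M[K]_n, (forall v, (v <= U)%MS -> P v) /\ \rank U = r >].
have g0 : exists r, good r.
  by exists 0%N; apply/asboolP; exists 0; split=> [v|]; rewrite ?submx0 ?mxrank0 // => /eqP ->.
have gn r : good r -> (r <= n)%N by move=> /asboolP[U [_ <-]]; exact: rank_leq_row.
case: (ex_maxnP g0 gn) => r /asboolP[U [UP rU]] maxr; exists U => v; split; last exact: UP.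
move=> Pv; apply: contraT => vU.
have : good (\rank (U + v)%MS).
  apply/asboolP; exists (U + v)%MS; split=> // w /sub_addsmxP[[a b] ->] /=.
  rewrite addrC [b]mx11_scalar mul_scalar_mx; apply: PD => //.
  by apply: UP; exact: submxMl.
move/maxr; rewrite -rU leqNgt => /negP[]; rewrite rank_ltmx // /ltmx addsmxSl.
by apply: contra vU; apply: submx_trans; exact: addsmxSr.
Qed.

Lemma eigen_exists n (A : 'M[K]_n) : (0 < n)%N -> exists a, eigenvalue A a.
Proof.
move=> n0; have /closed_rootP[a ra] : size (char_poly A) != 1%N.
  by rewrite size_char_poly eqSS -lt0n.
by exists a; rewrite eigenvalue_root_char.
Qed.

Lemma poly_roots_seq (p : {poly K}) : p != 0 -> exists r : seq K, forall x, root p x -> x \in r.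
Proof.
move=> p0; have [r ep] := closed_field_poly_normal p; exists r => x.
by rewrite ep rootZ ?lead_coef_eq0 // root_prod_XsubC.
Qed.

Definition irreducible_on H n (phi : G -> 'M[K]_n) :=
  forall P : set 'rV[K]_n, P 0 -> (forall c u v, P u -> P v -> P (c *: u + v)) ->
    (forall h v, H h -> P v -> P (v *m phi h)) -> (exists2 v, v != 0 & P v) ->
    forall v, P v.

Lemma irreducible_subrep H n (phi : G -> 'M[K]_n) : (0 < n)%N -> rep_on H phi ->
  exists m (B : 'M[K]_(m, n)) phi', [/\ (0 < m)%N, row_free B, rep_on H phi',
    irreducible_on H phi' & forall h, H h -> phi' h *m B = B *m phi h].
Proof.
move=> n0 rphi.
pose good r := `[< exists U : 'M[K]_n, [/\ U != 0, \rank U = r &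
                    forall h, H h -> (U *m phi h <= U)%MS] >].
have g0 : exists r, good r.
  exists n; apply/asboolP; exists 1%:M; split=> [||h _]; [|exact: mxrank1|exact: submx1].
  by rewrite -mxrank_eq0 mxrank1 -lt0n.
case: (ex_minnP g0) => r /asboolP[U [U0 rU sU]] minr.
have fB := row_base_free U.
have sB h : H h -> (row_base U *m phi h <= row_base U)%MS.
  move=> Hh; rewrite eq_row_base; apply: submx_trans (sU h Hh).
  by apply: submxMr; rewrite eq_row_base.
have [phi' [rphi' ephi']] := subrep_on rphi fB sB.
exists (\rank U), (row_base U), phi'; split=> //.
  by rewrite lt0n mxrank_eq0.
move=> P P0 PD Pst [v v0 Pv] w; have [W WP] := linear_set_mx P0 PD.
apply/WP; apply: submx_full; rewrite -col_leq_rank.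
suff h : (r <= \rank W)%N by apply: leq_trans h; rewrite rU.
have : good (\rank (<<W *m row_base U>>%MS : 'M_n)).
  apply/asboolP; exists <<W *m row_base U>>%MS; split=> //.
    rewrite -mxrank_eq0 genmxE mxrankMfree // mxrank_eq0; apply: contra v0 => /eqP W0.
    by move/WP: Pv; rewrite W0 submx0.
  move=> h Hh; rewrite (eqmxMr _ (genmxE _)) !genmxE -mulmxA -ephi' // mulmxA.
  apply: submxMr; apply/row_subP => i; rewrite row_mul; apply/WP; apply: Pst => //.
  by apply/WP; exact: row_sub.
by move/minr; rewrite genmxE mxrankMfree //.
Qed.

(** Induction on the derived length, inside an irreducible subrepresentation [psi]. The weight space
    of [derived H] given by induction is stable under [H], hence everything, so [derived H] acts by
    scalars. These have determinant 1 and, by connectedness, equal 1. Then [H] acts by commuting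
    matrices, each eigenspace is stable, and [H] itself acts by scalars. *)
Theorem lie_kolchin H n (phi : G -> 'M[K]_n) :
  is_subgroup H -> conn H -> is_solvable H -> rep_on H phi -> (0 < n)%N ->
  exists2 a : 'rV[K]_n, a != 0 & forall h, H h -> exists c, a *m phi h = c *: a.
Proof.
move=> sH cH [k]; elim: k H n phi sH cH => [|k IH] H n phi sH cH solH rphi n0.
  exists (const_mx 1) => [|h /solH /= ->].
    by apply/eqP => /matrixP/(_ 0 (Ordinal n0))/eqP; rewrite !mxE oner_eq0.
  by case: rphi => _ -> _; exists 1; rewrite mulmx1 scale1r.
have [m [B [psi [m0 fB rpsi irr epsi]]]] := irreducible_subrep n0 rphi.
suff [a a0 ha] : exists2 a : 'rV[K]_m, a != 0 &
    forall h, H h -> exists c, a *m psi h = c *: a.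
  exists (a *m B) => [|h Hh]; first by rewrite -(mul0mx _ B) (inj_eq (row_free_inj fB)).
  by have [c hc] := ha h Hh; exists c; rewrite -mulmxA -epsi // mulmxA hc scalemxAl.
have sD := derived_subgroup H; have cD := derived_conn sH cH; have DH := derived_le sH.
have [H1 HM HV] := sH; have [d1 dM dV] := sD; have [pp p1 pM] := rpsi.
have [|a a0 ha] := IH (derived H) m psi sD cD _ (rep_on_sub DH rpsi) m0.
  by rewrite iterSr in solH.
have [j aj] : exists j, a 0 j != 0.
  apply: contrapT => /forallNP h; case/eqP: a0; apply/rowP => j.
  by rewrite mxE; apply/eqP; apply: contrapT => /negP; exact: h.
pose chi z := (a *m psi z) 0 j / a 0 j.
have chiE z : derived H z -> a *m psi z = chi z *: a.
  by move=> /ha[c hc]; rewrite /chi hc mxE mulfK.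
have pchi : pol chi.
  apply: pol_mul (pol_cst _); apply: pol_entry; apply: polmap_mulmx => //; exact: polmap_cst.
have chi1 : chi 1%g = 1 by rewrite /chi p1 mulmx1 divff.
(* The values of [g |-> chi (g z g^-1)] are eigenvalues of [psi z]. *)
have scalar (v : 'rV_m) z : derived H z -> v *m psi z = chi z *: v.
  move=> dz; pose P := [set v : 'rV_m | forall z, derived H z -> v *m psi z = chi z *: v].
  suff : P v by move/(_ z dz).
  apply: irr => [z' _|c u w Pu Pw z' dz'|h w Hh Pw z' dz'|].
  - by rewrite mul0mx scaler0.
  - by rewrite mulmxDl -scalemxAl Pu // Pw // scalerDr !scalerA mulrC.
  - have [->|w0] := eqVneq w 0; first by rewrite !mul0mx scaler0.
    have key g : H g -> w *m psi g *m psi z' = chi (g * z' * g^-1)%g *: (w *m psi g).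
      move=> Hg; have dz'' := derived_conj sH Hg dz'.
      rewrite -mulmxA -pM //; last exact: DH.
      have -> : (g * z' = g * z' * g^-1 * g)%g by rewrite mulgVK.
      rewrite pM //; last exact: DH.
      by rewrite mulmxA Pw // mulgVK scalemxAl.
    rewrite key //; congr (_ *: _).
    have [r hr] := poly_roots_seq (monic_neq0 (char_poly_monic (psi z'))).
    have -> : chi z' = chi (1 * z' * 1^-1)%g by rewrite mul1g invg1 mulg1.
    apply: (conn_finite_value (f := fun g => chi (g * z' * g^-1)%g) (r := r) _ cH) => //.
      apply: (pol_comp (phi := fun g => g * z' * g^-1)%g) => //.
      apply: polmap_mulg; last exact: polmap_invg (@polmap_id _ _ _).
      by apply: polmap_mulg; [exact: polmap_id|exact: polmap_cst].
    move=> g Hg /=; apply: hr; rewrite -eigenvalue_root_char; apply/eigenvalueP.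
    exists (w *m psi g); first exact: key.
    apply: contra w0 => /eqP e; rewrite -[w]mulmx1 -(rep_onV sH rpsi Hg).1 mulmxA e.
    by rewrite mul0mx.
  - by exists a.
have psiE z : derived H z -> psi z = (chi z)%:M.
  move=> dz; apply/row_matrixP => i; rewrite rowE (scalar _ _ dz).
  by rewrite [in RHS]rowE -scalemx1 -scalemxAr mulmx1.
have detD z : derived H z -> \det (psi z) = 1.
  suff sub : derived H `<=` [set z | H z /\ \det (psi z) = 1] by move=> /sub[].
  apply: derived_sub; first split=> [|x y [Hx ex] [Hy ey]|x [Hx ex]].
  - by split=> //; rewrite p1 det1.
  - by split; [exact: HM|rewrite pM // det_mulmx ex ey mulr1].
  - split; first exact: HV.
    by have := congr1 determinant (rep_onV sH rpsi Hx).1; rewrite det_mulmx ex mul1r det1.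
  move=> x y Hx Hy; have Hc := subgroup_comm sH Hx Hy; split=> //.
  have := congr1 (fun g => \det (psi g)) (commgC x y).
  rewrite (pM x y) // (pM _ [~ x, y]%g) //; last exact: HM.
  rewrite (pM y x) // !det_mulmx.
  have : \det (psi x) * \det (psi y) != 0.
    by rewrite mulf_neq0 // -unitfE -unitmxE; exact: (rep_on_unit sH).
  by move=> n1 e; apply: (mulfI n1); rewrite mulr1 [RHS]e; congr (_ * _); exact: mulrC.
(* By [detD] the scalar [chi z] is an [m]-th root of unity; on a connected group it keeps its value
   at 1. *)
have chi_1 z : derived H z -> chi z = 1.
  move=> dz; rewrite -chi1.
  have [r hr] := @poly_roots_seq ('X^m - 1%:P) (monic_neq0 (monicXnsubC 1 m0)).
  apply: (conn_finite_value (f := chi) (r := r) _ cD) => // t dt; apply: hr.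
  by rewrite rootE !hornerE -(detD t dt) psiE // det_scalar subrr.
have comm g h : H g -> H h -> psi g *m psi h = psi h *m psi g.
  move=> Hg Hh; rewrite -!pM // [in LHS]commgC (pM _ [~ g, h]%g) //.
  - by rewrite (psiE [~ g, h]%g) ?chi_1 ?mulmx1 //; exact: derived_comm.
  - exact: HM.
  - exact: subgroup_comm.
exists a => // h Hh; have [c /eigenvalueP[w hw w0]] := eigen_exists (psi h) m0; exists c.
apply: (irr [set v : 'rV_m | v *m psi h = c *: v]) => /=.
- by rewrite mul0mx scaler0.
- by move=> b u v hu hv; rewrite mulmxDl -scalemxAl hu hv scalerDr !scalerA mulrC.
- by move=> g v Hg hv; rewrite -mulmxA comm // mulmxA hv scalemxAl.
- by exists w.
Qed.

Lemma pol_horner (f : K -> K) : pol f -> exists p : {poly K}, forall x, f x = p.[x].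
Proof.
elim=> {f} [a|_ ->|f g _ [p ep] _ [q eq]|f g _ [p ep] _ [q eq]].
- by exists a%:P => x; rewrite hornerC.
- by exists 'X => x; rewrite hornerX.
- by exists (p + q) => x; rewrite hornerD ep eq.
- by exists (p * q) => x; rewrite hornerM ep eq.
Qed.

(* A complete variety in an affine space is finite. *)
Lemma cone_ratio_finite n (Y : set 'rV[K]_n) (l : 'cV[K]_n) j :
  closedp Y -> (forall c a, c != 0 -> Y a -> Y (c *: a)) ->
  (forall a, Y a -> a != 0 -> (a *m l) 0 0 != 0) ->
  exists r : seq K, forall a, Y a -> a != 0 -> a 0 j / (a *m l) 0 0 \in r.
Proof.
case: n Y l j => [|n] Y l j; first by case: j.
move=> cY coneY Yl.
(* The second component is the inverse of the ratio sought. It is never 0, as [l] has no zero on [Y]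
   outside the origin; so the image in the line, closed by elimination, is proper and therefore
   finite. *)
pose Z := [set ac : 'rV[K]_n.+1 * K | Y ac.1 /\ ac.2 * ac.1 0 j = (ac.1 *m l) 0 0].
have cZ : closedp (K := K) Z.
  have p1 : polmap (K := K) (fun ac : 'rV[K]_n.+1 * K => ac.1) by exact: polmap_fst (@polmap_id _ _ _).
  have p2 : polmap (K := K) (fun ac : 'rV[K]_n.+1 * K => ac.2) by exact: polmap_snd (@polmap_id _ _ _).
  apply: (@closedp_and K _ _ [set ac | Y ac.1] [set ac : 'rV[K]_n.+1 * K | ac.2 * ac.1 0 j = (ac.1 *m l) 0 0]).
    exact: closedp_preimage p1 cY.
  apply: (@closedp_ext K _ _ [set ac : 'rV[K]_n.+1 * K | ac.2 * ac.1 0 j - (ac.1 *m l) 0 0 = 0]).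
    by split=> ac /=; [move/subr0_eq|move->; rewrite subrr].
  apply: closedp0; apply: pol_sub; last by apply: pol_entry; apply: polmap_mulmx => //; exact: polmap_cst.
  by apply: pol_mul; [exact: polmap_pol|exact: pol_entry].
have coneZ c a y : c != 0 -> Z (a, y) -> Z (c *: a, y).
  move=> c0 [/= Ya e]; split=> /=; first exact: coneY.
  by rewrite -scalemxAl !mxE mulrCA e mxE.
have [[a a0 [Ya /= /esym/eqP]]|f [/pol_horner[p ep] f0 fn0]] := elimination cZ coneZ (t := 0).
  by rewrite mul0r (negbTE (Yl a Ya a0)).
have p0 : p != 0 by apply: contraNneq fn0 => p0; rewrite ep p0 horner0.
have [r hr] := poly_roots_seq p0; exists (0 :: map GRing.inv r) => a Ya a0.
have [->|aj] := eqVneq (a 0 j) 0; first by rewrite mul0r mem_head.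
rewrite inE; apply/orP; right; rewrite -[_ / _]invrK invf_div; apply: map_f; apply: hr.
rewrite rootE -ep f0 //; exists a => //; split=> //=.
by rewrite divfK.
Qed.

(** Borel's fixed point theorem in projective space. Lie-Kolchin for the dual representation gives a
    linear form [l] that [H] scales. If [Y] has a nonzero point on the hyperplane [l = 0], induct
    there. Otherwise the ratios of coordinates to [l] take finitely many values on [Y], so
    connectedness makes [H] fix every line of [Y]. *)
Lemma fixed_line H n (phi : G -> 'M[K]_n) (Y : set 'rV[K]_n) :
  is_subgroup H -> conn H -> is_solvable H -> rep_on H phi ->
  closedp Y -> (forall c a, c != 0 -> Y a -> Y (c *: a)) ->
  (forall a h, Y a -> H h -> Y (a *m phi h)) -> (exists2 a, a != 0 & Y a) ->
  exists a, [/\ a != 0, Y a & forall h, H h -> exists c, a *m phi h = c *: a].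
Proof.
move=> sH cH solH; elim/ltn_ind: n phi Y => n IH phi Y rphi cY coneY stY [a a0 Ya].
have n0 : (0 < n)%N by case: n a a0 {Ya stY coneY cY rphi Y phi IH} => // a; rewrite thinmx0 eqxx.
have [pp p1 pM] := rphi; have [H1 HM HV] := sH.
have rdual : rep_on H (fun h => (phi h^-1%g)^T).
  split; first by apply: polmap_trmx; apply: (polmap_comp _ pp); exact: polmap_invg (@polmap_id _ _ _).
    by rewrite invg1 p1 trmx1.
  by move=> g h Hg Hh; rewrite invgM pM ?trmx_mul //; exact: HV.
have [l' l'0 hl'] := lie_kolchin sH cH solH rdual n0.
pose l := l'^T; have l0 : l != 0 by rewrite trmx_eq0.
have hl h : H h -> exists c, phi h *m l = c *: l.
  move=> /HV/hl'[c]; rewrite invgK => e; exists c.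
  by rewrite -[phi h]trmxK -trmx_mul e linearZ.
have [[b [b0 Yb bl]]|nb] := pselect (exists b, [/\ b != 0, Y b & b *m l = 0]).
  pose B := row_base (kermx l); have fB : row_free B := row_base_free _.
  have sB h : H h -> (B *m phi h <= B)%MS.
    move=> /hl[c hc]; rewrite /B eq_row_base; apply/sub_kermxP.
    rewrite -mulmxA hc -scalemxAr (sub_kermxP _) ?scaler0 //.
    by rewrite eq_row_base.
  have [psi [rpsi epsi]] := subrep_on rphi fB sB.
  have lt : (\rank (kermx l) < n)%N.
    rewrite mxrank_ker ltn_subrL n0 andbT lt0n mxrank_eq0 //.
  have bB : b = b *m pinvmx B *m B.
    by rewrite mulmxKpV // eq_row_base; apply/sub_kermxP.
  have pB : polmap (K := K) (fun a : 'rV[K]_(\rank (kermx l)) => a *m B).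
    by apply: polmap_mulmx; [exact: polmap_id|exact: polmap_cst].
  have [|||a' [a'0 Ya' ha']] := IH _ lt psi _ rpsi (closedp_preimage pB cY).
  - by move=> c u c0 /=; rewrite -scalemxAl; exact: coneY.
  - by move=> u h /= Yu Hh; rewrite -mulmxA epsi // mulmxA; exact: stY.
  - exists (b *m pinvmx B); last by rewrite /= -bB.
    by apply: contra b0 => /eqP e; rewrite bB e mul0mx.
  exists (a' *m B); split=> // [|h Hh].
    by rewrite -(mul0mx _ B) (inj_eq (row_free_inj fB)).
  by have [c hc] := ha' h Hh; exists c; rewrite -mulmxA -epsi // mulmxA hc scalemxAl.
have Yl u : Y u -> u != 0 -> (u *m l) 0 0 != 0.
  move=> Yu u0; apply/eqP => e; apply: nb; exists u; split=> //.
  by rewrite [LHS]mx11_scalar e; apply/matrixP => i k; rewrite !mxE mul0rn.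
exists a; split=> // h Hh.
pose s := (a *m l) 0 0; have s0 : s != 0 by exact: Yl.
pose chi h := (a *m phi h *m l) 0 0 / s.
have chiE g : H g -> phi g *m l = chi g *: l.
  by move=> /hl[c hc]; rewrite /chi -mulmxA hc -scalemxAr mxE mulfK.
have pchi : pol (K := K) chi.
  apply: pol_mul (pol_cst _); apply: pol_entry; apply: polmap_mulmx (polmap_cst _).
  by apply: polmap_mulmx => //; exact: polmap_cst.
have chiV g : H g -> chi g * chi g^-1%g = 1.
  move=> Hg; have := congr1 (mulmx (a *m phi g)) (chiE _ (HV _ Hg)).
  rewrite mulmxA -(mulmxA a) (rep_onV sH rphi Hg).1 mulmx1 -scalemxAr => /matrixP/(_ 0 0).
  by rewrite [in RHS]mxE /chi -/s => e; rewrite mulrAC [_ * (_ / s)]mulrC -e divff.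
exists (chi h); apply/rowP => j; rewrite [RHS]mxE.
suff : (a *m phi h) 0 j * chi h^-1%g = a 0 j.
  by move=> <-; rewrite mulrCA chiV // mulr1.
have [r hr] := cone_ratio_finite j cY coneY Yl.
have -> : a 0 j = (a *m phi 1%g) 0 j * chi 1^-1%g.
  by rewrite p1 mulmx1 invg1 /chi p1 mulmx1 divff // mulr1.
apply: (conn_finite_value (f := fun h => (a *m phi h) 0 j * chi h^-1%g) (r := map ( *%R s) r) _ cH) => //.
  apply: pol_mul; first by apply: pol_entry; apply: polmap_mulmx => //; exact: polmap_cst.
  by apply: pol_comp pchi; exact: polmap_invg (@polmap_id _ _ _).
move=> g Hg /=; apply/mapP; exists ((a *m phi g) 0 j / (a *m phi g *m l) 0 0).
  apply: hr; first exact: stY.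
  by apply: contra a0 => /eqP e; rewrite -[a]mulmx1 -(rep_onV sH rphi Hg).1 mulmxA e mul0mx.
have chiVE : chi g^-1%g = (chi g)^-1.
  by rewrite -[RHS]mulr1 -(chiV g Hg) mulKf //; apply/eqP => c0;
     have /eqP := chiV g Hg; rewrite c0 mul0r eq_sym oner_eq0.
by rewrite chiVE /chi invf_div mulrCA.
Qed.

Lemma mulmx_lblock1 n (a a' : 'M[K]_1) (b b' : 'cV[K]_n) (x x' : 'M[K]_n) :
  (block_mx a 0 b x : 'M[K]_n.+1) *m (block_mx a' 0 b' x' : 'M[K]_n.+1) =
  block_mx (a *m a') 0 (b *m a' + x *m b') (x *m x') :> 'M[K]_n.+1.
Proof.
have := @mulmx_block K 1 n 1 n 1 n a 0 b x a' 0 b' x'.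
by rewrite !mul0mx !mulmx0 !addr0 !add0r.
Qed.

(** [fixed_line], applied to the closed cone of first lines of the flags in [Y], fixes a line;
    conjugating by [g] makes the action block triangular, and induction applies to the flags of the
    quotient that complete this line to a member of [Y]. *)
Lemma fixed_flag H n (phi : G -> 'M[K]_n) (Y : set 'M[K]_n) :
  is_subgroup H -> conn H -> is_solvable H -> rep_on H phi ->
  closedp Y ->
  (forall l g, l \in unitmx -> is_trig_mx l -> g \in unitmx -> Y g -> Y (l *m g)) ->
  (forall g h, g \in unitmx -> Y g -> H h -> Y (g *m phi h)) ->
  (exists2 g, g \in unitmx & Y g) ->
  exists g, [/\ g \in unitmx, Y g &
    forall h, H h -> is_trig_mx (g *m phi h *m invmx g)].
Proof.
move=> sH cH solH; elim: n phi Y => [|n IH] phi Y rphi cY fY stY [g0 g0u Yg0].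
  by exists g0; split=> // h _; apply/is_trig_mxP => -[].
have [pp p1 pM] := rphi.
pose Y1 := [set a : 'rV[K]_n.+1 | a = 0 \/ exists g, [/\ g \in unitmx, row 0 g = a & Y g]].
have cY1 : closedp (K := K) Y1.
  pose Z := [set gy : 'M[K]_n.+1 * K | Y gy.1].
  have cZ : closedp (K := K) Z by apply: closedp_preimage cY; exact: polmap_fst (@polmap_id _ _ _).
  have fZ : flag_set Z by move=> l g y /=; exact: fY.
  have p0 : polmap (K := K) (fun a : 'rV[K]_n.+1 => (a, 0 : K)).
    by apply: polmap_pair; [exact: polmap_id|exact: polmap_cst].
  exact: (closedp_preimage p0 (first_row_closed (@flags_complete K n) cZ fZ)).
have [|||a [a0 [/eqP e|[g [gu ga Yg]]] ha]] := fixed_line sH cH solH rphi cY1.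
- move=> c a c0 [->|[g [gu ga Yg]]]; [by left; rewrite scaler0|right].
  exists (c%:M *m g); split.
  + by rewrite unitmx_mul gu unitmxE det_scalar unitfE expf_neq0.
  + by rewrite mul_scalar_mx linearZ /= ga.
  + by apply: fY; rewrite ?scalar_mx_is_trig // unitmxE det_scalar unitfE expf_neq0.
- move=> a h [->|[g [gu ga Yg]]] Hh; [by left; rewrite mul0mx|right].
  exists (g *m phi h); split; last exact: stY.
    by rewrite unitmx_mul gu; exact: rep_on_unit rphi Hh.
  by rewrite row_mul ga.
- exists (row 0 g0); last by right; exists g0.
  apply/eqP => e; have /matrixP/(_ 0 0)/eqP := congr1 (row 0) (mulmxV g0u).
  by rewrite row_mul e mul0mx !mxE eq_sym oner_eq0.
- by rewrite e in a0.
pose psi h : 'M[K]_(1 + n) := g *m phi h *m invmx g.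
pose phi' h := drsubmx (psi h).
have psiE h : H h -> exists2 c, c != 0 & psi h = block_mx c%:M 0 (dlsubmx (psi h)) (phi' h).
  move=> Hh; have [c hc] := ha h Hh; exists c.
    apply: contraNneq a0 => c0; rewrite c0 scale0r in hc.
    by rewrite -[a]mulmx1 -(rep_onV sH rphi Hh).1 mulmxA hc mul0mx.
  have e : usubmx (psi h) = row_mx c%:M 0.
    rewrite -row0_usubmx /psi -mulmxA row_mul ga mulmxA hc -ga -scalemxAl -row_mul.
    by rewrite mulmxV // row1 (@delta_row_mx K n) scale_row_mx scalemx1 scaler0.
  by rewrite -[psi h in LHS]submxK /ulsubmx /ursubmx e row_mxKl row_mxKr.
have psiM x y : H x -> H y -> psi (x * y)%g = psi x *m psi y.
  by move=> Hx Hy; rewrite /psi pM // !mulmxA mulmxKV.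
have rphi' : rep_on H phi'.
  split.
  - apply: polmap_mx => i j.
    apply: (@eq_pol K _ _ (fun h => psi h (rshift 1 i) (rshift 1 j))).
      by move=> h; rewrite [RHS]mxE [RHS]mxE.
    apply: pol_entry.
    by apply: polmap_mulmx; [apply: polmap_mulmx => //|]; exact: polmap_cst.
  - by rewrite /phi' /psi p1 mulmx1 mulmxV // (@scalar_mx_block _ 1 n 1) block_mxKdr.
  - move=> x y Hx Hy; rewrite /phi' psiM //.
    have [c _ ->] := psiE x Hx; have [d _ ->] := psiE y Hy.
    by rewrite mulmx_block !block_mxKdr mulmx0 add0r.
pose emb (x : 'M[K]_n) : 'M[K]_n.+1 := block_mx (1%:M : 'M_1) 0 0 x.
have pemb : polmap (K := K) emb.
  apply: (@polmap_col_mx K _ _ 1 n (1 + n)); apply: (@polmap_row_mx K _ _ _ 1 n);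
    by [exact: polmap_cst|exact: polmap_id].
have embu x : (emb x \in unitmx) = (x \in unitmx) by exact: unitmx_ublock1.
have embM x y : emb (x *m y) = emb x *m emb y.
  by rewrite /emb mulmx_lblock1 mul1mx mul0mx mulmx0 addr0.
have emb1 : emb 1%:M = 1%:M by rewrite [RHS](@scalar_mx_block _ 1 n 1).
have pY' : polmap (fun x => emb x *m g) by apply: polmap_mulmx => //; exact: polmap_cst.
have embpsi x h : H h -> exists c, [/\ c != 0 &
    emb x *m psi h = block_mx c%:M 0 (x *m dlsubmx (psi h)) (x *m phi' h)].
  move=> Hh; have [c c0 e] := psiE h Hh; exists c; split=> //.
  by rewrite {1}e /emb mulmx_lblock1 mul1mx mul0mx add0r.
have [|||x [xu Yx hx]] := IH phi' [set x | Y (emb x *m g)] rphi' (closedp_preimage pY' cY).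
- move=> l x lu lt xu /= Yx; rewrite embM -mulmxA; apply: fY => //.
  + by rewrite embu.
  + exact: is_trig_lblock1.
  + by rewrite unitmx_mul embu xu.
- move=> x h xu /= Yx Hh; have [c [c0 e]] := embpsi x h Hh.
  have := stY _ _ _ Yx Hh; rewrite unitmx_mul embu xu gu => /(_ isT).
  have -> : emb x *m g *m phi h = emb x *m psi h *m g.
    by rewrite /psi -!mulmxA mulVmx // mulmx1.
  rewrite e; set dl := x *m dlsubmx _ => Y2.
  (* Acting by [h] disturbs only the first column of the representative; this triangular factor
     restores it. *)
  pose l : 'M[K]_n.+1 := block_mx (c^-1)%:M 0 (- c^-1 *: dl) 1%:M.
  have -> : emb (x *m phi' h) = l *m (block_mx (c%:M : 'M_1) 0 dl (x *m phi' h) : 'M[K]_n.+1).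
    rewrite /l /emb mulmx_lblock1 !mul1mx.
    rewrite -scalar_mxM mulVf // mul_mx_scalar scalerA mulrN mulfV //.
    by rewrite scaleN1r addNr.
  rewrite -mulmxA; apply: fY => //.
  + by rewrite unitmxE (@det_lblock K 1 n) det1 mulr1 det_scalar expr1 unitfE invr_eq0.
  + exact/is_trig_lblock1/scalar_mx_is_trig.
  + rewrite unitmx_mul gu andbT unitmxE (@det_lblock K 1 n) det_scalar expr1 unitfE.
    by rewrite mulf_neq0 // -unitfE -unitmxE unitmx_mul xu; exact: rep_on_unit rphi' Hh.
- by exists 1%:M; rewrite ?unitmx1 //= emb1 mul1mx.
exists (emb x *m g); split=> //; first by rewrite unitmx_mul embu xu.
move=> h Hh; have [c [c0 e]] := embpsi x h Hh.
have -> : invmx (emb x *m g) = invmx g *m emb (invmx x).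
  apply: (can_inj (@mulKmx _ _ n.+1 (emb x *m g) _)); first by rewrite unitmx_mul embu xu.
  by rewrite mulmxV ?unitmx_mul ?embu ?xu // -mulmxA mulKVmx // -embM mulmxV // emb1.
have -> : emb x *m g *m phi h *m (invmx g *m emb (invmx x)) = emb x *m psi h *m emb (invmx x).
  by rewrite /psi !mulmxA.
rewrite e /emb mulmx_lblock1 mulmx1; apply: is_trig_lblock1.
exact: hx.
Qed.
End FixedPoints.

(** * Hilbert's basis theorem and Nullstellensatz *)

Section Ideals.
Variable R : comNzRingType.
Implicit Types (I J Q S T : set R).

Definition ideal I := I 0 /\ forall a x y, I x -> I y -> I (a * x + y).

Lemma idealD I x y : ideal I -> I x -> I y -> I (x + y).
Proof. by move=> [_ IM] Ix Iy; rewrite -[x]mul1r; exact: IM. Qed.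

Lemma idealMl I a x : ideal I -> I x -> I (a * x).
Proof. by move=> [I0 IM] Ix; rewrite -[_ * _]addr0; exact: IM. Qed.

Lemma idealMr I a x : ideal I -> I x -> I (x * a).
Proof. by rewrite mulrC; exact: idealMl. Qed.

Lemma idealN I x : ideal I -> I x -> I (- x).
Proof. by move=> iI Ix; rewrite -mulN1r; exact: idealMl. Qed.

Lemma idealB I x y : ideal I -> I x -> I y -> I (x - y).
Proof. by move=> iI Ix Iy; apply: idealD => //; exact: idealN. Qed.

Lemma ideal_sum I (A : Type) (r : seq A) (P : pred A) (F : A -> R) :
  ideal I -> (forall i, P i -> I (F i)) -> I (\sum_(i <- r | P i) F i).
Proof.
move=> iI IF; apply: big_ind => //; first by case: iI.
by move=> x y; exact: idealD.
Qed.

Definition ideal_add I J : set R := [set z | exists x y, [/\ I x, J y & z = x + y]].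

Lemma ideal_addP I J : ideal I -> ideal J ->
  [/\ ideal (ideal_add I J), I `<=` ideal_add I J & J `<=` ideal_add I J].
Proof.
move=> iI iJ; have [I0 IM] := iI; have [J0 JM] := iJ; split.
- split; first by exists 0, 0; split; rewrite ?addr0.
  move=> a _ _ [x [y [Ix Jy ->]]] [x' [y' [Ix' Jy' ->]]].
  exists (a * x + x'), (a * y + y'); split; [exact: IM|exact: JM|ring].
- by move=> x Ix; exists x, 0; rewrite addr0.
- by move=> y Jy; exists 0, y; rewrite add0r.
Qed.

Definition principal x : set R := [set y | exists a, y = a * x].

Lemma principal_ideal x : ideal (principal x).
Proof.
split; first by exists 0; rewrite mul0r.
by move=> a _ _ [b ->] [c ->]; exists (a * b + c); ring.
Qed.

(** Serves both the Nullstellensatz, with [S] the powers of a polynomial and [T] empty, and Krull's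
    theorem. Zorn's lemma runs over sets whose union with [J] is an ideal, so that the empty chain
    has an admissible union. *)
Lemma maximal_ideal_avoiding J S T : ideal J -> J `&` S `<=` T ->
  exists Q, [/\ ideal Q, J `<=` Q, Q `&` S `<=` T &
    forall Q', ideal Q' -> Q `<=` Q' -> Q' `&` S `<=` T -> Q' `<=` Q].
Proof.
move=> iJ JST; have [J0 JM] := iJ.
pose P A := ideal (A `|` J) /\ (A `|` J) `&` S `<=` T.
have [F FP totF|A [[iA AST] maxA]] := @Zorn_bigcup R P.
  split; last first.
    move=> x [[[A FA Ax]|Jx] Sx]; last exact: JST.
    by apply: (FP A FA).2; split=> //; left.
  split; first by right.
  move=> a x y [[A FA Ax]|Jx] [[B FB By]|Jy]; last by right; exact: JM.
  - have [AB|BA] := totF _ _ FA FB.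
      have [_ /(_ a x y (or_introl (AB _ Ax)) (or_introl By))] := (FP B FB).1.
      by case=> h; [left; exists B|right].
    have [_ /(_ a x y (or_introl Ax) (or_introl (BA _ By)))] := (FP A FA).1.
    by case=> h; [left; exists A|right].
  - have [_ /(_ a x y (or_introl Ax) (or_intror Jy))] := (FP A FA).1.
    by case=> h; [left; exists A|right].
  - have [_ /(_ a x y (or_intror Jx) (or_introl By))] := (FP B FB).1.
    by case=> h; [left; exists B|right].
exists (A `|` J); split=> //.
move=> Q iQ AQ QST; apply: contrapT => nQ.
have QJ : Q `|` J = Q by apply/seteqP; split=> x; [case=> // Jx; apply: AQ; right|left].
apply: (maxA Q); last by rewrite /P QJ.
split=> [x Ax|QA]; first by apply: AQ; left.
by apply: nQ => x /QA; left.
Qed.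

Definition noetherian := forall I, ideal I -> exists s : seq R,
  (forall x, x \in s -> I x) /\
  (forall J, ideal J -> (forall x, x \in s -> J x) -> I `<=` J).

Lemma noetherian_span I : noetherian -> ideal I -> exists s : seq R,
  (forall x, x \in s -> I x) /\
  (forall x, I x -> exists c : 'I_(size s) -> R, x = \sum_i c i * s`_i).
Proof.
move=> nR /nR[s [Is minI]]; exists s; split=> //.
apply: (minI [set x | exists c : 'I_(size s) -> R, x = \sum_i c i * s`_i]).
  split; first by exists (fun=> 0); rewrite big1 // => i _; rewrite mul0r.
  move=> a _ _ [c ->] [d ->]; exists (fun i => a * c i + d i).
  by rewrite mulr_sumr -big_split; apply: eq_bigr => i _; rewrite mulrDl mulrA.
move=> x xs; have hx : (index x s < size s)%N by rewrite index_mem.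
exists (fun i => (i == Ordinal hx)%:R); rewrite (bigD1 (Ordinal hx)) //= eqxx mul1r.
by rewrite nth_index // big1 ?addr0 // => i /negbTE ->; rewrite mul0r.
Qed.

Lemma noetherian_chain (I : nat -> set R) : noetherian -> (forall n, ideal (I n)) ->
  (forall n, I n `<=` I n.+1) -> exists N, forall n, I n `<=` I N.
Proof.
move=> nR iI incI.
have inc m n : (m <= n)%N -> I m `<=` I n.
  by elim: n => [|n IH]; [rewrite leqn0 => /eqP ->|rewrite leq_eqVlt => /predU1P[->//|/IH h] x /h/incI].
have [] := nR [set x | exists n, I n x].
  split; first by exists 0%N; case: (iI 0%N).
  move=> a x y [m Ix] [n Iy]; exists (maxn m n); case: (iI (maxn m n)) => _; apply.
    exact: inc (leq_maxl _ _) _ Ix.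
  exact: inc (leq_maxr _ _) _ Iy.
move=> s [Is minI]; suff [N hN] : exists N, forall x, x \in s -> I N x.
  by exists N => n x Ix; apply: minI (iI N) hN _ _; exists n.
elim: s Is {minI} => [|x s IH] Is; first by exists 0%N.
have [|N hN] := IH; first by move=> y ys; apply: Is; rewrite inE ys orbT.
have [m Im] := Is x (mem_head _ _); exists (maxn m N) => y.
rewrite inE => /predU1P[->|/hN]; first exact: inc (leq_maxl _ _) _ Im.
exact: inc (leq_maxr _ _) _.
Qed.

End Ideals.

Lemma noetherian_surj (R S : comNzRingType) (f : {rmorphism S -> R}) :
  (forall x, exists y, f y = x) -> noetherian S -> noetherian R.
Proof.
move=> sf nS I [I0 IM].
have [|s [Is minI]] := nS (f @^-1` I).
  by split=> /= [|a x y Ix Iy]; rewrite ?rmorph0 // rmorphD rmorphM; exact: IM.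
exists (map f s); split=> [_ /mapP[y ys ->]|J [J0 JM] Js x Ix]; first exact: Is.
have [y ey] := sf x; rewrite -ey; apply: (minI (f @^-1` J)) => /=; last by rewrite ey.
  by split=> /= [|a u v Ju Jv]; rewrite ?rmorph0 // rmorphD rmorphM; exact: JM.
by move=> u us; apply: Js; exact: map_f.
Qed.

(** The ideals of degree-[d] coefficients increase with [d], hence are constant from some [N] on.
    The top coefficient of an element of [I] is cancelled by an element that the representatives
    generate, shifted by a power of ['X] when the degree exceeds [N]. *)
Theorem hilbert_basis (R : comNzRingType) : noetherian R -> noetherian {poly R}.
Proof.
move=> nR I iI; have [I0 IM] := iI.
pose lead (A : set {poly R}) d : set R :=
  [set a | exists p, [/\ A p, (size p <= d.+1)%N & p`_d = a]].
have lead_ideal A d : ideal A -> ideal (lead A d).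
  move=> iA; split; first by exists 0; rewrite size_poly0 coef0; split=> //; case: iA.
  move=> a _ _ [p [Ap sp <-]] [q [Aq sq <-]]; exists (a%:P * p + q); split.
  - by case: iA => _; apply.
  - rewrite (leq_trans (size_polyD _ _)) // geq_max sq andbT mul_polyC.
    exact: leq_trans (size_scale_leq _ _) sp.
  - by rewrite coefD coefCM.
have [N hN] : exists N, forall d, lead I d `<=` lead I N.
  apply: noetherian_chain => // [d|d a [p [Ip sp <-]]]; first exact: lead_ideal.
  exists (p * 'X); rewrite coefMX /=; split=> //; first exact: idealMr.
  by rewrite (leq_trans (size_polyMleq _ _)) // size_polyX addn2.
(* Representatives of generators of the ideals of leading coefficients. *)
have [s [sI sgen]] : exists s : seq {poly R}, (forall p, p \in s -> I p) /\
    forall J, ideal J -> (forall p, p \in s -> J p) ->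
    forall d, (d <= N)%N -> lead I d `<=` lead (I `&` J) d.
  have reps d : exists s : seq {poly R}, (forall p, p \in s -> I p) /\
      forall J, ideal J -> (forall p, p \in s -> J p) -> lead I d `<=` lead (I `&` J) d.
    have [l [lI lgen]] := nR _ (lead_ideal I d iI).
    have [s [sI sl]] : exists s : seq {poly R}, (forall p, p \in s -> I p) /\
        forall a, a \in l -> exists p, [/\ p \in s, (size p <= d.+1)%N & p`_d = a].
      elim: l lI {lgen} => [|a l IH] lI; first by exists [::].
      have [|s [sI sl]] := IH; first by move=> b bl; apply: lI; rewrite inE bl orbT.
      have [p [Ip sp pa]] := lI a (mem_head _ _); exists (p :: s); split.
        by move=> q; rewrite inE => /predU1P[->|/sI].
      move=> b; rewrite inE => /predU1P[->|/sl[q [qs sq qb]]].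
        by exists p; rewrite mem_head.
      by exists q; rewrite inE qs orbT.
    exists s; split=> // J iJ Js; apply: lgen.
      apply: lead_ideal; split; first by split=> //; case: iJ.
      by move=> a x y [Ix Jx] [Iy Jy]; split; [exact: IM|case: iJ => _; apply].
    by move=> a /sl[p [ps sp pa]]; exists p; split=> //; split; [exact: sI|exact: Js].
  elim: N {hN} => [|N [s [sI sgen]]].
    have [s [sI sgen]] := reps 0%N; exists s; split=> // J iJ Js d.
    by rewrite leqn0 => /eqP ->; exact: sgen.
  have [t [tI tgen]] := reps N.+1; exists (t ++ s); split.
    by move=> p; rewrite mem_cat => /orP[/tI|/sI].
  move=> J iJ Js d; rewrite leq_eqVlt => /predU1P[->|].
    by apply: tgen => // p pt; apply: Js; rewrite mem_cat pt.
  by rewrite ltnS; apply: sgen => // p ps; apply: Js; rewrite mem_cat ps orbT.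
exists s; split=> // J iJ Js p; have [n] := ubnP (size p); elim: n p => // n IH p sp Ip.
have [->|p0] := eqVneq p 0; first by case: iJ.
have [d sd] : exists d, size p = d.+1.
  by exists (size p).-1; rewrite prednK // size_poly_gt0.
have [q [Iq Jq sq qd]] : exists q, [/\ I q, J q, (size q <= d.+1)%N & q`_d = p`_d].
  have Lp : lead I d p`_d by exists p; rewrite sd.
  have [dN|Nd] := leqP d N.
    by have [q [[Iq Jq] sq qd]] := sgen J iJ Js d dN _ Lp; exists q.
  have [q [[Iq Jq] sq qd]] := sgen J iJ Js N (leqnn N) _ (hN _ _ Lp).
  exists (q * 'X^(d - N)); split; [exact: idealMr|exact: idealMr| |].
    rewrite (leq_trans (size_polyMleq _ _)) // size_polyXn addnS /=.
    by rewrite -{2}(subnKC (ltnW Nd)) -addSn leq_add2r.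
  by rewrite coefMXn ltnNge leq_subr /= subKn // ltnW.
rewrite -(subrK q p); apply: idealD => //; apply: IH; last exact: idealB.
rewrite -ltnS; apply: leq_trans sp; rewrite ltnS sd ltnS.
apply/leq_sizeP => j; rewrite leq_eqVlt => /predU1P[<-|dj].
  by rewrite coefB qd subrr.
by rewrite coefB !nth_default ?subrr // ?sd // (leq_trans sq).
Qed.

Lemma mpoly_alg_ind n (R : comNzRingType) (P : {mpoly R[n]} -> Prop) :
  (forall c, P c%:MP) -> (forall i, P 'X_i) ->
  (forall p q, P p -> P q -> P (p + q)) -> (forall p q, P p -> P q -> P (p * q)) ->
  forall p, P p.
Proof.
move=> PC PX PD PM; elim/mpolyind => [|c m p _ _ Pp]; first by rewrite -(mpolyC0 n); exact: PC.
apply: (PD) Pp; rewrite -mul_mpolyC; apply: (PM) => //; rewrite mpolyXE_id.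
apply: big_ind => // [|i _]; first by rewrite -mpolyC1; exact: PC.
elim: (m i) => [|k IH]; first by rewrite expr0 -mpolyC1; exact: PC.
by rewrite exprS; exact: PM.
Qed.

Lemma noetherian_mpoly (K : fieldType) n : noetherian {mpoly K[n]}.
Proof.
elim: n => [|n IH].
  move=> I iI; have [[p [Ip p0]]|nI] := pselect (exists p, I p /\ p != 0).
    exists [:: p]; split=> [q|J iJ Jp q _]; first by rewrite inE => /eqP ->.
    have Jpp := Jp p (mem_head _ _).
    have pE : p = (p@_0)%:MP.
      apply/mpolyP => m; rewrite mcoeffC (_ : m = 0%MM) ?eqxx ?mulr1 //.
      by apply/mnmP => -[].
    have c0 : p@_0 != 0 by apply: contraNneq p0 => c0; rewrite pE c0 mpolyC0.
    have -> : q = (q * (p@_0)^-1%:MP) * p.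
      by rewrite [in RHS]pE mcoeffC eqxx mulr1 -mulrA -mpolyCM mulVf // mpolyC1 mulr1.
    exact: idealMl.
  exists [::]; split=> // J [J0 _] _ p Ip; suff -> : p = 0 by [].
  by apply/eqP; apply: contrapT => /negP p0; apply: nI; exists p.
pose f := (horner_eval ('X_ord_max : {mpoly K[n.+1]}) \o map_poly (@mwiden n K)).
apply: (@noetherian_surj _ _ f); last exact: hilbert_basis.
elim/mpoly_alg_ind => [c|i|p q [x ex] [y ey]|p q [x ex] [y ey]].
- by exists (c%:MP)%:P; rewrite /f /= map_polyC /= mwidenC /horner_eval hornerC.
- have [j ->|->] := unliftP ord_max i; last first.
    by exists 'X; rewrite /f /= map_polyX /horner_eval hornerX.
  exists ('X_j)%:P; rewrite /f /= map_polyC /= /horner_eval hornerC mwidenX.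
  rewrite mnmwiden1; congr 'X_[U_(_)]; apply: val_inj => /=.
  by rewrite /bump leqNgt ltn_ord.
- by exists (x + y); rewrite rmorphD ex ey.
- by exists (x * y); rewrite rmorphM ex ey.
Qed.

Section Nullstellensatz.

(** In the form in which it is used: every colouring by natural numbers has an infinite colour
    class. *)
Definition uncountable (T : eqType) := forall f : T -> nat, exists d, forall r,
  exists s : seq T, [/\ uniq s, size s = r & {in s, forall x, f x = d}].

Lemma mpoly_dependent (K : fieldType) n d r (u : 'I_r -> {mpoly K[n]}) :
  (#|{: 'X_{1..n < d}}| < r)%N -> (forall i, msize (u i) <= d)%N ->
  exists c : 'I_r -> K, (exists i, c i != 0) /\ \sum_i (c i)%:MP * u i = 0.
Proof.
move=> hr hu.
pose A : 'M[K]_(r, #|{: 'X_{1..n < d}}|) := \matrix_(i, j) (u i)@_(enum_val j : 'X_{1..n < d}).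
have : kermx A != 0.
  rewrite -mxrank_eq0 mxrank_ker subn_eq0 -ltnNge.
  exact: leq_ltn_trans (rank_leq_col _) hr.
case/rowV0Pn => c /sub_kermxP cA c0; exists (c 0); split.
  apply: contrapT => /forallNP h; case/eqP: c0; apply/rowP => i; rewrite mxE.
  by apply/eqP; apply: contrapT => /negP; exact: h.
rewrite (eq_bigr (fun i => \sum_(m : 'X_{1..n < d}) (c 0 i * (u i)@_m) *: 'X_[m])); last first.
  move=> i _; rewrite {1}(mpolywE (hu i)) mul_mpolyC scaler_sumr.
  by apply: eq_bigr => m _; rewrite scalerA.
rewrite exchange_big big1 // => m _; rewrite -scaler_suml.
have /matrixP/(_ 0 (enum_rank m)) := cA; rewrite !mxE => e.
rewrite (_ : \sum_i _ = 0) ?scale0r // -[RHS]e; apply: eq_bigr => i _.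
by rewrite mxE enum_rankK.
Qed.

(** Let [Q] be maximal among the ideals containing [J] and no power of [f]; it is prime. If no
    ['X_i - a] were in [Q], each would divide a power of [f] modulo [Q], with cofactor [u_a].
    Infinitely many [a] share the exponent and the size of [u_a], so the [u_a] are linearly
    dependent; this puts [f^k q('X_i)] in [Q] for some nonzero [q], which splits into linear
    factors, against primality. Hence [Q] is the ideal of a point [v], where [f] would vanish. *)
Theorem nullstellensatz (K : closedFieldType) n (J : set {mpoly K[n]}) f :
  uncountable K -> ideal J ->
  (forall v, (forall p, J p -> p.@[v] = 0) -> f.@[v] = 0) -> exists k, J (f ^+ k).
Proof.
move=> uK iJ fJ; apply: contrapT => /forallNP nJ.
pose S : set {mpoly K[n]} := [set p | exists k, p = f ^+ k].
have [|Q [iQ JQ QS maxQ]] := @maximal_ideal_avoiding _ J S set0 iJ.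
  by move=> p [Jp [k ek]]; apply: (nJ k); rewrite -ek.
have Qf k : ~ Q (f ^+ k) by move=> Qk; apply: (QS (f ^+ k)); split=> //; exists k.
have Qc c : c != 0 -> ~ Q c%:MP.
  move=> c0 Qc; apply: (Qf 0%N); rewrite expr0 -mpolyC1 -(mulVf c0) mpolyCM.
  exact: idealMl.
have nQ p : ~ Q p -> exists k m u, Q m /\ f ^+ k = m + u * p.
  move=> Qp; apply: contrapT => h; apply: Qp.
  have [iQp QQp pQp] := ideal_addP iQ (principal_ideal p).
  apply: (maxQ _ iQp QQp); last by apply: pQp; exists 1; rewrite mul1r.
  move=> z [[m [_ [Qm [u ->] ez]]] [k ek]]; apply: h; exists k, m, u.
  by rewrite -ek ez.
have prime p q : Q (p * q) -> Q p \/ Q q.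
  move=> Qpq; apply: contrapT => /not_orP[/nQ[k [m [u [Qm ek]]]] /nQ[l [m' [u' [Qm' el]]]]].
  apply: (Qf (k + l)%N); rewrite exprD ek el.
  have -> : (m + u * p) * (m' + u' * q) = (m' + u' * q) * m + u * p * m' + u * u' * (p * q) by ring.
  by do ?apply: idealD => //; exact: idealMl.
have coord i : exists a, Q ('X_i - a%:MP).
  apply: contrapT => /forallNP na.
  have /choice[ku hku] a : exists ku : nat * {mpoly K[n]},
      Q (f ^+ ku.1 - ku.2 * ('X_i - a%:MP)).
    have [k [m [u [Qm ek]]]] := nQ _ (na a); exists (k, u) => /=.
    by rewrite ek addrK.
  have [d hd] := uK (fun a => pickle ((ku a).1, msize (ku a).2)).
  have [s0 [us0 ss0 hs0]] := hd 1%N; case: s0 us0 ss0 hs0 => [|a0 s0] // _ _ hs0.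
  set k := (ku a0).1; set e := msize (ku a0).2.
  have [s [us ss hs]] := hd #|{: 'X_{1..n < e}}|.+1.
  have hs' a : a \in s -> (ku a).1 = k /\ msize (ku a).2 = e.
    move=> sa; have := hs a sa; rewrite -(hs0 a0 (mem_head _ _)).
    by move/(pcan_inj pickleK) => [-> ->].
  have hi (j : 'I_(size s)) : s`_j \in s by exact: mem_nth.
  have [||c [[j0 cj0] sc]] := @mpoly_dependent K n e (size s) (fun j => (ku s`_j).2).
  - by rewrite ss.
  - by move=> j; rewrite (hs' _ (hi j)).2.
  (* The numerator of the sum of the [c j / ('X - s_j)]; at [s_j0] a single term survives, so it is
     nonzero. *)
  pose q : {poly K} := \sum_j (c j)%:P * \prod_(l | l != j) ('X - (s`_l)%:P).
  have q0 : q != 0.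
    apply/eqP => /(congr1 (fun q => q.[s`_j0]))/eqP; rewrite horner0 horner_sum.
    rewrite (bigD1 j0) //= [X in _ + X]big1 => [|j jj0].
      rewrite addr0 hornerM hornerC horner_prod mulf_eq0 (negbTE cj0) /=.
      rewrite prodf_seq_eq0 => /hasP[l _ /andP[lj0]]; rewrite !hornerE subr_eq0.
      by rewrite nth_uniq // eq_sym val_eqE (negbTE lj0).
    by rewrite hornerM (bigD1 j0) /= ?hornerM ?hornerXsubC ?subrr ?mul0r ?mulr0 // eq_sym.
  pose X (p : {poly K}) : {mpoly K[n]} := (map_poly (@mpolyC n K) p).['X_i].
  have XM p1 p2 : X (p1 * p2) = X p1 * X p2 by rewrite /X rmorphM hornerM.
  have XC a : X a%:P = a%:MP by rewrite /X map_polyC hornerC.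
  have Xlin a : X ('X - a%:P) = 'X_i - a%:MP.
    by rewrite /X rmorphB /= map_polyX map_polyC !hornerE.
  have Xsum (A : finType) (P : pred A) F : X (\sum_(j | P j) F j) = \sum_(j | P j) X (F j).
    by rewrite /X rmorph_sum horner_sum.
  have Xprod (A : finType) (P : pred A) F : X (\prod_(j | P j) F j) = \prod_(j | P j) X (F j).
    by rewrite /X rmorph_prod horner_prod.
  have Qq : Q (f ^+ k * X q).
    pose W := \prod_(l < size s) ('X_i - (s`_l)%:MP).
    have -> : f ^+ k * X q = \sum_j (c j)%:MP * \prod_(l | l != j) ('X_i - (s`_l)%:MP) *
        (f ^+ k - (ku s`_j).2 * ('X_i - (s`_j)%:MP)) + W * \sum_j (c j)%:MP * (ku s`_j).2.
      rewrite Xsum !mulr_sumr -big_split; apply: eq_bigr => j _ /=.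
      have -> : W = ('X_i - (s`_j)%:MP) * \prod_(l < size s | l != j) ('X_i - (s`_l)%:MP).
        by rewrite /W (bigD1 j).
      rewrite XM XC Xprod; under [X in _ * (_ * X)]eq_bigr => l _ do rewrite Xlin.
      by move: (\prod_(l | l != j) _) => P; ring.
    rewrite sc mulr0 addr0; apply: ideal_sum => // j _; apply: idealMl => //.
    by have := hku s`_j; rewrite (hs' _ (hi j)).1.
  case: (prime _ _ Qq) => [|QX]; first exact: Qf.
  have [r er] := closed_field_poly_normal q.
  move: QX; rewrite er -mul_polyC XM XC => /prime[].
    by apply: Qc; rewrite lead_coef_eq0.
  elim: r {er} => [|b r IH].
    by rewrite big_nil /X rmorph1 hornerC; rewrite -mpolyC1; apply: Qc; exact: oner_neq0.
  by rewrite big_cons XM Xlin => /prime[/na|].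
have /choice[v hv] := coord.
have Qv p : Q (p - (p.@[v])%:MP).
  elim/mpoly_alg_ind: p => [c|i|p q Qp Qq|p q Qp Qq].
  - by rewrite mevalC subrr; case: iQ.
  - by rewrite mevalXU.
  - by rewrite mevalD mpolyCD opprD addrACA; exact: idealD.
  - rewrite mevalM mpolyCM.
    have -> : p * q - (p.@[v])%:MP * (q.@[v])%:MP =
      q * (p - (p.@[v])%:MP) + (p.@[v])%:MP * (q - (q.@[v])%:MP) by ring.
    by apply: idealD => //; exact: idealMl.
have Qz p : Q p -> p.@[v] = 0.
  move=> Qp; apply/eqP; apply: contrapT => /negP /Qc; apply.
  have -> : (p.@[v])%:MP = p - (p - (p.@[v])%:MP) by ring.
  exact: idealB.
apply: (Qf 1%N); rewrite expr1 -[f](subrK (f.@[v])%:MP) fJ ?mpolyC0.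
  by rewrite addr0 -[X in _ - X](_ : (f.@[v])%:MP = 0) //; rewrite fJ ?mpolyC0 // => p /JQ/Qz.
by move=> p /JQ/Qz.
Qed.

End Nullstellensatz.

(** * Krull's intersection theorem *)

Section Krull.
Variables (R : comNzRingType) (m : nat) (y : 'I_m -> R).
Implicit Types (I J Q : set R).

Fixpoint ideal_pow k : set R :=
  if k is k'.+1 then [set p | exists b, (forall i, ideal_pow k' (b i)) /\ p = \sum_i y i * b i]
  else setT.

Lemma ideal_powP k : ideal (ideal_pow k).
Proof.
elim: k => [|k IH]; first by split.
split; first by exists (fun=> 0); split=> [i|]; [case: IH|rewrite big1 // => i _; rewrite mulr0].
move=> a _ _ [b [hb ->]] [c [hc ->]]; exists (fun i => a * b i + c i); split=> [i|].
  by case: IH => _; apply; [exact: hb|exact: hc].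
by rewrite mulr_sumr -big_split; apply: eq_bigr => i _ /=; rewrite mulrDr mulrCA.
Qed.

Lemma ideal_powS k i p : ideal_pow k p -> ideal_pow k.+1 (y i * p).
Proof.
move=> hp; exists (fun j => (j == i)%:R * p); split=> [j|].
  by case: eqP => _; rewrite ?mul1r ?mul0r //; case: (ideal_powP k).
rewrite (bigD1 i) //= eqxx mul1r big1 ?addr0 // => j /negbTE ->.
by rewrite mul0r mulr0.
Qed.

Lemma ideal_powM k l p q : ideal_pow k p -> ideal_pow l q -> ideal_pow (k + l) (p * q).
Proof.
elim: k p => [|k IH] p; first by move=> _; exact: idealMl (ideal_powP l).
move=> [b [hb ->]] hq; rewrite mulr_suml; apply: ideal_sum => [|i _]; first exact: ideal_powP.
by rewrite -mulrA; apply: (@ideal_powS (k + l)); exact: IH (hb i) hq.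
Qed.

Definition colon Q z : set R := [set a | Q (a * z)].

Lemma colon_ideal Q z : ideal Q -> ideal (colon Q z).
Proof.
move=> iQ; split=> [|a x t]; rewrite /colon /= ?mul0r; first by case: iQ.
by rewrite mulrDl -mulrA; case: iQ => _; apply.
Qed.

(** Pigeonhole: a product of [t] of the [y i] contains some [y i] at least [e i] times. Passing to
    [colon Q (y i)] strips one factor and lowers [e i] by one. *)
Lemma ideal_pow_sub t Q (e : 'I_m -> nat) : ideal Q -> (\sum_i e i < t)%N ->
  (forall i, Q (y i ^+ e i)) -> ideal_pow t `<=` Q.
Proof.
elim: t Q e => // t IH Q e iQ et Qy _ [b [hb ->]]; apply: ideal_sum => // i _.
case ei : (e i) => [|s].
  by have := Qy i; rewrite ei => Q1; rewrite -[_ * _]mulr1; exact: (idealMl _ iQ).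
rewrite mulrC; pose e' j := if j == i then s else e j.
apply: (IH (colon Q (y i)) e') (hb i); first exact: colon_ideal.
  apply: leq_trans (_ : \sum_j e j <= t)%N => //; rewrite [X in (X < _)%N](bigD1 i) //=.
  rewrite [X in (_ < X)%N](bigD1 i) //= /e' eqxx ei addSn ltnS leq_add2l.
  by apply: leq_sum => j /negbTE ->.
move=> j; rewrite /colon /= /e'; case: eqP => [->|_]; first by rewrite -exprSr -ei.
exact: (idealMr _ iQ).
Qed.

(** Let [N] be the intersection of the ideals generated by [I] and the [k]-th powers, and [N'] the
    ideal [(y) N + I]. Enlarge [N'] to [Q], maximal with [Q] and [N] meeting inside [N']. Then [Q]
    contains a power of each [y i], hence some [ideal_pow], hence [N]; so [N] lies in [N'], and
    Nakayama's determinant gives [e]. With [phi] the evaluation at a point, [e] is a function with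
    value 1 there. *)
Lemma krull I (L : comNzRingType) (phi : {rmorphism R -> L}) : noetherian R -> ideal I ->
  (forall i, phi (y i) = 0) -> exists e, phi e = 1 /\
    forall x, (forall k, ideal_add (ideal_pow k) I x) -> I (e * x).
Proof.
move=> nR iI phi0.
pose N x := forall k, ideal_add (ideal_pow k) I x.
have iN : ideal N.
  split=> [k|a x z hx hz k]; have [iA _ _] := ideal_addP (ideal_powP k) iI; first by case: iA.
  by case: iA => _; apply; [exact: hx|exact: hz].
have IN : I `<=` N by move=> x Ix k; have [_ _] := ideal_addP (ideal_powP k) iI; exact.
pose N' x := exists b v, [/\ forall i, N (b i), I v & x = \sum_i y i * b i + v].
have iN' : ideal N'.
  split; first by exists (fun=> 0), 0; split=> [i||]; rewrite ?addr0 ?big1 //;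
    [case: iN|case: iI|move=> i _; rewrite mulr0].
  move=> a _ _ [b [v [hb hv ->]]] [c [w [hc hw ->]]].
  exists (fun i => a * b i + c i), (a * v + w); split=> [i||].
  - by case: iN => _; apply; [exact: hb|exact: hc].
  - by case: iI => _; apply.
  rewrite [X in _ = X + _](eq_bigr (fun i => a * (y i * b i) + y i * c i)); last first.
    by move=> i _; rewrite mulrDr mulrCA.
  by rewrite big_split -mulr_sumr /=; ring.
have NN' : N `<=` N'.
  have [|Q [iQ N'Q QN maxQ]] := @maximal_ideal_avoiding R N' N N' iN'; first by move=> x [].
  have yQ i : exists s, Q (y i ^+ s).
    have [||s hs] := noetherian_chain (I := fun s => colon Q (y i ^+ s)) nR.
    - by move=> s; exact: colon_ideal.
    - by move=> s a; rewrite /colon /= exprSr mulrA; exact: (idealMr _ iQ).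
    exists s; have [iA QA PA] := ideal_addP iQ (principal_ideal (y i ^+ s)).
    apply: (maxQ _ iA QA); last by apply: PA; exists 1; rewrite mul1r.
    (* For [z = q + a y_i^s] in [N], the product [y_i z] is in [N'], so [a y_i^(s+1)] is in [Q];
       stationarity of the colon ideals brings this down to [a y_i^s]. *)
    move=> z [[q [_ [Qq [a ->] ez]]] Nz].
    apply: QN; split=> //; rewrite ez; apply: (idealD iQ) => //.
    apply: (hs s.+1); rewrite /colon /= exprS mulrCA.
    have -> : y i * (a * y i ^+ s) = y i * z - y i * q by rewrite ez; ring.
    apply: (idealB iQ); last exact: (idealMl _ iQ).
    apply: N'Q; exists (fun j => (j == i)%:R * z), 0; split=> [j||].
    - exact: (idealMl _ iN).
    - by case: iI.
    - rewrite addr0 (bigD1 i) //= eqxx mul1r big1 ?addr0 // => j /negbTE ->.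
      by rewrite mul0r mulr0.
  have [e he] := choice yQ.
  move=> z Nz; apply: QN; split=> //.
  have [u [v [hu Iv ->]]] := Nz (\sum_i e i).+1; apply: (idealD iQ).
    exact: (ideal_pow_sub iQ (ltnSn _) he).
  apply: N'Q; exists (fun=> 0), v; split=> // [i|]; first by case: iN.
  by rewrite big1 ?add0r // => i _; rewrite mulr0.
have [s [Ns spanN]] := noetherian_span nR iN.
have hU (j : 'I_(size s)) : exists c : 'I_(size s) -> R, (forall k, phi (c k) = 0) /\
    I (s`_j - \sum_k c k * s`_k).
  have [b [v [hb Iv eb]]] := NN' _ (Ns _ (mem_nth 0 (ltn_ord j))).
  have /choice[c hc] := fun i => spanN _ (hb i).
  exists (fun k => \sum_i y i * c i k); split=> [k|].
    by rewrite rmorph_sum big1 // => i _; rewrite rmorphM phi0 mul0r.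
  rewrite eb (_ : \sum_i y i * b i = \sum_k (\sum_i y i * c i k) * s`_k).
    by rewrite addrAC subrr add0r.
  under eq_bigr do rewrite hc mulr_sumr; rewrite exchange_big; apply: eq_bigr => k _ /=.
  by rewrite mulr_suml; apply: eq_bigr => i _; rewrite mulrA.
have [c hc] := choice hU.
(* Modulo [I] this matrix kills the generators of [N], hence so does its determinant, by Cramer's
   rule; [phi] maps it to the identity. *)
pose A : 'M[R]_(size s) := 1%:M - \matrix_(j, k) c j k.
exists (\det A); split.
  have -> : phi (\det A) = \det (map_mx phi A) by rewrite det_map_mx.
  have -> : map_mx phi A = 1%:M; last exact: det1.
  apply/matrixP => j k; rewrite !mxE rmorphB (hc j).1 subr0.
  by case: (j == k); rewrite ?rmorph1 ?rmorph0.
have detI j : I (\det A * s`_(j : 'I_(size s))).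
  pose v : 'cV[R]_(size s) := \col_k s`_k.
  have -> : \det A * s`_j = (\adj A *m (A *m v)) j 0.
    by rewrite mulmxA mul_adj_mx mul_scalar_mx !mxE.
  rewrite mxE; apply: ideal_sum => // k _; apply: (idealMl _ iI).
  rewrite mulmxBl mul1mx !mxE (eq_bigr (fun l => c k l * s`_l)); last by move=> l _; rewrite !mxE.
  exact: (hc k).2.
move=> x /spanN[d ->]; rewrite mulr_sumr; apply: ideal_sum => // i _.
by rewrite mulrCA; apply: (idealMl _ iI).
Qed.

End Krull.

(** * Lie algebras of closed matrix groups *)

(* Locked, lest conversion tests unfold polynomial evaluation. *)
HB.lock Definition ev (K : fieldType) (n : nat) (A : 'M[K]_n) (p : {mpoly K[n * n]}) : K :=
  p.@[fun i => mxvec A 0 i].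

HB.lock Definition gen_mx (K : fieldType) (n : nat) : 'M[{mpoly K[n * n]}]_n :=
  vec_mx (\row_i 'X_i).

HB.lock Definition der (K : fieldType) (n : nat) (A B : 'M[K]_n) (p : {mpoly K[n * n]}) : K :=
  \sum_i ev A p^`M(i) * mxvec B 0 i.

(* The left-invariant derivation attached to [xi]. *)
HB.lock Definition lder (K : fieldType) (n : nat) (xi : 'M[K]_n) (p : {mpoly K[n * n]}) :
    {mpoly K[n * n]} :=
  \sum_i p^`M(i) * mxvec (gen_mx K n *m map_mx (@mpolyC _ K) xi) 0 i.

Section MatrixPolynomials.
Variables (K : fieldType) (n : nat).
Local Notation R := {mpoly K[n * n]}.
Local Notation gen_mx := (gen_mx K n).
Local Notation cmx := (map_mx (@mpolyC (n * n) K)).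
Implicit Types (p q : R) (A B xi eta : 'M[K]_n).

Lemma evE A : ev A =1 meval (fun i => mxvec A 0 i).
Proof. by move=> p; rewrite ev.unlock. Qed.

Fact ev_zmod_morphism A : zmod_morphism (ev A).
Proof. by move=> p q; rewrite !evE mevalB. Qed.

Fact ev_monoid_morphism A : monoid_morphism (ev A).
Proof. by split=> [|p q]; rewrite !evE ?meval1 ?mevalM. Qed.

HB.instance Definition _ A := GRing.isZmodMorphism.Build _ _ (ev A) (ev_zmod_morphism A).
HB.instance Definition _ A := GRing.isMonoidMorphism.Build _ _ (ev A) (ev_monoid_morphism A).

Lemma gen_mxE i j : gen_mx i j = 'X_(mxvec_index i j).
Proof. by rewrite gen_mx.unlock !mxE. Qed.

Lemma evC A c : ev A c%:MP = c. Proof. by rewrite evE mevalC. Qed.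
Lemma evX A i : ev A 'X_i = mxvec A 0 i. Proof. by rewrite evE mevalXU. Qed.
Lemma ev0 A : ev A 0 = 0. Proof. exact: rmorph0. Qed.
Lemma ev1 A : ev A 1 = 1. Proof. exact: rmorph1. Qed.
Lemma evD A p q : ev A (p + q) = ev A p + ev A q. Proof. exact: rmorphD. Qed.
Lemma evM A p q : ev A (p * q) = ev A p * ev A q. Proof. exact: rmorphM. Qed.
Lemma evB A p q : ev A (p - q) = ev A p - ev A q. Proof. exact: rmorphB. Qed.
Lemma evXn A p k : ev A (p ^+ k) = ev A p ^+ k. Proof. exact: rmorphXn. Qed.

Lemma ev_meval (v : 'I_(n * n) -> K) p : p.@[v] = ev (vec_mx (\row_i v i)) p.
Proof. by rewrite evE vec_mxK; apply: meval_eq => i; rewrite mxE. Qed.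

Lemma ev_gen A : map_mx (ev A) gen_mx = A.
Proof. by apply/matrixP => i j; rewrite mxE gen_mxE evX mxvecE. Qed.

Lemma ev_cmx A m1 m2 (a : 'M[K]_(m1, m2)) : map_mx (ev A) (cmx a) = a.
Proof. by apply/matrixP => i j; rewrite !mxE evC. Qed.

Lemma ev_sum A (I : Type) (r : seq I) (P : pred I) (F : I -> R) :
  ev A (\sum_(i <- r | P i) F i) = \sum_(i <- r | P i) ev A (F i).
Proof. exact: rmorph_sum. Qed.

Lemma mderiv_var (i j : 'I_(n * n)) : ('X_j : R)^`M(i) = (j == i)%:R.
Proof.
rewrite mderivX mnm1E; case: eqP => [->|_]; last by rewrite scale0r.
have -> : (U_(i) - U_(i) = 0)%MM by apply/mnmP => k; rewrite mnmBE subnn mnm0E.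
by rewrite scale1r mpolyX0.
Qed.

Lemma derC A B c : der A B c%:MP = 0.
Proof. by rewrite der.unlock big1 // => i _; rewrite mderivC ev0 mul0r. Qed.

Lemma derX A B i : der A B 'X_i = mxvec B 0 i.
Proof.
rewrite der.unlock (bigD1 i) //= mderiv_var eqxx ev1 mul1r big1 ?addr0 // => j ji.
by rewrite mderiv_var eq_sym (negbTE ji) ev0 mul0r.
Qed.

Lemma derD A B p q : der A B (p + q) = der A B p + der A B q.
Proof.
by rewrite der.unlock -big_split; apply: eq_bigr => i _; rewrite mderivD evD mulrDl.
Qed.

Lemma derM A B p q : der A B (p * q) = der A B p * ev A q + ev A p * der A B q.
Proof.
rewrite der.unlock mulr_suml mulr_sumr -big_split; apply: eq_bigr => i _.
by rewrite mderivM evD !evM mulrDl mulrAC -(mulrA (ev A p)).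
Qed.

Lemma der_sum A B (I : Type) (r : seq I) (P : pred I) (F : I -> R) :
  der A B (\sum_(i <- r | P i) F i) = \sum_(i <- r | P i) der A B (F i).
Proof.
elim/big_rec2: _ => [|i u v _ <-]; last exact: derD.
by rewrite -(mpolyC0 (n * n)) derC.
Qed.

Lemma der_linear A c B C p : der A (c *: B + C) p = c * der A B p + der A C p.
Proof.
rewrite der.unlock mulr_sumr -big_split; apply: eq_bigr => i _.
by rewrite linearP mxE [X in _ * (X + _)]mxE mulrDr mulrCA.
Qed.

Lemma der0 A p : der A 0 p = 0.
Proof. by have := der_linear A (-1) 0 0 p; rewrite scaler0 addr0 mulN1r addNr. Qed.

(** The pullback of [p] along [A |-> a A b], with its chain rule; translations and conjugations of
    the group are of this form. *)
Lemma substitution a b p : exists q,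
  (forall A, ev A q = ev (a *m A *m b) p) /\
  (forall A B, der A B q = der (a *m A *m b) (a *m B *m b) p).
Proof.
elim/mpoly_alg_ind: p => [c|k|p q [p' [ep dp]] [q' [eq dq]]|p q [p' [ep dp]] [q' [eq dq]]].
- by exists c%:MP; split=> [A|A B]; rewrite ?evC ?derC.
- case/mxvec_indexP: k => i j.
  exists (\sum_k \sum_l (a i k * b l j)%:MP * 'X_(mxvec_index k l)).
  have lin A : (a *m A *m b) i j = \sum_k \sum_l a i k * b l j * A k l.
    rewrite mxE (eq_bigr (fun l => \sum_k a i k * b l j * A k l)).
      exact: exchange_big.
    by move=> l _; rewrite mxE mulr_suml; apply: eq_bigr => k _; rewrite mulrAC.
  split=> [A|A B].
    rewrite evX mxvecE lin ev_sum; apply: eq_bigr => k _; rewrite ev_sum.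
    by apply: eq_bigr => l _; rewrite evM evC evX mxvecE.
  rewrite derX mxvecE lin der_sum; apply: eq_bigr => k _; rewrite der_sum.
  by apply: eq_bigr => l _; rewrite derM derC derX evC mul0r add0r mxvecE.
- exists (p' + q'); split=> [A|A B]; first by rewrite !evD ep eq.
  by rewrite !derD dp dq.
- exists (p' * q'); split=> [A|A B]; first by rewrite !evM ep eq.
  by rewrite !derM dp dq ep eq.
Qed.

Lemma ev_lder A xi p : ev A (lder xi p) = der A (A *m xi) p.
Proof.
rewrite lder.unlock der.unlock ev_sum; apply: eq_bigr => k _; rewrite evM; congr (_ * _).
case/mxvec_indexP: k => i j; rewrite !mxvecE -{2}(ev_gen A) !mxE ev_sum.
by apply: eq_bigr => l _; rewrite evM !mxE evC.
Qed.

Lemma lderC xi c : lder xi c%:MP = 0.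
Proof. by rewrite lder.unlock big1 // => i _; rewrite mderivC mul0r. Qed.

Lemma lderD xi p q : lder xi (p + q) = lder xi p + lder xi q.
Proof. by rewrite lder.unlock -big_split; apply: eq_bigr => i _; rewrite mderivD mulrDl. Qed.

Lemma lderM xi p q : lder xi (p * q) = lder xi p * q + p * lder xi q.
Proof.
rewrite lder.unlock mulr_suml mulr_sumr -big_split; apply: eq_bigr => i _.
by rewrite mderivM mulrDl mulrAC -(mulrA p).
Qed.

Lemma lderX xi i : lder xi 'X_i = mxvec (gen_mx *m cmx xi) 0 i.
Proof.
rewrite lder.unlock (bigD1 i) //= mderiv_var eqxx mul1r big1 ?addr0 // => j ji.
by rewrite mderiv_var eq_sym (negbTE ji) mul0r.
Qed.

Lemma lder0 xi : lder xi 0 = 0. Proof. by rewrite -(mpolyC0 (n * n)) lderC. Qed.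

Lemma lderN xi p : lder xi (- p) = - lder xi p.
Proof. by apply/eqP; rewrite -addr_eq0 -lderD addNr lder0. Qed.

Lemma lderB xi p q : lder xi (p - q) = lder xi p - lder xi q.
Proof. by rewrite lderD lderN. Qed.

Lemma lder_sum xi (I : Type) (r : seq I) (P : pred I) (F : I -> R) :
  lder xi (\sum_(i <- r | P i) F i) = \sum_(i <- r | P i) lder xi (F i).
Proof.
by elim/big_rec2: _ => [|i u v _ <-]; [exact: lder0|exact: lderD].
Qed.

Lemma lderXn xi p k : lder xi (p ^+ k.+1) = k.+1%:R * p ^+ k * lder xi p.
Proof.
elim: k => [|k IH]; first by rewrite expr1 expr0 !mul1r.
rewrite exprS lderM IH (exprS p k) -[in RHS](addn1 k.+1) natrD.
by move: (lder xi p) (p ^+ k) => d q; ring.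
Qed.

Lemma lder_mulmx xi m1 m2 m3 (M : 'M[R]_(m1, m2)) (N : 'M[R]_(m2, m3)) :
  map_mx (lder xi) (M *m N) = map_mx (lder xi) M *m N + M *m map_mx (lder xi) N.
Proof.
apply/matrixP => i j; rewrite !mxE lder_sum -big_split; apply: eq_bigr => k _.
by rewrite lderM !mxE.
Qed.

Lemma lder_cmx xi m1 m2 (a : 'M[K]_(m1, m2)) : map_mx (lder xi) (cmx a) = 0.
Proof. by apply/matrixP => i j; rewrite !mxE lderC. Qed.

Lemma lder_gen xi : map_mx (lder xi) gen_mx = gen_mx *m cmx xi.
Proof. by apply/matrixP => i j; rewrite mxE gen_mxE lderX mxvecE. Qed.

(** Both sides are derivations, so it suffices to compare them on the generic matrix, which
    [lder xi] multiplies by [xi] on the right. *)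
Lemma lder_bracket xi eta p :
  lder xi (lder eta p) - lder eta (lder xi p) = lder (xi *m eta - eta *m xi) p.
Proof.
elim/mpoly_alg_ind: p => [c|k|p q ep eq|p q ep eq].
- by rewrite !lderC ?lder0 subrr.
- have second a b : map_mx (lder a) (map_mx (lder b) gen_mx) = gen_mx *m cmx (a *m b).
    by rewrite (lder_gen b) lder_mulmx lder_cmx lder_gen mulmx0 addr0 map_mxM mulmxA.
  case/mxvec_indexP: k => i j; rewrite -gen_mxE.
  have e a b : lder a (lder b (gen_mx i j)) = (gen_mx *m cmx (a *m b)) i j.
    by rewrite -second [RHS]mxE [in RHS]mxE.
  have e1 a : lder a (gen_mx i j) = (gen_mx *m cmx a) i j by rewrite -lder_gen [RHS]mxE.
  rewrite !e e1 map_mxB mulmxBr; move: (gen_mx *m _) (gen_mx *m _) => M N.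
  by rewrite !mxE.
- by rewrite !(lderD _ p) !lderD -ep -eq addrACA opprD.
- rewrite !(lderM _ p) !lderD !lderM -ep -eq.
  move: (lder xi (lder eta p)) (lder eta (lder xi p)) (lder xi (lder eta q)) => a b c.
  move: (lder eta (lder xi q)) (lder xi p) (lder xi q) (lder eta p) (lder eta q) => d e f g h.
  ring.
Qed.

Lemma lder_linear c xi eta p : lder (c *: xi + eta) p = c%:MP * lder xi p + lder eta p.
Proof.
rewrite lder.unlock mulr_sumr -big_split; apply: eq_bigr => k _.
rewrite map_mxD map_mxZ mulmxDr -scalemxAr linearP [X in _ * X]mxE.
by rewrite [X in _ * (X + _)]mxE mulrDr mulrCA.
Qed.

Definition bilin (a b : 'M[K]_n) i j : R := (cmx a *m gen_mx *m cmx b) i j.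

Lemma ev_bilin A a b i j : ev A (bilin a b i j) = (a *m A *m b) i j.
Proof.
have -> : ev A (bilin a b i j) = map_mx (ev A) (cmx a *m gen_mx *m cmx b) i j.
  by rewrite [RHS]mxE.
by rewrite !map_mxM /= ev_gen !ev_cmx.
Qed.

Lemma lder_bilin xi a b i j : lder xi (bilin a b i j) = bilin a (xi *m b) i j.
Proof.
have -> : lder xi (bilin a b i j) = map_mx (lder xi) (cmx a *m gen_mx *m cmx b) i j.
  by rewrite [RHS]mxE.
rewrite !lder_mulmx !lder_cmx mul0mx add0r mulmx0 addr0 lder_gen.
by rewrite /bilin map_mxM !mulmxA.
Qed.

Lemma bilin_mulr a b c i j : bilin a (b *m c) i j = \sum_k (c k j)%:MP * bilin a b i k.
Proof.
rewrite /bilin map_mxM mulmxA; move: (_ *m gen_mx *m _) => M; rewrite mxE.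
by apply: eq_bigr => k _; rewrite mulrC [map_mx _ _ _ _]mxE.
Qed.

End MatrixPolynomials.

Definition ideal_gen (R : comNzRingType) (E : set R) : set R :=
  [set x | forall I, ideal I -> E `<=` I -> I x].

Lemma ideal_genP (R : comNzRingType) (E : set R) :
  ideal (ideal_gen E) /\ E `<=` ideal_gen E.
Proof.
split; last by move=> x Ex I _; exact.
split; first by move=> I [].
by move=> a x y gx gy I iI EI; case: (iI) => _; apply; [exact: gx|exact: gy].
Qed.

(** * Lower triangular matrices and solvability *)

Section Triangular.
Variable K : fieldType.

(** A filtration compatible with products: 0 means lower triangular, 1 strictly so, and each further
    step kills one more diagonal. *)
Definition below n k : set 'M[K]_n := [set A | forall i j : 'I_n, (i < j + k)%N -> A i j = 0].

Lemma belowM n k l (A B : 'M[K]_n) : below k A -> below l B -> below (k + l) (A *m B).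
Proof.
move=> hA hB i j ij; rewrite mxE big1 // => m _.
have [h|h] := ltnP i (m + k); first by rewrite hA ?mul0r.
by rewrite hB ?mulr0 //; move: h ij; lia.
Qed.

Lemma below_le n k l (A : 'M[K]_n) : (k <= l)%N -> below l A -> below k A.
Proof. by move=> kl hA i j ij; apply: hA; apply: leq_trans ij _; rewrite leq_add2l. Qed.

Lemma belowB n k (A B : 'M[K]_n) : below k A -> below k B -> below k (A - B).
Proof. by move=> hA hB i j ij; rewrite !mxE hA // hB // subrr. Qed.

Lemma trig_below n (A : 'M[K]_n) : is_trig_mx A <-> below 0 A.
Proof.
split=> [/is_trig_mxP h i j|h]; first by rewrite addn0; exact: h.
by apply/is_trig_mxP => i j ij; apply: h; rewrite addn0.
Qed.

Lemma trig_mulmx n (A B : 'M[K]_n) : is_trig_mx A -> is_trig_mx B -> is_trig_mx (A *m B).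
Proof. by move=> /trig_below hA /trig_below hB; apply/trig_below; exact: belowM hA hB. Qed.

Lemma trig_diag_neq0 n (A : 'M[K]_n) i : is_trig_mx A -> A \in unitmx -> A i i != 0.
Proof. by move=> hA; rewrite unitmxE unitfE det_trig // => /prodf_neq0; apply. Qed.

Lemma trig_invmx n (A : 'M[K]_n) : A \in unitmx -> is_trig_mx A -> is_trig_mx (invmx A).
Proof.
move=> uA tA; apply/is_trig_mxP => i; have [k] := ubnP i; elim: k i => // k IH i ik j ij.
have /matrixP/(_ i j) := mulmxV uA; rewrite !mxE -val_eqE (ltn_eqF ij) (bigD1 i) //=.
rewrite big1 ?addr0 => [/eqP|l li].
  by rewrite mulf_eq0 (negbTE (trig_diag_neq0 i tA uA)) => /eqP.
have [il|il|/val_inj e] := ltngtP i l; last by rewrite e eqxx in li.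
  by rewrite (is_trig_mxP tA) ?mul0r.
by rewrite IH ?mulr0 //; [exact: leq_trans il ik|exact: ltn_trans il ij].
Qed.

Lemma trig_commutator n (x y : 'M[K]_n) : is_trig_mx x -> is_trig_mx y ->
  below 1 (x *m y - y *m x).
Proof.
move=> tx ty i j; rewrite addn1 ltnS leq_eqVlt => /predU1P[/val_inj <-|ij].
  rewrite !mxE (bigD1 i) //= [X in _ - X](bigD1 i) //= mulrC opprD addrACA subrr add0r.
  have zero (a b : 'M[K]_n) : is_trig_mx a -> is_trig_mx b -> \sum_(k | k != i) a i k * b k i = 0.
    move=> /is_trig_mxP ha /is_trig_mxP hb; apply: big1 => k ki.
    have [ik|ik|/val_inj e] := ltngtP i k; last by rewrite e eqxx in ki.
      by rewrite ha ?mul0r.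
    by rewrite hb ?mulr0.
  by rewrite !zero ?subrr.
rewrite mxE [X in _ + X]mxE (is_trig_mxP (trig_mulmx tx ty)) //.
by rewrite (is_trig_mxP (trig_mulmx ty tx)) // subrr.
Qed.

Variable G : groupType.

(** The [k]-th derived group lies in the [z] with [M z - 1] in [below k]: with [X = M x] and
    [Y = M y], the commutator minus 1 is the inverse of [Y X] times [X Y - Y X], and the latter is
    also the bracket of [X - 1] and [Y - 1]. *)
Lemma trig_solvable n (M : G -> 'M[K]_n) (S : set G) : is_subgroup S ->
  (forall g h, M (g * h)%g = M g *m M h) -> M 1%g = 1%:M -> injective M ->
  (forall g, S g -> is_trig_mx (M g)) -> is_solvable S.
Proof.
move=> sS MM M1 Minj tM; exists n.+1.
have sub k : is_subgroup (iter k (@derived G) S) /\ iter k (@derived G) S `<=` S.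
  elim: k => [|k [sD DS]]; first by split.
  split; first exact: derived_subgroup.
  by apply: subset_trans DS; exact: derived_le.
have Mu g : M g \in unitmx.
  by have := congr1 M (mulgV g); rewrite MM M1 => /mulmx1_unit[].
have commE x y : M [~ x, y]%g - 1%:M = invmx (M y *m M x) *m (M x *m M y - M y *m M x).
  have -> : M [~ x, y]%g = invmx (M y *m M x) *m (M x *m M y).
    by rewrite -!MM [in RHS](commgC x y) [in RHS](MM (y * x)%g) mulKmx.
  by rewrite mulmxBr mulVmx // unitmx_mul !Mu.
have Nsub k : is_subgroup [set z | S z /\ below k (M z - 1%:M)].
  have [S1 SM SV] := sS; split.
  - by split=> //; rewrite M1 subrr => i j _; rewrite mxE.
  - move=> x y [Sx hx] [Sy hy]; split; first exact: SM.
    have -> : M (x * y)%g - 1%:M = M x *m (M y - 1%:M) - (1%:M - M x).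
      by rewrite mulmxBr mulmx1 -MM opprB addrA subrK.
    apply: belowB; first by have /trig_below := tM x Sx; move/belowM; apply.
    by move=> i j ij; rewrite -[_ - M x]opprB mxE hx // oppr0.
  - move=> x [Sx hx]; split; first exact: SV.
    have -> : M x^-1%g - 1%:M = M x^-1%g *m (1%:M - M x).
      by rewrite mulmxBr mulmx1 -MM mulVg M1.
    have /trig_below := tM _ (SV _ Sx); move/belowM; apply.
    by move=> i j ij; rewrite -[_ - M x]opprB mxE hx // oppr0.
have lvl k : iter k.+1 (@derived G) S `<=` [set z | S z /\ below k.+1 (M z - 1%:M)].
  elim: k => [|k IH]; rewrite iterS; apply: derived_sub => // x y.
    move=> Sx Sy; split; first exact: subgroup_comm.
    rewrite commE; apply: (@belowM _ 0 1); last exact: trig_commutator (tM _ _) (tM _ _).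
    apply/trig_below/trig_invmx; first by rewrite unitmx_mul !Mu.
    by apply: trig_mulmx; exact: tM.
  move=> /IH[Sx hx] /IH[Sy hy]; split; first exact: subgroup_comm.
  rewrite commE; apply: (@belowM _ 0 k.+2).
    apply/trig_below/trig_invmx; first by rewrite unitmx_mul !Mu.
    by apply: trig_mulmx; exact: tM.
  have -> : M x *m M y - M y *m M x =
      (M x - 1%:M) *m (M y - 1%:M) - (M y - 1%:M) *m (M x - 1%:M).
    rewrite !mulmxBl !mulmxBr !mul1mx !mulmx1.
    move: (M x *m M y) (M y *m M x) (M x) (M y) => a b c d.
    by apply/matrixP => i j; rewrite !mxE; ring.
  have lek : (k.+2 <= k.+1 + k.+1)%N by lia.
  by apply: belowB; apply: (below_le lek); [exact: (belowM hx hy)|exact: (belowM hy hx)].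
move=> z /lvl[_ hz]; apply: Minj; rewrite M1; apply/eqP; rewrite -subr_eq0; apply/eqP/matrixP => i j.
by rewrite hz ?mxE //; have := ltn_ord i; lia.
Qed.

End Triangular.

(** * The correspondence between closed subgroups and Lie subalgebras *)

Section LieAlgebras.
Variables (K : closedFieldType) (n : nat) (G : groupType) (r : G -> 'M[K]_n).
Hypothesis char0 : [char K] =i pred0.
Hypothesis uK : uncountable K.
Hypothesis r1 : r 1%g = 1%:M.
Hypothesis rM : forall g h, r (g * h)%g = r g *m r h.
Hypothesis rclosed : forall A, (forall p, (forall g, ev (r g) p = 0) -> ev A p = 0) ->
  exists g, r g = A.
Local Notation R := {mpoly K[n * n]}.
Implicit Types (S T H P : set G) (p q : R) (xi eta : 'M[K]_n).

Definition vanish S : set R := [set p | forall s, S s -> ev (r s) p = 0].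

Definition closedG S := forall g, (forall p, vanish S p -> ev (r g) p = 0) -> S g.

Definition csub S := is_subgroup S /\ closedG S.

(** The Zariski tangent space at 1 of the image of [S]: at the identity, [lder xi] is the derivative
    in the direction [xi]. *)
Definition Lie S : set 'M[K]_n := [set xi | forall p, vanish S p -> ev 1%:M (lder xi p) = 0].

Lemma rV g : r g *m r g^-1%g = 1%:M /\ r g^-1%g *m r g = 1%:M.
Proof. by rewrite -!rM mulgV mulVg r1. Qed.

Lemma r_unit g : r g \in unitmx.
Proof. by have [/mulmx1_unit[]] := rV g. Qed.

Lemma rVE g : r g^-1%g = invmx (r g).
Proof. by rewrite -[LHS]mul1mx -(mulVmx (r_unit g)) -mulmxA (rV g).1 mulmx1. Qed.

Lemma vanish_ideal S : ideal (vanish S).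
Proof.
split=> [s _|a x y hx hy s Ss]; first by rewrite ev0.
by rewrite evD evM hx // hy // mulr0 addr0.
Qed.

Lemma vanish_anti S T : S `<=` T -> vanish T `<=` vanish S.
Proof. by move=> ST p hp s /ST; exact: hp. Qed.

Lemma csubT : csub setT.
Proof. by split; split. Qed.

Lemma Lie_mono S T : S `<=` T -> Lie S `<=` Lie T.
Proof. by move=> ST xi hx p hp; apply: hx; exact: vanish_anti hp. Qed.

Lemma Lie_linear S : Lie S 0 /\ forall c u v, Lie S u -> Lie S v -> Lie S (c *: u + v).
Proof.
split=> [p _|c u v hu hv p hp]; first by rewrite ev_lder mulmx0 der0.
by rewrite lder_linear evD evM hu // hv // mulr0 addr0.
Qed.

(** [lder xi] is left-invariant, so translation by [s] carries tangency from 1 to [s]. *)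
Lemma LieE S xi : is_subgroup S -> Lie S xi -> forall p, vanish S p -> vanish S (lder xi p).
Proof.
move=> [S1 SM SV] hx p hp s Ss; rewrite ev_lder.
have [q [eq dq]] := substitution (r s) 1%:M p.
have hq : vanish S q.
  by move=> t St; rewrite eq mulmx1 -rM; apply: hp; exact: SM.
by have := hx q hq; rewrite ev_lder dq mulmx1 mul1mx !mulmx1.
Qed.

Lemma Lie_conj S s xi : is_subgroup S -> S s -> Lie S xi -> Lie S (r s *m xi *m r s^-1%g).
Proof.
move=> [S1 SM SV] Ss hx p hp.
have [q [eq dq]] := substitution (r s) (r s^-1%g) p.
have hq : vanish S q.
  by move=> t St; rewrite eq -!rM; apply: hp; apply: (SM) (SM _ _ _ _) (SV _ _).
by have := hx q hq; rewrite !ev_lder dq mulmx1 (rV s).1 !mul1mx.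
Qed.

Lemma Lie_bracket S xi eta : is_subgroup S -> Lie S xi -> Lie S eta ->
  Lie S (xi *m eta - eta *m xi).
Proof.
move=> sS hx hy p hp; rewrite -lder_bracket evB.
have S1 : S 1%g by case: sS.
by rewrite -r1 (LieE sS hx (LieE sS hy hp) S1) (LieE sS hy (LieE sS hx hp) S1) subrr.
Qed.

(* In characteristic 0, the radical of an ideal stable under a derivation is
   stable; so tangent vectors may be tested on any set of equations. *)
Lemma Lie_scheme (E : set R) S xi :
  (forall p, E p -> ideal_gen E (lder xi p)) ->
  (forall A, (forall p, E p -> ev A p = 0) -> exists2 s, S s & r s = A) ->
  (forall p, E p -> ev 1%:M p = 0) -> Lie S xi.
Proof.
move=> hE hS E1 f hf; pose J := ideal_gen E; have [iJ EJ] := ideal_genP E.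
have dJ p : J p -> J (lder xi p).
  move=> Jp; suff [] : (J p /\ J (lder xi p)) by [].
  apply: (Jp [set p | J p /\ J (lder xi p)]); last by move=> q Eq; split; [exact: EJ|exact: hE].
  split=> [|a x y [Jx Jdx] [Jy Jdy]] /=; first by split; rewrite ?lder0; case: iJ.
  split; first by case: iJ => _; apply.
  by rewrite lderD lderM; apply: (idealD iJ) => //; apply: (idealD iJ); exact: (idealMl _ iJ).
have J1 p : J p -> ev 1%:M p = 0.
  move=> Jp; apply: (Jp [set p | ev 1%:M p = 0]) => //.
  split=> [|a x y hx hy] /=; first by rewrite ev0.
  by rewrite evD evM hx hy mulr0 addr0.
have [|k Jk] := nullstellensatz (f := f) uK iJ.
  move=> v hv; have vE := ev_meval v.
  have [p Ep|s Ss es] := hS (vec_mx (\row_i v i)); first by rewrite -vE; apply: hv; exact: EJ.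
  by rewrite vE -es; exact: hf.
have f1 : ev 1%:M f = 0 by have [s Ss <-] := hS _ E1; exact: hf.
have itJ j : J (iter j (lder xi) (f ^+ k)) by elim: j => //= j; exact: dJ.
(* For [j = k] this reads [k! (lder xi f)^k] modulo [f]; at 1, where [f] vanishes, characteristic 0
   leaves [lder xi f = 0]. *)
have key j : (j <= k)%N -> exists q, iter j (lder xi) (f ^+ k) =
    (k ^_ j)%:R * f ^+ (k - j) * lder xi f ^+ j + f ^+ (k - j).+1 * q.
  elim: j => [|j IH] jk; first by exists 0; rewrite ffactn0 subn0 expr0 mulr1 mul1r mulr0 addr0.
  have [q eq] := IH (ltnW jk); rewrite iterS eq.
  have [m em] : exists m, (k - j = m.+1)%N by exists (k - j.+1)%N; rewrite subnSK.
  have em' : (k - j.+1 = m)%N by rewrite subnS em.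
  have ed : lder xi (lder xi f ^+ j) = lder xi f ^+ j.-1 * (j%:R * lder xi (lder xi f)).
    case: (j) => [|i]; last by rewrite lderXn /=; ring.
    by rewrite expr0 mul0r mulr0 -(mpolyC1 (n * n)) lderC.
  have en : lder xi ((k ^_ j)%:R : R) = 0 by rewrite -mpolyC_nat lderC.
  rewrite em em' ffactnSr em natrM; exists
    ((k ^_ j)%:R * (lder xi f ^+ j.-1 * (j%:R * lder xi (lder xi f)))
     + m.+2%:R * lder xi f * q + f * lder xi q).
  rewrite lderD (lderM xi _ (lder xi f ^+ j)) (lderM xi _ (f ^+ m.+1)).
  rewrite (lderM xi (f ^+ m.+2) q) en ed !lderXn (exprS f m.+1) (exprS f m) (exprS _ j).
  by move: (lder xi (lder xi f)) (lder xi q) (lder xi f ^+ j.-1) (lder xi f ^+ j) (lder xi f) => a b c d e; ring.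
have [q eq] := key k (leqnn k).
have := J1 _ (itJ k); rewrite eq subnn expr0 mulr1 expr1 ffactnn evD !evM f1 mul0r addr0.
have -> : ev 1%:M (k`!%:R : R) = k`!%:R by rewrite -mpolyC_nat evC.
rewrite evXn.
move/eqP; rewrite mulf_eq0 expf_eq0 => /orP[|/andP[_ /eqP]//].
by rewrite ((charf0P K).1 char0) (gtn_eqF (fact_gt0 k)).
Qed.

(** The usual way to show that a tangent vector of [T] is tangent to the subset cut out by further
    equations: the derivatives of these need only lie in the ideal that they generate with the
    equations of [T]. *)
Lemma Lie_cut T (E : set R) S xi : csub T -> Lie T xi ->
  (forall g, S g <-> T g /\ forall p, E p -> ev (r g) p = 0) -> S 1%g ->
  (forall p, E p -> ideal_gen (vanish T `|` E) (lder xi p)) -> Lie S xi.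
Proof.
move=> [sT cT] hx SE S1 hE; have [iJ EJ] := ideal_genP (vanish T `|` E).
apply: (@Lie_scheme (vanish T `|` E)).
- move=> p [hp|]; last exact: hE.
  by apply: EJ; left; exact: LieE.
- move=> A hA; have [p hp|g eg] := rclosed (A := A).
    by apply: hA; left=> g _; exact: hp.
  exists g => //; apply/SE; split; first by apply: cT => p hp; rewrite eg; apply: hA; left.
  by move=> p Ep; rewrite eg; apply: hA; right.
- have [T1 hS1] := (SE 1%g).1 S1.
  by move=> p [hp|Ep]; rewrite -r1; [exact: hp|exact: hS1].
Qed.

Definition lie_group (X : set 'M[K]_n) : set G :=
  [set g | forall S, csub S -> X `<=` Lie S -> S g].

Lemma csub_lie_group X : csub (lie_group X).
Proof.
split; first split=> [S [[S1 _ _] _] _ //|x y hx hy S sS XS|x hx S sS XS].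
- by case: (sS) => -[_ SM _] _; apply: (SM); [exact: hx|exact: hy].
- by case: (sS) => -[_ _ SV] _; apply: (SV); exact: hx.
move=> g hg S sS XS; apply: sS.2 => p hp; apply: hg.
by apply: vanish_anti hp => h; exact.
Qed.

Lemma lie_group_min X S : csub S -> X `<=` Lie S -> lie_group X `<=` S.
Proof. by move=> sS XS g; exact. Qed.

(** The equations of all the closed subgroups that define [lie_group X], taken together, are stable
    under [lder xi]; [Lie_scheme] tolerates that they may not generate a radical ideal. *)
Lemma Lie_lie_group X : X `<=` Lie setT -> X `<=` Lie (lie_group X).
Proof.
move=> XT xi Xxi.
pose E : set R := [set p | exists S, [/\ csub S, X `<=` Lie S & vanish S p]].
apply: (@Lie_scheme E).
- move=> p [S [sS XS hp]]; apply: (ideal_genP E).2; exists S; split=> //.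
  by apply: (LieE sS.1) (XS _ Xxi) _ hp.
- move=> A hA; have [p hp|g eg] := rclosed (A := A).
    by apply: hA; exists setT; split=> // g _; exact: hp.
  exists g => // S sS XS; apply: sS.2 => p hp; rewrite eg; apply: hA.
  by exists S.
- by move=> p [S [[[S1 _ _] _] _ hp]]; rewrite -r1; exact: hp.
Qed.

(* The idempotent separating two disjoint closed pieces is killed by all the
   derivations, hence invariant under translations. *)
Lemma lie_group_pieces X (C D : set G) : X `<=` Lie setT ->
  closedG C -> closedG D -> lie_group X `<=` C `|` D ->
  lie_group X `&` C `&` D = set0 -> C 1%g -> lie_group X `<=` C.
Proof.
move=> XT cC cD sub dis C1; set H := lie_group X in sub dis *.
have [sH cH] := csub_lie_group X; rewrite -/H in sH cH; have [H1 HM HV] := sH.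
have iC := vanish_ideal (H `&` C); have iD := vanish_ideal (H `&` D).
have [iCD CCD DCD] := ideal_addP iC iD.
(* Disjointness gives [1 = a + e] with [a] zero on the piece in [C] and [e] zero on the piece in
   [D], so [a] is 0 on the first and 1 on the second. *)
have [|k [a [e [ha he]]]] := nullstellensatz (f := 1) uK iCD.
  move=> v hv; exfalso; set A := vec_mx (\row_i v i).
  have hA p : vanish (H `&` C) p -> ev A p = 0.
    by move=> hp; rewrite -ev_meval; apply: hv; exact: CCD.
  have hA' p : vanish (H `&` D) p -> ev A p = 0.
    by move=> hp; rewrite -ev_meval; apply: hv; exact: DCD.
  have [p hp|g eg] := rclosed (A := A); first by apply: hA => h _; exact: hp.
  suff : (set0 : set G) g by [].
  rewrite -dis; split; first split.
  - apply: cH => p hp; rewrite eg; apply: hA; apply: vanish_anti hp.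
    by move=> h [].
  - by apply: cC => p hp; rewrite eg; apply: hA; apply: vanish_anti hp => h [].
  - by apply: cD => p hp; rewrite eg; apply: hA'; apply: vanish_anti hp => h [].
rewrite expr1n => e1.
have aE h : H h -> D h -> ev (r h) a = 1.
  by move=> Hh Dh; have := congr1 (ev (r h)) e1; rewrite ev1 evD (he h) // addr0 => ->.
(* Differentiate [a^2 = a]: the factor [2 a - 1] is 1 or -1 at each point of [H]. *)
have da xi : X xi -> vanish H (lder xi a).
  move=> Xxi h Hh; have hx := Lie_lie_group XT Xxi.
  have : vanish H (a * a - a).
    move=> g Hg; rewrite evB evM; case: (sub g Hg) => [Cg|Dg].
      by rewrite (ha g) // mulr0 subrr.
    by rewrite aE // mulr1 subrr.
  move=> /(LieE sH hx) /(_ h Hh); rewrite lderB lderM evB evD !evM.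
  case: (sub h Hh) => [Ch|Dh].
    by rewrite (ha h) // mulr0 mul0r addr0 sub0r => /eqP; rewrite oppr_eq0 => /eqP.
  by rewrite (aE h) // mulr1 mul1r addrK.
pose S := [set h | H h /\ forall g, H g -> ev (r (g * h)%g) a = ev (r g) a].
have sS : csub S.
  split.
    split=> [|x y [Hx hx] [Hy hy]|x [Hx hx]].
    - by split=> // g _; rewrite mulg1.
    - by split=> [|g Hg]; [exact: HM|rewrite mulgA hy ?hx //; exact: HM].
    - split; first exact: HV.
      by move=> g Hg; rewrite -[in RHS](mulgVK x g) hx //; apply: HM => //; exact: HV.
  move=> h hh; split; first by apply: cH => p hp; apply: hh; apply: vanish_anti hp => g [].
  move=> g Hg; have [q [eq _]] := substitution (r g) 1%:M a.
  have : ev (r h) (q - (ev (r g) a)%:MP) = 0.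
    apply: hh => s [Hs hs]; rewrite evB evC eq mulmx1 -rM hs //.
    by rewrite subrr.
  by rewrite evB evC eq mulmx1 -rM => /subr0_eq.
have XS : X `<=` Lie S.
  move=> xi Xxi; have hx := Lie_lie_group XT Xxi.
  pose E : set R := [set p | exists g q, [/\ H g,
     (forall A, ev A q = ev (r g *m A *m 1%:M) a),
     (forall A B, der A B q = der (r g *m A *m 1%:M) (r g *m B *m 1%:M) a) &
     p = q - (ev (r g) a)%:MP]].
  apply: (@Lie_cut H E) => // [h||].
  - split=> -[Hh hh]; split=> //.
      move=> _ [g [q [Hg eq _ ->]]].
      by rewrite evB evC eq mulmx1 -rM hh // subrr.
    move=> g Hg; have [q [eq dq]] := substitution (r g) 1%:M a.
    have : ev (r h) (q - (ev (r g) a)%:MP) = 0 by apply: hh; exists g, q.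
    by rewrite evB evC eq mulmx1 -rM => /subr0_eq.
  - by case: sS => -[].
  - move=> _ [g [q [Hg _ dq ->]]]; apply: (ideal_genP _).2; left=> h Hh.
    rewrite lderB lderC subr0 ev_lder dq !mulmx1 mulmxA -rM -ev_lder da //.
    exact: HM.
move=> h Hh; have [_ /(_ 1%g H1)] := lie_group_min sS XS Hh; rewrite mul1g => ah.
case: (sub h Hh) => // Dh; have := aE h Hh Dh; rewrite ah (ha 1%g) // => /eqP.
by rewrite eq_sym oner_eq0.
Qed.

Lemma Lie_centralizer T c xi : csub T -> Lie T xi -> xi *m c = c *m xi ->
  Lie [set g | T g /\ r g *m c = c *m r g] xi.
Proof.
move=> cT hx comm.
pose w i j : R := bilin 1%:M c i j - bilin c 1%:M i j.
have ew A i j : ev A (w i j) = (A *m c - c *m A) i j.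
  by rewrite /w evB !ev_bilin mul1mx mulmx1 !mxE.
pose E : set R := [set p | exists i j, p = w i j].
apply: (@Lie_cut T E) => // [g||].
- split=> [[Tg cg]|[Tg hg]]; split=> //.
    by move=> _ [i [j ->]]; rewrite ew cg subrr mxE.
  apply/eqP; rewrite -subr_eq0; apply/eqP/matrixP => i j; rewrite [RHS]mxE -ew.
  by apply: hg; exists i, j.
- by split; [case: cT => -[]|rewrite r1 mulmx1 mul1mx].
- move=> _ [i [j ->]]; set I := ideal_gen _.
  have [iI EI] := ideal_genP (vanish T `|` E).
  have -> : lder xi (w i j) = \sum_k (xi k j)%:MP * w i k.
    rewrite /w lderB !lder_bilin comm mulmx1 -{2}[xi]mul1mx !bilin_mulr -sumrB.
    by apply: eq_bigr => k _; rewrite mulrBr.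
  apply: ideal_sum => // k _; apply: (idealMl _ iI).
  by apply: EI; right; exists i, k.
Qed.

Lemma csub_centralizer T (c : 'M[K]_n) : csub T -> csub [set g | T g /\ r g *m c = c *m r g].
Proof.
move=> [[T1 TM TV] cT]; split.
  split=> [|x y [Tx cx] [Ty cy]|x [Tx cx]]; first by split; rewrite ?r1 ?mulmx1 ?mul1mx.
    by split; [exact: TM|rewrite rM -mulmxA cy mulmxA cx mulmxA].
  split; first exact: TV.
  have := congr1 (fun M => r x^-1%g *m M *m r x^-1%g) cx.
  by rewrite -!mulmxA (rV x).1 mulmx1 !mulmxA (rV x).2 mul1mx.
move=> g hg; split; first by apply: cT => p hp; apply: hg; apply: vanish_anti hp => h [].
apply/eqP; rewrite -subr_eq0; apply/eqP/matrixP => i j.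
have := hg (bilin 1%:M c i j - bilin c 1%:M i j); rewrite evB !ev_bilin mul1mx mulmx1.
rewrite !mxE => -> // h [Th ch].
by rewrite evB !ev_bilin mul1mx mulmx1 ch subrr.
Qed.

Hypothesis r_inj : injective r.

(* [lie_group [set xi]] lies in the centraliser of [xi], hence in the
   centraliser of each of its own elements. *)
Lemma lie_group1_comm xi g h : Lie setT xi -> lie_group [set xi] g ->
  lie_group [set xi] h -> (g * h = h * g)%g.
Proof.
move=> Txi hg hh; apply: r_inj; rewrite !rM.
have sub S : csub S -> Lie S xi -> lie_group [set xi] `<=` S.
  by move=> sS Sxi; apply: lie_group_min => // _ ->.
have [_ cxi] := sub _ (csub_centralizer xi csubT) (Lie_centralizer csubT Txi erefl) _ hh.
by have [] := sub _ (csub_centralizer (r h) csubT) (Lie_centralizer csubT Txi (esym cxi)) _ hg.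
Qed.

Lemma csub_flag_stabilizer x : x \in unitmx -> csub [set g | is_trig_mx (x *m r g *m invmx x)].
Proof.
move=> ux; have conjM g h : x *m r (g * h)%g *m invmx x =
    (x *m r g *m invmx x) *m (x *m r h *m invmx x).
  by rewrite rM !mulmxA mulmxKV.
split.
  split=> [|g h tg th|g tg] /=.
  - by rewrite r1 mulmx1 mulmxV.
  - by rewrite conjM; exact: trig_mulmx.
  - have -> : x *m r g^-1%g *m invmx x = invmx (x *m r g *m invmx x).
      rewrite rVE; set M := x *m r g *m invmx x.
      have uM : M \in unitmx by rewrite !unitmx_mul ux r_unit unitmx_inv ux.
      apply: (can_inj (mulKmx uM)); rewrite mulmxV // /M.
      by rewrite !mulmxA mulmxKV // mulmxK ?r_unit // mulmxV.
    by apply: trig_invmx => //; rewrite !unitmx_mul ux r_unit unitmx_inv ux.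
move=> g hg; apply/is_trig_mxP => i j ij; rewrite -ev_bilin; apply: hg => h /is_trig_mxP th.
by rewrite ev_bilin th.
Qed.

(** When [xi] is triangular in the flag [x], deriving an entry above the diagonal gives a
    combination of entries of the same row at or to the right of it, which are equations too. *)
Lemma Lie_flag_stabilizer x xi : x \in unitmx -> Lie setT xi ->
  Lie [set g | is_trig_mx (x *m r g *m invmx x)] xi <-> is_trig_mx (x *m xi *m invmx x).
Proof.
move=> ux Txi; split=> [hx|/is_trig_mxP tx].
  apply/is_trig_mxP => i j ij.
  have : vanish [set g | is_trig_mx (x *m r g *m invmx x)] (bilin x (invmx x) i j).
    by move=> g /is_trig_mxP tg; rewrite ev_bilin tg.
  by move/hx; rewrite lder_bilin ev_bilin mulmx1 mulmxA.
pose E : set R := [set p | exists i j : 'I_n, (i < j)%N /\ p = bilin x (invmx x) i j].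
apply: (@Lie_cut setT E _ _ csubT Txi) => [g||].
- split=> [/is_trig_mxP tg|[_ hg]].
    by split=> // _ [i [j [ij ->]]]; rewrite ev_bilin tg.
  by apply/is_trig_mxP => i j ij; rewrite -ev_bilin; apply: hg; exists i, j.
- by rewrite /= r1 mulmx1 mulmxV.
move=> _ [i [j [ij ->]]]; set I := ideal_gen _.
have [iI EI] := ideal_genP (vanish setT `|` E).
rewrite lder_bilin; have -> : xi *m invmx x = invmx x *m (x *m xi *m invmx x) by rewrite !mulmxA mulVmx // mul1mx.
rewrite bilin_mulr; apply: ideal_sum => // k _.
have [kj|jk] := ltnP k j; last first.
  by apply: (idealMl _ iI); apply: EI; right; exists i, k; split=> //; exact: leq_trans ij jk.
by rewrite tx // mpolyC0 mul0r; case: iI.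
Qed.

Variable iota : 'M[R]_n.
Hypothesis iotaE : forall g, map_mx (ev (r g)) iota = r g^-1%g.

Definition stab m (U : 'M[K]_(m, n * n)) : set G :=
  [set g | forall w, (mxvec w <= U)%MS -> (mxvec (r g *m w *m r g^-1%g) <= U)%MS].

Local Notation cmx := (map_mx (@mpolyC (n * n) K)).

Definition stab_eq m (U : 'M[K]_(m, n * n)) w j : R :=
  (mxvec (gen_mx K n *m cmx w *m iota) *m cmx (cokermx U)) 0 j.

Lemma ev_stab_eq m (U : 'M[K]_(m, n * n)) w j g :
  ev (r g) (stab_eq U w j) = (mxvec (r g *m w *m r g^-1%g) *m cokermx U) 0 j.
Proof.
have -> : ev (r g) (stab_eq U w j) =
    map_mx (ev (r g)) (mxvec (gen_mx K n *m cmx w *m iota) *m cmx (cokermx U)) 0 j.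
  by rewrite [RHS]mxE.
by rewrite map_mxM map_mxvec !map_mxM /= ev_gen !ev_cmx iotaE.
Qed.

Lemma stabP m (U : 'M[K]_(m, n * n)) g :
  stab U g <-> forall w j, (mxvec w <= U)%MS -> ev (r g) (stab_eq U w j) = 0.
Proof.
split=> [sg w j /sg|h w wU].
  by rewrite ev_stab_eq submxE => /eqP ->; rewrite mxE.
by rewrite submxE; apply/eqP/rowP => j; rewrite [RHS]mxE -ev_stab_eq h.
Qed.

Definition conj_mx (h : G) : 'M[K]_(n * n) := lin_mulmx (r h) *m lin_mulmxr (r h^-1%g).

Lemma conj_mxE h xi : mxvec xi *m conj_mx h = mxvec (r h *m xi *m r h^-1%g).
Proof. by rewrite mulmxA !mul_vec_lin. Qed.

Lemma row_free_conj h : row_free (conj_mx h).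
Proof.
apply/row_freeP; exists (conj_mx h^-1%g); apply/row_matrixP => i.
rewrite rowE mulmxA -[delta_mx _ _]vec_mxK !conj_mxE invgK !mulmxA (rV h).2.
by rewrite mul1mx -mulmxA (rV h).2 mulmx1 vec_mxK row1.
Qed.

Lemma csub_stab m (U : 'M[K]_(m, n * n)) : csub (stab U).
Proof.
split; last first.
  move=> g hg; apply/stabP => w j wU; apply: hg => h /stabP; exact.
split=> [w wU|x y sx sy w wU|x sx w wU].
- by rewrite invg1 r1 mul1mx mulmx1.
- have -> : r (x * y)%g *m w *m r (x * y)^-1%g =
      r x *m (r y *m w *m r y^-1%g) *m r x^-1%g by rewrite invgM !rM !mulmxA.
  exact: sx (sy _ wU).
(* An injective endomorphism of the finite-dimensional [U] is onto. *)
have Uf : (U *m conj_mx x <= U)%MS.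
  by apply/row_subP => i; rewrite row_mul -[row i U]vec_mxK conj_mxE; apply: sx; rewrite vec_mxK row_sub.
have /andP[_ UUf] : (U *m conj_mx x == U)%MS.
  by rewrite -(mxrank_leqif_eq Uf).2 mxrankMfree // row_free_conj.
have /submxP[D eD] := submx_trans wU UUf.
rewrite invgK; have -> : mxvec (r x^-1%g *m w *m r x) = D *m U; last exact: submxMl.
apply: (row_free_inj (row_free_conj x)); rewrite /= conj_mxE -[RHS]mulmxA -eD; congr mxvec.
by rewrite !mulmxA (rV x).1 mul1mx -mulmxA (rV x).1 mulmx1.
Qed.

(** The derivative of [g w g^-1] along [xi] is [g [xi, w] g^-1], so the equations for [w] are sent
    to those for [[xi, w]], up to functions vanishing on the group. *)
Lemma Lie_stab m (U : 'M[K]_(m, n * n)) xi : Lie setT xi ->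
  (forall w, (mxvec w <= U)%MS -> (mxvec (xi *m w - w *m xi) <= U)%MS) -> Lie (stab U) xi.
Proof.
move=> Txi hxi; pose E : set R := [set p | exists w j, (mxvec w <= U)%MS /\ p = stab_eq U w j].
have [sT cT] := csubT.
apply: (@Lie_cut setT E _ _ csubT Txi) => [g||].
- split=> [/stabP sg|[_ hg]]; first by split=> // _ [w [j [wU ->]]]; exact: sg.
  by apply/stabP => w j wU; apply: hg; exists w, j.
- by case: (csub_stab U) => -[].
(* Differentiate [g g^-1 = 1], which holds for [iota] only modulo functions vanishing on the group;
   [LieE] allows this. *)
have diota g : map_mx (ev (r g)) (map_mx (lder xi) iota) = - (xi *m r g^-1%g).
  have inv0 : map_mx (ev (r g)) (map_mx (lder xi) (gen_mx K n *m iota - cmx 1%:M)) = 0.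
    apply/matrixP => i j; rewrite [RHS]mxE [LHS]mxE [X in ev _ X]mxE.
    apply: (LieE sT Txi) => // h _.
    have -> : ev (r h) ((gen_mx K n *m iota - cmx 1%:M) i j) =
        map_mx (ev (r h)) (gen_mx K n *m iota - cmx 1%:M) i j by rewrite [RHS]mxE.
    by rewrite map_mxB map_mxM /= ev_gen ev_cmx iotaE (rV h).1 subrr mxE.
  have dB (A B : 'M[R]_n) : map_mx (lder xi) (A - B) = map_mx (lder xi) A - map_mx (lder xi) B.
    by apply/matrixP => i j; rewrite !mxE lderB.
  move: inv0; rewrite dB lder_mulmx lder_gen lder_cmx subr0 map_mxD !map_mxM /=.
  rewrite ev_gen ev_cmx iotaE => /eqP; rewrite addrC addr_eq0 => /eqP e.
  rewrite -[LHS]mul1mx -(rV g).2 -mulmxA e mulmxN !mulmxA.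
  by rewrite (rV g).2 mul1mx.
move=> _ [w [j [wU ->]]]; have [iI EI] := ideal_genP (vanish setT `|` E).
rewrite -[lder _ _](subrK (stab_eq U (xi *m w - w *m xi) j)); apply: (idealD iI); last first.
  by apply: EI; right; exists (xi *m w - w *m xi), j; split=> //; exact: hxi.
apply: EI; left=> g _; rewrite evB ev_stab_eq; apply/eqP; rewrite subr_eq0; apply/eqP.
have -> : ev (r g) (lder xi (stab_eq U w j)) = map_mx (ev (r g)) (map_mx (lder xi)
    (mxvec (gen_mx K n *m cmx w *m iota) *m cmx (cokermx U))) 0 j.
  by rewrite [RHS]mxE; congr ev; rewrite [RHS]mxE.
rewrite lder_mulmx lder_cmx mulmx0 addr0 map_mxM /= ev_cmx !map_mxvec !lder_mulmx lder_cmx.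
rewrite mulmx0 addr0 lder_gen map_mxD !map_mxM /= diota ev_gen !ev_cmx iotaE.
congr ((mxvec _ *m _) _ _).
by rewrite mulmxBr mulmxBl mulmxN !mulmxA.
Qed.

(** * Connected groups are determined by their Lie algebras *)

Definition yvar i : R := 'X_i - (mxvec (1%:M : 'M[K]_n) 0 i)%:MP.

Local Notation mpow := (ideal_pow yvar).

Lemma ev_yvar i : ev 1%:M (yvar i) = 0.
Proof. by rewrite /yvar evB evX evC subrr. Qed.

Lemma mpow1 p : ev 1%:M p = 0 -> mpow 1 p.
Proof.
suff h : mpow 1 (p - (ev 1%:M p)%:MP) by move=> p0; move: h; rewrite p0 mpolyC0 subr0.
have i1 := ideal_powP yvar 1.
elim/mpoly_alg_ind: p => [c|i|p q hp hq|p q hp hq].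
- by rewrite evC subrr; case: i1.
- by rewrite evX -/(yvar i) -[yvar i]mulr1; exact: ideal_powS.
- by rewrite evD mpolyCD opprD addrACA; exact: idealD.
rewrite evM mpolyCM; move: hp hq; move: (ev _ p)%:MP (ev _ q)%:MP => a b hp hq.
have -> : p * q - a * b = q * (p - a) + a * (q - b) by ring.
by apply: idealD => //; exact: idealMl.
Qed.

Definition grad q i := ev 1%:M q^`M(i).

Lemma taylor q : ev 1%:M q = 0 -> mpow 2 (q - \sum_i (grad q i)%:MP * yvar i).
Proof.
move=> /mpow1[b [_ eq]].
have gE i : grad q i = ev 1%:M (b i).
  rewrite /grad eq (raddf_sum (mderiv i)) ev_sum (bigD1 i) //= big1 ?addr0 => [|j ji].
    rewrite mderivM evD !evM ev_yvar mul0r addr0 /yvar mderivB mderivC subr0 mderiv_var eqxx.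
    by rewrite ev1 mul1r.
  rewrite mderivM evD !evM ev_yvar mul0r addr0 /yvar mderivB mderivC subr0 mderiv_var.
  by rewrite (negbTE ji) ev0 mul0r.
rewrite {1}eq -sumrB; apply: ideal_sum => [|i _]; first exact: (ideal_powP yvar 2).
rewrite gE [_%:MP * _]mulrC -mulrBr; apply: ideal_powS; apply: mpow1.
by rewrite evB evC subrr.
Qed.

(** * Comparing two closed subgroups to infinite order at 1 *)

Section Euler.
Variable H : set G.
Hypothesis cH : csub H.
Let I := vanish H.
Let iI : ideal I := vanish_ideal H.

(** Double orthogonality: [Lie H] is the orthogonal of the space of gradients at 1 of functions in
    [I], so a linear form killing [Lie H] is such a gradient, and its function agrees with it to
    first order. *)
Lemma linear_form_vanish (c : 'I_(n * n) -> K) :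
  (forall xi, Lie H xi -> \sum_i c i * mxvec xi 0 i = 0) ->
  ideal_add (mpow 2) I (\sum_i (c i)%:MP * yvar i).
Proof.
move=> hc; pose V := [set v : 'rV[K]_(n * n) | exists2 q, I q & v = \row_i grad q i].
have [||U UP] := @linear_set_mx K (n * n) V.
- exists 0; first by case: iI.
  by apply/rowP => i; rewrite !mxE /grad mderiv0 ev0.
- move=> a _ _ [p Ip ->] [q Iq ->]; exists (a%:MP * p + q); first by case: iI => _; apply.
  by apply/rowP => i; rewrite !mxE /grad mderivD mderiv_mulC evD evM evC.
have [q Iq /rowP eq] : V (\row_i c i).
  apply/UP; rewrite submxE; apply/eqP/rowP => j; rewrite [RHS]mxE.
  pose xi := vec_mx (col j (cokermx U))^T.
  rewrite mxE -[RHS](hc xi); first by apply: eq_bigr => i _; rewrite vec_mxK !mxE.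
  move=> q Iq; rewrite ev_lder mul1mx der.unlock.
  have : V (\row_i grad q i) by exists q.
  move/UP; rewrite submxE => /eqP/rowP/(_ j); rewrite [RHS]mxE => e; rewrite -[RHS]e mxE.
  by apply: eq_bigr => i _; rewrite vec_mxK !mxE.
have q1 : ev 1%:M q = 0 by rewrite -r1; apply: Iq; case: cH => -[].
have [iA A2 AI] := ideal_addP (ideal_powP yvar 2) iI.
have -> : \sum_i (c i)%:MP * yvar i = q - (q - \sum_i (grad q i)%:MP * yvar i).
  rewrite opprB addrC subrK; apply: eq_bigr => i _.
  by have := eq i; rewrite !mxE => ->.
by apply: (idealB iA); [exact: AI|exact/A2/taylor].
Qed.

Let P : {P : 'M[K]_(n * n) | (forall i, Lie H (vec_mx (row i P))) /\
  (forall xi, Lie H xi -> mxvec xi *m P = mxvec xi)}.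
Proof.
apply: cid.
have [||U UP] := @linear_set_mx K (n * n) [set v | Lie H (vec_mx v)].
- by rewrite /= linear0; exact: (Lie_linear H).1.
- by move=> c u v /= hu hv; rewrite linearP; exact: (Lie_linear H).2.
exists (proj_mx U (U^C)%MS); split=> [i|xi hx].
  by apply/UP; rewrite rowE proj_mx_sub.
by apply: proj_mx_id; [exact: capmx_compl|apply/UP; rewrite /= mxvecK].
Qed.

Let xi_ i := vec_mx (row i (sval P)).

(* The projected Euler vector field, tangent to [H]. *)
Let euler p := \sum_i yvar i * lder (xi_ i) p.

Let eulerM p q : euler (p * q) = euler p * q + p * euler q.
Proof.
rewrite /euler mulr_suml mulr_sumr -big_split; apply: eq_bigr => i _ /=.
rewrite lderM; move: (lder _ p) (lder _ q) (yvar i) => a b c; ring.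
Qed.

Let euler_sum (J : finType) (F : J -> R) : euler (\sum_j F j) = \sum_j euler (F j).
Proof.
rewrite /euler exchange_big; apply: eq_bigr => i _.
by rewrite lder_sum mulr_sumr.
Qed.

(** The first-order part of the difference is a linear form that vanishes on [Lie H], since the
    projection [P] is the identity there. *)
Let euler_yvar l : ideal_add (mpow 2) I (euler (yvar l) - yvar l).
Proof.
have [iA A2 AI] := ideal_addP (ideal_powP yvar 2) iI.
pose z i := lder (xi_ i) (yvar l) - (sval P i l)%:MP.
have hz i : mpow 1 (z i).
  apply: mpow1; rewrite evB evC ev_lder mul1mx /yvar derD derX -mpolyCN derC addr0.
  by rewrite /xi_ vec_mxK mxE subrr.
have -> : euler (yvar l) - yvar l =
    \sum_i yvar i * z i + \sum_i (sval P i l - (i == l)%:R)%:MP * yvar i.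
  rewrite -big_split (eq_bigr (fun i => yvar i * lder (xi_ i) (yvar l) - (i == l)%:R * yvar i)).
    rewrite sumrB /euler; congr (_ - _); rewrite (bigD1 l) //= eqxx mul1r big1 ?addr0 // => i.
    by move=> /negbTE ->; rewrite mul0r.
  move=> i _ /=; rewrite /z mpolyCB mpolyC_nat.
  by move: (lder _ _) ((sval P i l)%:MP) => a b; ring.
apply: (idealD iA); last first.
  apply: linear_form_vanish => xi hx; have [_ hP] := svalP P.
  have := congr1 (fun v : 'rV_(n * n) => v 0 l) (hP xi hx); rewrite mxE => e.
  rewrite (eq_bigr (fun i => mxvec xi 0 i * sval P i l - (i == l)%:R * mxvec xi 0 i)).
    rewrite sumrB e (bigD1 l) //= eqxx mul1r big1 ?addr0 ?subrr // => i /negbTE ->.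
    by rewrite mul0r.
  by move=> i _; rewrite mulrBl mulrC.
by apply: ideal_sum => // i _; apply: A2; exact: ideal_powS (hz i).
Qed.

(** Euler's identity for degree [k], extended from the coordinates by the Leibniz rule. *)
Let euler_mpow k p : mpow k p -> ideal_add (mpow k.+1) I (euler p - k%:R * p).
Proof.
elim: k p => [|k IH] p.
  move=> _; have [iA A1 AI] := ideal_addP (ideal_powP yvar 1) iI; apply: A1.
  by rewrite mul0r subr0; exists (fun i => lder (xi_ i) p).
move=> [b [hb ->]]; have [iA Ak AI] := ideal_addP (ideal_powP yvar k.+2) iI.
rewrite euler_sum mulr_sumr -sumrB; apply: ideal_sum => // i _.
have -> : euler (yvar i * b i) - k.+1%:R * (yvar i * b i) =
    (euler (yvar i) - yvar i) * b i + yvar i * (euler (b i) - k%:R * b i).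
  rewrite eulerM -[k.+1]addn1 natrD; move: (euler (yvar i)) (euler (b i)) (yvar i) => x z y.
  by ring.
apply: (idealD iA).
  have [u [v [hu hv ->]]] := euler_yvar i; rewrite mulrDl; apply: (idealD iA).
    by apply: Ak; exact: (ideal_powM hu (hb i)).
  by apply: AI; exact: idealMr iI hv.
have [u [v [hu hv ->]]] := IH _ (hb i); rewrite mulrDr; apply: (idealD iA).
  by apply: Ak; exact: ideal_powS.
by apply: AI; exact: idealMl iI hv.
Qed.

(** Induction on the order. Write [f = b + v] with [b] of order [k + 1] and [v] in [I]. The
    derivatives of [f] along [Lie H] again vanish on [S], so by induction [euler f] has order
    [k + 2] modulo [I]; but it is [(k + 1) b] up to such terms, and [k + 1] is invertible. *)
Lemma vanish_mpow S k : is_subgroup S -> Lie H `<=` Lie S ->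
  vanish S `<=` ideal_add (mpow k) I.
Proof.
move=> sS LS; have [S1 _ _] := sS; have [LP _] := svalP P.
elim: k => [|k IH] f hf.
  by have [_ A0 _] := ideal_addP (ideal_powP yvar 0) iI; exact: A0.
have [iA Ak AI] := ideal_addP (ideal_powP yvar k.+1) iI.
case: k IH Ak iA AI => [|k] IH Ak iA AI.
  by apply: Ak; apply: mpow1; rewrite -r1; exact: hf.
have he : ideal_add (mpow k.+2) I (euler f).
  apply: ideal_sum => // i _.
  have [u [v [hu hv ->]]] := IH _ (LieE sS (LS _ (LP i)) hf).
  by rewrite mulrDr; apply: (idealD iA); [exact/Ak/ideal_powS|apply: AI; exact: idealMl iI hv].
have [b [v [hb hv ef]]] := IH f hf.
have hev : I (euler v).
  by apply: ideal_sum => [|i _]; [exact: iI|apply: (idealMl _ iI); exact: (LieE cH.1 (LP i))].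
have eD : euler f = euler b + euler v.
  by rewrite /euler -big_split; apply: eq_bigr => i _; rewrite ef lderD mulrDr.
have k0 : (k.+1%:R : K) != 0 by rewrite ((charf0P K).1 char0).
rewrite ef; apply: (idealD iA); last exact: AI.
have -> : b = (k.+1%:R^-1)%:MP * (euler f - euler v - (euler b - k.+1%:R * b)).
  rewrite eD addrK opprB addrC subrK -mpolyC_nat mulrA -mpolyCM mulVf //.
  by rewrite mpolyC1 mul1r.
apply: (idealMl _ iA); apply: (idealB iA); last exact: euler_mpow.
by apply: (idealB iA) => //; exact: AI.
Qed.
End Euler.

Definition connG H := forall C D, closedG C -> closedG D -> H `<=` C `|` D ->
  H `&` C `&` D = set0 -> H `<=` C \/ H `<=` D.

Lemma connG_lie_group X : X `<=` Lie setT -> connG (lie_group X).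
Proof.
move=> XT C D cC cD sub dis; have [[H1 _ _] _] := csub_lie_group X.
case: (sub _ H1) => [C1|D1]; first by left; exact: lie_group_pieces sub dis C1.
right; apply: (@lie_group_pieces X D C) => //; first by rewrite setUC.
by rewrite setIAC.
Qed.

(* By Krull's theorem a closed subgroup [P] with [Lie H `<=` Lie P] contains a
   neighbourhood of 1 in [H], so that [H `&` P] is open and closed in [H]. *)
Lemma connG_sub_Lie H P : csub H -> connG H -> csub P -> Lie H `<=` Lie P -> H `<=` P.
Proof.
move=> cH conH cP LHP; have [[H1 HM HV] _] := cH; have [[P1 PM PV] closP] := cP.
have [e [e1 he]] := krull (phi := ev 1%:M) (@noetherian_mpoly K (n * n)) (vanish_ideal H) ev_yvar.
have nbh h : H h -> ev (r h) e != 0 -> P h.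
  move=> Hh eh; apply: (closP) => p hp; apply/eqP.
  have := he p (fun k => vanish_mpow cH k cP.1 LHP hp) h Hh.
  by rewrite evM => /eqP; rewrite mulf_eq0 (negbTE eh).
(* The translates by [H] and [P] of the neighbourhood where [e] is nonzero stay inside [P]; [D] is
   the closed complement of their union. *)
pose D : set G := [set g | forall q : G, H q -> P q -> ev (r (q^-1 * g)%g) e = 0].
have nD g : H g -> P g -> ~ D g.
  move=> Hg Pg /(_ g Hg Pg); rewrite mulVg r1 e1 => /eqP; by rewrite oner_eq0.
have [||||//|HD] := conH P D.
- exact: closP.
- move=> g hg q Hq Pq; have [p [ep _]] := substitution (r q^-1%g) 1%:M e.
  have := hg p; rewrite ep mulmx1 -rM => -> // h Dh.
  by rewrite ep mulmx1 -rM Dh.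
- move=> h Hh; have [Ph|nPh] := pselect (P h); [by left|right=> q Hq Pq].
  apply/eqP; apply: contraT => ne; exfalso; apply: nPh.
  rewrite -(mulVKg q h); apply: (PM) => //; apply: nbh => //.
  by apply: (HM) => //; exact: HV.
- by apply/seteqP; split=> // g [[Hg Pg] Dg]; exact: nD Dg.
- by have := nD _ H1 P1 (HD _ H1).
Qed.

End LieAlgebras.

(** * Affine groups are linear *)

Section Minors.
Variables (K : fieldType) (S T : Type) (I : finType) (a : I -> S -> K) (b : I -> T -> K).
Variable Phi : S -> T -> K.
Hypothesis PhiE : forall s t, Phi s t = \sum_i a i s * b i t.

Let minor n (u : 'I_n -> S) (v : 'I_n -> T) : 'M[K]_n := \matrix_(i, j) Phi (u i) (v j).

(** Invertible minors have size at most [#|I|]. Bordering a largest one by [(s, t)] gives a singular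
    matrix, so the Schur complement, which is the difference of the two sides, is 0. *)
Lemma maximal_minor : exists n (u : 'I_n -> S) (v : 'I_n -> T),
  (\matrix_(i, j) Phi (u i) (v j) : 'M[K]_n) \in unitmx /\
  forall s t, Phi s t = (\row_j Phi s (v j) *m invmx (\matrix_(i, j) Phi (u i) (v j))
                         *m \col_i Phi (u i) t) 0 0.
Proof.
pose good n := `[< exists (u : 'I_n -> S) (v : 'I_n -> T), minor u v \in unitmx >].
have g0 : exists n, good n.
  exists 0%N; apply/asboolP; have f (X : Type) (i : 'I_0) : X by case: i.
  by exists (@f S), (@f T); rewrite unitmxE det_mx00 unitr1.
have gn n : good n -> (n <= #|I|)%N.
  move=> /asboolP[u [v]]; rewrite -row_full_unit => /eqP <-.
  have -> : minor u v = (\matrix_(i < n, k < #|I|) a (enum_val k) (u i)) *m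
      (\matrix_(k < #|I|, j < n) b (enum_val k) (v j)).
    apply/matrixP => i j; rewrite !mxE PhiE (reindex _ (onW_bij _ (enum_val_bij I))).
    by apply: eq_bigr => k _; rewrite !mxE.
  exact: leq_trans (mxrankM_maxl _ _) (rank_leq_col _).
case: (ex_maxnP g0 gn) => n /asboolP[u [v uB]] maxn; exists n, u, v; split=> // s t.
set x := (X in _ = X); apply/eqP; rewrite -subr_eq0; apply: contraT => d0.
suff /maxn : good (n + 1)%N by rewrite addn1 ltnn.
apply/asboolP.
pose u' (k : 'I_(n + 1)) := if split k is inl i then u i else s.
pose v' (k : 'I_(n + 1)) := if split k is inl i then v i else t.
exists u', v'; pose B := minor u v; rewrite -/B in uB.
pose A : 'rV[K]_n := \row_j Phi s (v j); pose C : 'cV[K]_n := \col_i Phi (u i) t.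
have -> : minor u' v' = block_mx 1%:M 0 (A *m invmx B) 1%:M *m block_mx B C 0 (Phi s t - x)%:M.
  rewrite mulmx_block !mul1mx !mul0mx !addr0 mulmxKV //.
  have -> : A *m invmx B *m C + (Phi s t - x)%:M = (Phi s t)%:M.
    by apply/matrixP => i j; rewrite !ord1 [LHS]mxE -/x !mxE eqxx !mulr1n addrC subrK.
  apply/matrixP => i j; rewrite /minor /u' /v' mxE.
  by case: (split_ordP i) => i' ->; case: (split_ordP j) => j' ->;
    rewrite ?(block_mxEul, block_mxEur, block_mxEdl, block_mxEdr) ?split_lshift ?split_rshift;
    rewrite ?mxE ?ord1 ?eqxx ?mulr1n.
rewrite unitmx_mul; apply/andP; split; rewrite unitmxE ?det_lblock ?det_ublock ?det1 ?mulr1 ?unitr1 //.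
by rewrite det_scalar expr1 unitrM -unitmxE uB unitfE.
Qed.

End Minors.

Lemma evalrow_split (K : fieldType) m d (p : {mpoly K[m + m]}) (v w : 'rV[K]_m) :
  (msize p <= d)%N ->
  evalrow p (row_mx v w) = \sum_(k : 'X_{1..(m + m)%N < d})
    (\prod_i v 0 i ^+ (k : 'X_{1..(m + m)%N}) (lshift m i)) *
    (p@_k * \prod_i w 0 i ^+ (k : 'X_{1..(m + m)%N}) (rshift m i)).
Proof.
move=> pd; rewrite /evalrow {1}(mpolywE pd) raddf_sum; apply: eq_bigr => k _ /=.
rewrite mevalZ mevalX mulrCA big_split_ord; congr (_ * (_ * _)); apply: eq_bigr => i _.
  by rewrite row_mxEl.
by rewrite row_mxEr.
Qed.

Lemma evalrow_comp (K : fieldType) m k (p : {mpoly K[m]}) (q : 'I_m -> {mpoly K[k]}) (v : 'rV[K]_k) (w : 'rV[K]_m) :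
  (forall i, w 0 i = evalrow (q i) v) -> evalrow p w = evalrow (p \mPo [tuple q i | i < m]) v.
Proof.
move=> wq; rewrite /evalrow comp_mpoly_meval; apply: meval_eq => i.
by rewrite tnth_map tnth_ord_tuple wq.
Qed.

Lemma ev_evalrow (K : fieldType) n (A : 'M[K]_n) p : ev A p = evalrow p (mxvec A).
Proof. by rewrite ev.unlock. Qed.

(** The right translates of the coordinate functions span a finite-dimensional space, because
    multiplication is polynomial; [f] is a basis of it obtained from a maximal minor, and [r] is the
    matrix of right translation, [f (g x) = f g *m r x]. Since [f g = f 1 *m r g], the coordinates
    of [g] are linear in the entries of [r g], which gives [kappa]. *)
Lemma linearization (K : fieldType) (G : affine_group K) : exists n (r : G -> 'M[K]_n)
    (rho : 'I_n -> 'I_n -> {mpoly K[ag_dim G]}) (kappa : 'I_(ag_dim G) -> {mpoly K[n * n]}),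
  [/\ forall g h, r (g * h)%g = r g *m r h, r 1%g = 1%:M,
      forall g i j, r g i j = evalrow (rho i j) (ag_coord g) &
      forall g j, ag_coord g 0 j = ev (r g) (kappa j)].
Proof.
have [P hP] := ag_mul_regular G.
pose m := ag_dim G; pose c := @ag_coord _ G.
pose Phi (g : G) (jh : 'I_m * G) := c (g * jh.2)%g 0 jh.1.
pose d := \max_j msize (P j).
pose a (k : 'X_{1..(m + m)%N < d}) g := \prod_i c g 0 i ^+ (k : 'X_{1..(m + m)%N}) (lshift m i).
pose b (k : 'X_{1..(m + m)%N < d}) (jh : 'I_m * G) :=
  (P jh.1)@_k * \prod_i c jh.2 0 i ^+ (k : 'X_{1..(m + m)%N}) (rshift m i).
have [|n [u [v [uB PhiE]]]] := @maximal_minor K G ('I_m * G) _ a b Phi.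
  move=> g [j h]; rewrite /Phi /= /c (hP (g, h) I) /=; apply: evalrow_split.
  exact: leq_bigmax.
set B : 'M[K]_n := \matrix_(_, _) _ in uB PhiE.
pose f g : 'rV[K]_n := \row_j Phi g (v j).
pose r (x : G) : 'M[K]_n := invmx B *m \matrix_(k, i) Phi (u k * x)%g (v i).
have fM g x : f (g * x)%g = f g *m r x.
  apply/rowP => i; rewrite mxE /Phi -mulgA.
  have := PhiE g ((v i).1, (x * (v i).2)%g); rewrite {1}/Phi /= => ->.
  rewrite /r mulmxA; rewrite [LHS]mxE [RHS]mxE; apply: eq_bigr => k _; rewrite !mxE /Phi /=.
  by rewrite mulgA.
have finj (A A' : 'M[K]_n) : (forall g, f g *m A = f g *m A') -> A = A'.
  move=> h; apply: (can_inj (mulKmx uB)); apply/row_matrixP => i; rewrite !row_mul.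
  by have -> : row i B = f (u i) by apply/rowP => j; rewrite !mxE.
have mull x : exists q, forall g i, c (x * g)%g 0 i = evalrow (q i) (c g).
  exists (fun i => P i \mPo [tuple (match split l with inl l' => (c x 0 l')%:MP
    | inr l' => 'X_l' end) | l < m + m]) => g i.
  rewrite /c (hP (x, g) I); apply: evalrow_comp => l /=; rewrite mxE /evalrow.
  by case: (split l) => l'; rewrite ?mevalC ?mevalXU.
have mulr x : exists q, forall g i, c (g * x)%g 0 i = evalrow (q i) (c g).
  exists (fun i => P i \mPo [tuple (match split l with inl l' => 'X_l'
    | inr l' => (c x 0 l')%:MP end) | l < m + m]) => g i.
  rewrite /c (hP (g, x) I); apply: evalrow_comp => l /=; rewrite mxE /evalrow.
  by case: (split l) => l'; rewrite ?mevalC ?mevalXU.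
have regPhi x jh : exists q, forall g, Phi (x * g)%g jh = evalrow q (c g).
  have [q1 h1] := mull x; have [q2 h2] := mulr jh.2.
  exists (q2 jh.1 \mPo [tuple q1 l | l < m]) => g.
  by rewrite /Phi h2; apply: evalrow_comp => l; exact: h1.
have /choice[rho0 h0] : forall kl : 'I_n * 'I_n, exists q, forall g,
    Phi (u kl.1 * g)%g (v kl.2) = evalrow q (c g) by move=> [k l]; exact: regPhi.
have rM g h : r (g * h)%g = r g *m r h.
  by apply: finj => x; rewrite -fM mulgA !fM mulmxA.
exists n, r, (fun i j => \sum_k (invmx B i k)%:MP * rho0 (k, j)),
  (fun j => \sum_i \sum_k (f 1%g 0 i * (invmx B *m \col_l Phi (u l) (j, 1%g)) k 0)%:MP * 'X_(mxvec_index i k)).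
split=> // [|g i j|g j].
- by apply: finj => x; rewrite -fM mulg1 mulmx1.
- rewrite mxE /evalrow raddf_sum; apply: eq_bigr => k _.
  rewrite /= mevalM mevalC; congr (_ * _); rewrite mxE.
  exact: (h0 (k, j)).
have -> : c g 0 j = Phi g (j, 1%g) by rewrite /Phi mulg1.
rewrite PhiE -mulmxA -/(f g) -{1}[g]mul1g fM -mulmxA.
set w := invmx B *m _.
rewrite mxE ev_sum; apply: eq_bigr => i _; rewrite ev_sum.
have -> : (r g *m w) i 0 = \sum_k r g i k * w k 0 by rewrite mxE.
by rewrite mulr_sumr; apply: eq_bigr => k _; rewrite evM evC evX mxvecE mulrAC mulrA.
Qed.

(** * Transport of the Zariski topology to the matrix group *)

Section LinearizedGroup.
Variables (K : closedFieldType) (G : affine_group K) (n : nat) (r : G -> 'M[K]_n).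
Variables (rho : 'I_n -> 'I_n -> {mpoly K[ag_dim G]}) (kappa : 'I_(ag_dim G) -> {mpoly K[n * n]}).
Hypothesis r1 : r 1%g = 1%:M.
Hypothesis rM : forall g h, r (g * h)%g = r g *m r h.
Hypothesis rhoE : forall g i j, r g i j = evalrow (rho i j) (ag_coord g).
Hypothesis kappaE : forall g j, ag_coord g 0 j = ev (r g) (kappa j).

Lemma r_inj : injective r.
Proof.
move=> g h e; apply: (@ag_coord_inj _ G); apply/rowP => j.
by rewrite !kappaE e.
Qed.

Lemma pull_rho p : exists q, forall g, ev (r g) p = evalrow q (ag_coord g).
Proof.
exists (p \mPo [tuple mxvec (\matrix_(i, j) rho i j) 0 k | k < n * n]) => g.
rewrite ev_evalrow; apply: evalrow_comp => k; case/mxvec_indexP: k => i j.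
by rewrite !mxvecE mxE.
Qed.

Lemma pull_kappa q : exists p, forall g, evalrow q (ag_coord g) = ev (r g) p.
Proof.
exists (q \mPo [tuple kappa k | k < ag_dim G]) => g.
by rewrite ev_evalrow; apply: evalrow_comp => k; rewrite kappaE ev_evalrow.
Qed.

(** The polynomials [kappa] send [A] into the closed set of coordinates of [G], because they do so
    on the image of [r]; and [rho] after [kappa] is the identity on that image, hence at [A]. *)
Lemma linear_closed (A : 'M[K]_n) : (forall p, (forall g, ev (r g) p = 0) -> ev A p = 0) ->
  exists g, r g = A.
Proof.
move=> hA; have [S rangeS] := ag_closed G.
pose v := \row_j ev A (kappa j).
have evq q : evalrow q v = ev A (q \mPo [tuple kappa k | k < ag_dim G]).
  by rewrite ev_evalrow; apply: evalrow_comp => k; rewrite mxE ev_evalrow.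
have [g _ eg] : range (@ag_coord K G) v.
  rewrite rangeS => q Sq; rewrite evq; apply: hA => g.
  have : range (@ag_coord K G) (ag_coord g) by exists g.
  rewrite rangeS => /(_ q Sq) <-; rewrite ev_evalrow; apply/esym; apply: evalrow_comp => k.
  by rewrite kappaE ev_evalrow.
exists g; apply/matrixP => i j; rewrite rhoE eg evq; apply/eqP; rewrite -subr_eq0.
have := hA (rho i j \mPo [tuple kappa k | k < ag_dim G] - 'X_(mxvec_index i j)).
rewrite evB evX mxvecE => -> // h; rewrite evB evX mxvecE rhoE.
apply/eqP; rewrite subr_eq0; apply/eqP/esym; rewrite ev_evalrow; apply: evalrow_comp => k.
by rewrite kappaE ev_evalrow.
Qed.

Lemma linear_inverse : exists iota : 'M[{mpoly K[n * n]}]_n,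
  forall g, map_mx (ev (r g)) iota = r g^-1%g.
Proof.
have [P hP] := ag_inv_regular G.
pose q (ij : 'I_n * 'I_n) := rho ij.1 ij.2 \mPo [tuple P k | k < ag_dim G].
have /choice[p hp] : forall ij, exists p, forall g, evalrow (q ij) (ag_coord g) = ev (r g) p.
  by move=> ij; exact: pull_kappa.
exists (\matrix_(i, j) p (i, j)) => g; apply/matrixP => i j.
rewrite !mxE -hp rhoE; apply/esym; apply: evalrow_comp => k.
exact: hP.
Qed.

Lemma zclosedE (A : set G) : zclosed (@ag_coord K G) A <-> closedG r A.
Proof.
split=> [[S ->] g hg s Ss|cA].
  have [p hp] := pull_kappa s; rewrite hp; apply: hg => h Sh.
  by rewrite -hp; exact: Sh.
exists [set q | forall g, A g -> evalrow q (ag_coord g) = 0].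
apply/seteqP; split=> [g Ag q|g hg]; first exact.
apply: cA => p hp; have [q hq] := pull_rho p.
by rewrite hq; apply: hg => h Ah; rewrite -hq; exact: hp.
Qed.

Lemma zconnectedE (A : set G) : zconnected (@ag_coord K G) A <-> connG r A.
Proof.
by split=> h C D cC cD; apply: h; apply/zclosedE.
Qed.

Lemma closed_subgroupE (A : set G) : closed_subgroup A <-> csub r A.
Proof. by split=> -[sA cA]; split=> //; apply/zclosedE. Qed.

End LinearizedGroup.

(** * Borel subgroups and the reducibility criterion *)

Section Frames.
Variables (K : fieldType) (m : nat).
Implicit Types (s : nat) (w l A : 'M[K]_m).

(** A subspace as the [s]-th step of a full flag: frames then range over a flag variety and
    [flags_complete] covers Grassmannians as well. *)
Definition fspan s w : 'M[K]_m := pid_mx s *m w.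

Lemma rank_fspan s w : (s <= m)%N -> w \in unitmx -> \rank (fspan s w) = s.
Proof. by move=> sm uw; rewrite mxrankMfree ?row_free_unit // rank_pid_mx. Qed.

Lemma frame_exists A : exists2 u, u \in unitmx & (fspan (\rank A) u :=: A)%MS.
Proof.
exists (row_ebase A); first exact: row_ebase_unit.
apply: eqmx_trans (eqmx_sym _) _; last exact: eqmx_refl.
rewrite -{1}(mulmx_ebase A) /fspan -mulmxA.
by apply: eqmxMfull; rewrite row_full_unit col_ebase_unit.
Qed.

Lemma fspan_trig s l w : l \in unitmx -> w \in unitmx -> is_trig_mx l ->
  (fspan s (l *m w) :=: fspan s w)%MS.
Proof.
move=> ul uw /is_trig_mxP tl.
have e : (pid_mx s : 'M_m) *m l = (pid_mx s : 'M_m) *m l *m pid_mx s.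
  apply/matrixP => i j; rewrite [RHS]mxE (bigD1 j) //= big1 ?addr0 => [|k /negbTE kj]; last first.
    by rewrite [X in _ * X]mxE (kj : (k == j :> nat) = false) mulr0.
  rewrite [X in _ * X]mxE eqxx; case: (ltnP j s) => js; rewrite ?mulr1 // mulr0.
  rewrite mxE big1 // => k _; rewrite mxE; case: eqP => [/ord_inj <-|_]; last by rewrite mul0r.
  by case: ltnP => is_; rewrite ?mul0r // tl ?mulr0 //; exact: leq_trans is_ js.
have /mxrank_leqif_eq : (fspan s (l *m w) <= fspan s w)%MS.
  by rewrite /fspan mulmxA e -mulmxA submxMl.
case=> _; rewrite /fspan mulmxA !mxrankMfree ?row_free_unit // eqxx => /esym/eqmxP.
exact.
Qed.

(** The adjugate in place of the inverse keeps the equations polynomial in [w]; the two differ by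
    the unit [\det w]. *)
Lemma mem_fspan s w (v : 'rV[K]_m) : (s <= m)%N -> w \in unitmx ->
  (v <= fspan s w)%MS <-> v *m \adj w *m copid_mx s = 0.
Proof.
move=> sm uw; split=> [/submxP[a ->]|].
  by rewrite /fspan -!mulmxA (mulmxA w) mul_mx_adj mul_scalar_mx -scalemxAr mul_pid_mx_copid // scaler0 mulmx0.
rewrite /copid_mx mulmxBr mulmx1 => /eqP; rewrite subr_eq0 => /eqP e.
have : (\det w *: v <= fspan s w)%MS.
  by rewrite -mul_mx_scalar -mul_adj_mx mulmxA e -mulmxA submxMl.
move/(scalemx_sub (\det w)^-1); rewrite scalerA mulVf ?scale1r //.
by rewrite -unitfE -unitmxE.
Qed.

Lemma linear_rows A (Q : set 'rV[K]_m) : Q 0 -> (forall c (u v : 'rV_m), Q u -> Q v -> Q (c *: u + v)) ->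
  (forall v, (v <= A)%MS -> Q v) <-> forall i, Q (row i A).
Proof.
move=> Q0 QD; split=> [h i|h v /submxP[a ->]]; first exact/h/row_sub.
rewrite mulmx_sum_row; elim/big_rec: _ => // i x _ Qx; exact: QD.
Qed.

End Frames.

Lemma pol_evalrow (K : fieldType) T {s : space K T} m (phi : T -> 'rV[K]_m) (p : {mpoly K[m]}) :
  polmap phi -> pol (fun t => evalrow p (phi t)).
Proof.
move=> hphi; rewrite /evalrow; elim/mpoly_alg_ind: p => [c|i|p q hp hq|p q hp hq].
- by apply: eq_pol (pol_cst c) => t; rewrite mevalC.
- by apply: eq_pol (pol_entry 0 i hphi) => t; rewrite mevalXU.
- by apply: eq_pol (pol_add hp hq) => t; rewrite mevalD.
- by apply: eq_pol (pol_mul hp hq) => t; rewrite mevalM.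
Qed.

(** * Borel subgroups as stabilisers of flags *)

Section Borel.
Variables (K : closedFieldType) (n : nat) (G : groupType) (r : G -> 'M[K]_n).
Hypothesis char0 : [char K] =i pred0.
Hypothesis uK : uncountable K.
Hypothesis r1 : r 1%g = 1%:M.
Hypothesis rM : forall g h, r (g * h)%g = r g *m r h.
Hypothesis rclosed : forall A, (forall p, (forall g, ev (r g) p = 0) -> ev A p = 0) ->
  exists g, r g = A.
Hypothesis r_inj : injective r.
Variable iota : 'M[{mpoly K[n * n]}]_n.
Hypothesis iotaE : forall g, map_mx (ev (r g)) iota = r g^-1%g.
Hypothesis connT : connG r setT.

Local Notation N := (n * n)%N.
Local Notation csub := (csub r).
Local Notation connG := (connG r).
Local Notation Lie := (Lie r).
Local Notation lie_group := (lie_group r).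
Implicit Types (H B M P : set G) (x : 'M[K]_n) (v : 'rV[K]_N) (U W : 'M[K]_N).

#[local] Instance rep_space : space K G := [set f | exists i j, f = fun g => r g i j].

Lemma polmap_rep : polmap (K := K) r.
Proof. by apply: polmap_mx => i j; apply: pol_coord; exists i, j. Qed.

Lemma pol_ev T {s : space K T} (phi : T -> 'M[K]_n) p : polmap phi -> pol (fun t => ev (phi t) p).
Proof.
move=> hphi; under eq_fun do rewrite ev_evalrow.
by apply: pol_evalrow; exact: polmap_mxvec.
Qed.

Lemma pol_repP (f : G -> K) : pol f -> exists p, forall g, f g = ev (r g) p.
Proof.
elim=> [a|_ [i [j ->]]|f1 f2 _ [p1 e1] _ [p2 e2]|f1 f2 _ [p1 e1] _ [p2 e2]].
- by exists a%:MP => g; rewrite evC.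
- by exists 'X_(mxvec_index i j) => g; rewrite evX mxvecE.
- by exists (p1 + p2) => g; rewrite evD e1 e2.
- by exists (p1 * p2) => g; rewrite evM e1 e2.
Qed.

Lemma closedpG (A : set G) : closedp (K := K) A <-> closedG r A.
Proof.
split=> [cA g hg|cA g nAg].
  apply: contrapT => /cA[f [/pol_repP[p ep] fA]]; rewrite ep hg ?eqxx // => a /fA.
  by rewrite ep.
have /existsNP[p /not_implyP[hp ne]] : ~ forall p, vanish r A p -> ev (r g) p = 0 by move=> /cA.
by exists (fun h => ev (r h) p); split=> //; [exact: pol_ev polmap_rep|exact/eqP].
Qed.

Lemma connGP (A : set G) : connG A -> conn (K := K) A.
Proof. by move=> cA C D /closedpG cC /closedpG cD; exact: cA. Qed.

Lemma polM_rep : polmap (K := K) (fun gh : G * G => gh.1 * gh.2)%g.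
Proof.
have h : polmap (K := K) (fun gh : G * G => r gh.1 *m r gh.2).
  by apply: polmap_mulmx; apply: (polmap_comp _ polmap_rep);
    [apply: polmap_fst|apply: polmap_snd]; exact: polmap_id.
apply: polmap_coords => _ [i [j ->]]; apply: eq_pol (pol_entry i j h) => -[g g'] /=.
by rewrite rM.
Qed.

Lemma polV_rep : polmap (K := K) (fun g : G => g^-1)%g.
Proof.
apply: polmap_coords => _ [i [j ->]]; apply: eq_pol (pol_ev (iota i j) polmap_rep) => g /=.
by rewrite -iotaE [RHS]mxE.
Qed.

Lemma Lie_mx S : exists U : 'M[K]_N, forall xi, Lie S xi <-> (mxvec xi <= U)%MS.
Proof.
have [||U UP] := @linear_set_mx K N [set v | Lie S (vec_mx v)].
- by rewrite /= linear0; exact: (Lie_linear r S).1.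
- by move=> c u v /= hu hv; rewrite linearP; exact: (Lie_linear r S).2.
by exists U => xi; rewrite -UP /= mxvecK.
Qed.

Lemma flag_mx x : exists T : 'M[K]_N, forall v,
  (v <= T)%MS <-> is_trig_mx (x *m vec_mx v *m \adj x).
Proof.
have [||T TP] := @linear_set_mx K N [set v | is_trig_mx (x *m vec_mx v *m \adj x)].
- by rewrite /= linear0 mulmx0 mul0mx; apply/is_trig_mxP => i j _; rewrite mxE.
- move=> c u v /is_trig_mxP hu /is_trig_mxP hv; apply/is_trig_mxP => i j ij.
  rewrite linearP mulmxDr mulmxDl -scalemxAr -scalemxAl mxE hv // addr0 mxE hu //.
  by rewrite mulr0.
by exists T => v; rewrite -TP.
Qed.

Let g := sval (cid (Lie_mx setT)).
Let gP xi : Lie setT xi <-> (mxvec xi <= g)%MS := svalP (cid (Lie_mx setT)) xi.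
Let T x := sval (cid (flag_mx x)).
Let TP x v : (v <= T x)%MS <-> is_trig_mx (x *m vec_mx v *m \adj x) := svalP (cid (flag_mx x)) v.

Lemma flag_mxP x xi : x \in unitmx -> (mxvec xi <= T x)%MS <-> is_trig_mx (x *m xi *m invmx x).
Proof.
move=> ux; rewrite TP mxvecK; have d0 : \det x != 0 by rewrite -unitfE -unitmxE.
rewrite /invmx ux -scalemxAr; split=> /is_trig_mxP h; apply/is_trig_mxP => i j ij.
  by rewrite mxE h // mulr0.
by apply: (mulfI (invr_neq0 d0)); rewrite mulr0 -(h i j ij) [RHS]mxE.
Qed.

Lemma flag_mx_conj x h : x \in unitmx -> (T x *m conj_mx r h^-1%g <= T (x *m r h))%MS.
Proof.
move=> ux; apply/rV_subP => _ /submxP[a ->]; rewrite mulmxA -[a *m T x]vec_mxK conj_mxE.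
have uh := r_unit r1 rM h.
apply/flag_mxP; first by rewrite unitmx_mul ux.
have ta : (a *m T x <= T x)%MS by exact: submxMl.
move: ta; rewrite -{1}[a *m _]vec_mxK => /(flag_mxP _ ux); congr is_trig_mx.
have -> : invmx (x *m r h) = r h^-1%g *m invmx x.
  apply: (can_inj (mulKmx (_ : x *m r h \in unitmx))); first by rewrite unitmx_mul ux.
  by rewrite mulmxV ?unitmx_mul ?ux // mulmxA -(mulmxA x) (rV r1 rM h).1 mulmx1 mulmxV.
rewrite invgK; move: (vec_mx _) => A.
rewrite !mulmxA -(mulmxA x (r h)) (rV r1 rM h).1 mulmx1.
by rewrite -(mulmxA _ (r h)) (rV r1 rM h).1 mulmx1.
Qed.

Lemma flag_mx_trig l x v : l \in unitmx -> is_trig_mx l -> x \in unitmx ->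
  (v <= T x)%MS -> (v <= T (l *m x))%MS.
Proof.
move=> ul tl ux; rewrite -[v]vec_mxK => /(flag_mxP _ ux) tv.
apply/flag_mxP; first by rewrite unitmx_mul ul.
have -> : invmx (l *m x) = invmx x *m invmx l.
    apply: (can_inj (mulKmx (_ : l *m x \in unitmx))); first by rewrite unitmx_mul ul.
    by rewrite mulmxV ?unitmx_mul ?ul // mulmxA mulmxK // mulmxV.
  rewrite mulmxA -mulmxA -mulmxA !mulmxA; apply: trig_mulmx (trig_invmx ul tl).
  by rewrite -!mulmxA; apply: trig_mulmx => //; rewrite mulmxA.
Qed.

(* The flag varieties of Borel subgroups: flags whose stabiliser meets the Lie
   algebra, or a subspace [W], in dimension at least [d]. *)
Definition flagsub d W : set 'M[K]_n := [set x | exists2 u, u \in unitmx &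
  forall v, (v <= fspan d u)%MS -> (v <= W)%MS /\ (v <= T x)%MS].

Lemma flagsubP d W x : (d <= N)%N -> flagsub d W x <-> (d <= \rank (W :&: T x)%MS)%N.
Proof.
move=> dN; split=> [[u uu h]|hd].
  rewrite -(rank_fspan dN uu); apply: mxrankS; rewrite sub_capmx.
  by apply/andP; split; apply/rV_subP => v /h[].
have [u uu e] := frame_exists (W :&: T x)%MS; exists u => // v hv.
suff : (v <= W :&: T x)%MS by rewrite sub_capmx => /andP.
rewrite -e; apply: submx_trans hv _; rewrite /fspan.
set k := \rank _ in hd *.
have e' : (pid_mx d : 'M[K]_N) = (pid_mx d : 'M[K]_N) *m (pid_mx k : 'M[K]_N).
  by rewrite mul_pid_mx (minn_idPl hd) (minn_idPr dN).
by rewrite e' -mulmxA submxMl.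
Qed.

Lemma closedp_trig X {s : space K X} m (phi : X -> 'M[K]_m) :
  polmap phi -> closedp [set t | is_trig_mx (phi t)].
Proof.
move=> hphi; apply: (@closedp_ext _ _ _ [set t | forall i j : 'I_m, (i < j)%N -> phi t i j = 0]).
  by split=> t /= h; apply/is_trig_mxP.
apply: closedpI => i; apply: closedpI => j; apply: closedp_imp => _.
by apply: closedp0; exact: pol_entry.
Qed.

Lemma closedp_submx X {s : space K X} m k (phi : X -> 'rV[K]_m) (U : 'M[K]_(k, m)) :
  polmap phi -> closedp [set t | (phi t <= U)%MS].
Proof.
move=> hphi; apply: (@closedp_ext _ _ _ [set t | phi t *m cokermx U = 0]).
  by split=> t /=; rewrite submxE => /eqP.
by apply: closedp_eqmx; [apply: polmap_mulmx|]; exact: polmap_cst || exact: hphi.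
Qed.

Lemma polmap_flag X {s : space K X} (phi : X -> 'M[K]_n) (psi : X -> 'rV[K]_N) :
  polmap phi -> polmap psi -> polmap (fun t => phi t *m vec_mx (psi t) *m \adj (phi t)).
Proof.
move=> h1 h2; apply: polmap_mulmx; last exact: polmap_adj.
by apply: polmap_mulmx => //; exact: polmap_vec_mx.
Qed.

(** The frame [u] witnessing a large intersection ranges over a flag variety, so it can be
    eliminated from equations in [u] and [x]. *)
Lemma closedp_flagsub d W : closedp (flagsub d W).
Proof.
pose Z : set ('M[K]_N * 'M[K]_n) :=
  [set ux | forall v, (v <= fspan d ux.1)%MS -> (v <= W)%MS /\ (v <= T ux.2)%MS].
apply: (@flags_complete K N _ (@mx_space K n n) Z); last first.
  by move=> l u x ul tl uu /= h v; rewrite (fspan_trig d ul uu tl) => /h.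
apply: (@closedp_ext _ _ _ [set ux | forall i, (row i (fspan d ux.1) <= W)%MS /\
    is_trig_mx (ux.2 *m vec_mx (row i (fspan d ux.1)) *m \adj ux.2)]).
  split=> -[u x] /=.
    move=> h; apply/linear_rows => [|c v w [vW vT] [wW wT]|i].
    - by rewrite !sub0mx.
    - by split; apply: addmx_sub => //; apply: scalemx_sub.
    - by case: (h i) => rW /TP.
  by move=> h i; have [|rW /TP] := h (row i (fspan d u)); first exact: row_sub.
have p2 : polmap (K := K) (fun ux : 'M[K]_N * 'M[K]_n => ux.2) by apply: polmap_snd; exact: polmap_id.
have p1 i : polmap (K := K) (fun ux : 'M[K]_N * 'M[K]_n => row i (fspan d ux.1)).
  by apply: polmap_row; apply: polmap_mulmx; [exact: polmap_cst|apply: polmap_fst; exact: polmap_id].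
apply: closedpI => i; apply: closedp_and; first exact: closedp_submx.
by apply: closedp_trig; exact: polmap_flag.
Qed.

Definition csolv H := [/\ csub H, connG H & is_solvable H].

Definition is_borelG B := csolv B /\ forall M, csolv M -> B `<=` M -> M = B.

Definition flag_stab x : set G := [set h | is_trig_mx (x *m r h *m invmx x)].

Lemma flag_stab_solvable x H : x \in unitmx -> is_subgroup H -> H `<=` flag_stab x -> is_solvable H.
Proof.
move=> ux sH HS; apply: (@trig_solvable _ _ _ (fun h => x *m r h *m invmx x)) => //.
- by move=> h k; rewrite rM !mulmxA mulmxKV.
- by rewrite r1 mulmx1 mulmxV.
- move=> h k /(congr1 (fun A => invmx x *m A *m x)).
  by rewrite !mulmxA mulVmx // !mul1mx -!mulmxA mulVmx // !mulmx1 => /r_inj.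
Qed.

(** Moving [x] by [H] conjugates [T x] and preserves [W], hence the dimension of their intersection:
    the flags in question form a closed [H]-stable set to which the fixed point theorem applies. *)
Lemma fixed_flagsub d W H : (d <= N)%N -> csolv H ->
  (forall h, H h -> (W *m conj_mx r h <= W)%MS) ->
  (exists2 x, x \in unitmx & flagsub d W x) ->
  exists x, [/\ x \in unitmx, flagsub d W x & H `<=` flag_stab x].
Proof.
move=> dN [[sH cH] conH solH] stW exW.
have [||||x [ux Yx hx]] := fixed_flag (phi := r) polM_rep polV_rep sH (connGP conH) solH _ (@closedp_flagsub d W); last by exists x.
- by split; [exact: polmap_rep|exact: r1|move=> h k _ _; exact: rM].
- move=> l x ul tl ux [u uu h]; exists u; first exact: uu.
  by move=> v /h[vW vT]; split; [exact: vW|exact: flag_mx_trig].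
- move=> x h ux /(flagsubP W x dN) hx Hh; apply/(flagsubP _ _ dN).
  apply: (leq_trans hx); rewrite -(mxrankMfree _ (row_free_conj r1 rM h^-1%g)); apply: mxrankS.
  rewrite sub_capmx; apply/andP; split.
    apply: submx_trans (stW h^-1%g _); last by case: sH => _ _; apply.
    by apply: submxMr; exact: capmxSl.
  apply: submx_trans (flag_mx_conj h ux).
  by apply: submxMr; exact: capmxSr.
- exact: exW.
Qed.

Let b x : 'M[K]_N := (g :&: T x)%MS.

Lemma max_flag : exists d, [/\ exists2 x, x \in unitmx & \rank (b x) = d,
  (d <= N)%N & forall x, x \in unitmx -> (\rank (b x) <= d)%N].
Proof.
pose good d := `[< exists2 x, x \in unitmx & \rank (b x) = d >].
have g0 : exists d, good d.
  by exists (\rank (b 1%:M)); apply/asboolP; exists 1%:M => //; exact: unitmx1.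
have gn d : good d -> (d <= N)%N by move=> /asboolP[x _ <-]; exact: rank_leq_row.
case: (ex_maxnP g0 gn) => d gd maxd; exists d; split; [exact/asboolP|exact: gn|].
by move=> x ux; apply: maxd; apply/asboolP; exists x.
Qed.

Let d := sval (cid max_flag).
Let d_ex : exists2 x, x \in unitmx & \rank (b x) = d.
Proof. by case: (svalP (cid max_flag)). Qed.
Let dN : (d <= N)%N. Proof. by case: (svalP (cid max_flag)). Qed.
Let d_max x : x \in unitmx -> (\rank (b x) <= d)%N.
Proof. by case: (svalP (cid max_flag)) => _ _; apply. Qed.

(** Generated by its Lie algebra rather than taken to be [flag_stab x], which need not be
    connected. *)
Let B x := lie_group [set xi | (mxvec xi <= b x)%MS].

Let bP x xi : (mxvec xi <= b x)%MS <-> Lie setT xi /\ (mxvec xi <= T x)%MS.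
Proof. by rewrite sub_capmx gP; split=> [/andP|/andP]. Qed.

Let b_sub_g x : [set xi | (mxvec xi <= b x)%MS] `<=` Lie setT.
Proof. by move=> xi /bP[]. Qed.

Let b_flag_stab x : x \in unitmx -> [set xi | (mxvec xi <= b x)%MS] `<=` Lie (flag_stab x).
Proof.
move=> ux xi /bP[Lxi /(flag_mxP _ ux)].
by move/(Lie_flag_stabilizer char0 uK r1 rM rclosed ux Lxi).
Qed.

Let flag_stab_b x S : x \in unitmx -> S `<=` flag_stab x -> Lie S `<=` [set xi | (mxvec xi <= b x)%MS].
Proof.
move=> ux Sx xi Sxi; have Lxi : Lie setT xi by apply: Lie_mono Sxi.
apply/bP; split=> //; apply/(flag_mxP _ ux).
apply/(Lie_flag_stabilizer char0 uK r1 rM rclosed ux Lxi).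
exact: Lie_mono Sxi.
Qed.

Let B_flag_stab x : x \in unitmx -> B x `<=` flag_stab x.
Proof.
by move=> ux; apply: lie_group_min (csub_flag_stabilizer r1 rM ux) (b_flag_stab ux).
Qed.

Let Lie_B x xi : x \in unitmx -> Lie (B x) xi <-> (mxvec xi <= b x)%MS.
Proof.
move=> ux; split; first exact: (flag_stab_b ux (B_flag_stab ux)).
by move=> hxi; apply: (Lie_lie_group char0 uK r1 rM rclosed (@b_sub_g x)).
Qed.

Lemma csolv_B x : x \in unitmx -> csolv (B x).
Proof.
move=> ux; split; [exact: csub_lie_group|exact: (connG_lie_group char0 uK r1 rM rclosed (@b_sub_g x))|].
by apply: flag_stab_solvable ux _ (B_flag_stab ux); exact: (csub_lie_group _ _).1.
Qed.

Let sub_B x M : x \in unitmx -> csub M -> connG M -> M `<=` flag_stab x -> M `<=` B x.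
Proof.
move=> ux cM conM Mx; apply: (connG_sub_Lie char0 r1 rM cM conM); first exact: csub_lie_group.
by move=> xi /(flag_stab_b ux Mx)/(Lie_B _ ux).
Qed.

Lemma g_conj h : (g *m conj_mx r h <= g)%MS.
Proof.
apply/rV_subP => _ /submxP[a ->]; rewrite mulmxA -[a *m g]vec_mxK conj_mxE.
apply/gP; apply: (Lie_conj r1 rM); [by split|by []|].
by apply/gP; rewrite vec_mxK submxMl.
Qed.

(** With [W] the whole Lie algebra, [fixed_flagsub] finds a fixed flag among those with [b x] of
    dimension at least, hence exactly, [d]. *)
Lemma csolv_sub_B M : csolv M -> exists x, [/\ x \in unitmx, \rank (b x) = d & M `<=` B x].
Proof.
move=> sM; have [[cM conM _] [x0 ux0 ex0]] := (sM, d_ex).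
have [h _||x [ux /(flagsubP _ _ dN) fx Mx]] := @fixed_flagsub d g M dN sM.
- exact: g_conj.
- by exists x0 => //; apply/(flagsubP _ _ dN); rewrite -ex0.
exists x; split; [exact: ux| |exact: sub_B].
by apply/eqP; rewrite eqn_leq d_max.
Qed.

(** A larger connected solvable [M] lies in some [B y] with [b y] of the same dimension [d]; so
    [b x = b y], and the groups generated coincide. *)
Lemma borel_B x : x \in unitmx -> \rank (b x) = d -> is_borelG (B x).
Proof.
move=> ux rx; split=> [|M sM BM]; first exact: csolv_B.
have [y [uy ry My]] := csolv_sub_B sM; apply/seteqP; split=> [h /My|]; last exact: BM.
have bxy : (b x <= b y)%MS.
  apply/rV_subP => v vb; rewrite -[v]vec_mxK; apply/(Lie_B _ uy).
  by apply: (Lie_mono (subset_trans BM My)); apply/(Lie_B _ ux); rewrite vec_mxK.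
have byx : (b y <= b x)%MS.
  by have := mxrank_leqif_sup bxy; rewrite /= => -[_ <-]; rewrite rx ry.
apply: (lie_group_min (csub_lie_group r _)).
by move=> xi /= hxi; apply/(Lie_B _ ux); exact: submx_trans byx.
Qed.

Lemma borelP (A : set G) : is_borelG A -> exists x, [/\ x \in unitmx, \rank (b x) = d & A = B x].
Proof.
move=> [sA maxA]; have [x [ux rx Ax]] := csolv_sub_B sA; exists x; split=> //.
by rewrite (maxA _ (csolv_B ux) Ax).
Qed.

(** * The equations of reducibility *)

Section Criterion.
Variables (Y : Type) (sY : space K Y) (m : nat) (sig sig' : 'I_m -> Y -> 'M[K]_n).
Hypothesis psig : forall i, polmap (K := K) (sig i).
Hypothesis psig' : forall i, polmap (K := K) (sig' i).

(* Membership in [fspan s w], for an invertible [w], by polynomial equations. *)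
Let mem s (w : 'M[K]_N) v := v *m \adj w *m copid_mx s = 0.

Let mem_linear s w : mem s w 0 /\ forall c u v, mem s w u -> mem s w v -> mem s w (c *: u + v).
Proof.
split=> [|c u v hu hv]; rewrite /mem ?mul0mx //.
by rewrite mulmxDl -scalemxAl mulmxDl -scalemxAl hu hv scaler0 addr0.
Qed.

Let memP s w v : (s <= N)%N -> w \in unitmx -> mem s w v <-> (v <= fspan s w)%MS.
Proof. by move=> sN uw; rewrite mem_fspan. Qed.

Let bracket (v w : 'rV[K]_N) : 'rV[K]_N := mxvec (vec_mx v *m vec_mx w - vec_mx w *m vec_mx v).

Let bracketDl (c : K) (u v w : 'rV[K]_N) : bracket (c *: u + v) w = c *: bracket u w + bracket v w.
Proof.
apply: (can_inj (@vec_mxK K n n)); rewrite /bracket (linearP vec_mx c) (linearP vec_mx c) /= !mxvecK.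
by rewrite mulmxDl mulmxDr -!scalemxAl -!scalemxAr scalerBr opprD addrACA.
Qed.

Let bracketDr (c : K) (u v w : 'rV[K]_N) : bracket w (c *: u + v) = c *: bracket w u + bracket w v.
Proof.
apply: (can_inj (@vec_mxK K n n)); rewrite /bracket (linearP vec_mx c) (linearP vec_mx c) /= !mxvecK.
by rewrite mulmxDl mulmxDr -!scalemxAl -!scalemxAr scalerBr opprD addrACA.
Qed.

(* [u] and [w] are frames of the Lie algebras of a Borel subgroup, the
   stabiliser of the flag [x], and of a parabolic subgroup containing it. *)
Definition crit s : set ('M[K]_N * ('M[K]_N * ('M[K]_n * Y))) :=
  [set z | let: (w, (u, (x, y))) := z in
    (forall v, (v <= fspan d u)%MS -> [/\ (v <= g)%MS, (v <= T x)%MS, mem s w v &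
       forall v', (v' <= fspan s w)%MS -> mem s w (bracket v v')]) /\
    forall i v', (v' <= fspan s w)%MS -> mem s w (mxvec (sig i y *m vec_mx v' *m sig' i y))].

Lemma closedp_crit s : closedp (K := K) (crit s).
Proof.
pose X := ('M[K]_N * ('M[K]_N * ('M[K]_n * Y)))%type.
have pid : polmap (K := K) (@id X) by exact: polmap_id.
have pw : polmap (K := K) (fun z : X => z.1) by exact: polmap_fst.
have pu : polmap (K := K) (fun z : X => z.2.1) by apply: polmap_fst; exact: polmap_snd.
have px : polmap (K := K) (fun z : X => z.2.2.1).
  by apply: polmap_fst; apply: polmap_snd; exact: polmap_snd.
have py : polmap (K := K) (fun z : X => z.2.2.2).
  by apply: polmap_snd; apply: polmap_snd; exact: polmap_snd.
pose ru i (z : X) := row i (fspan d z.2.1); pose rw i (z : X) := row i (fspan s z.1).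
have pru i : polmap (K := K) (ru i).
  by apply: polmap_row; apply: polmap_mulmx => //; exact: polmap_cst.
have prw i : polmap (K := K) (rw i).
  by apply: polmap_row; apply: polmap_mulmx => //; exact: polmap_cst.
have cmem (phi : X -> 'rV[K]_N) : polmap (K := K) phi -> closedp (K := K) [set z | mem s z.1 (phi z)].
  move=> pphi; apply: closedp_eqmx; last exact: polmap_cst.
  apply: polmap_mulmx; last exact: polmap_cst.
  by apply: polmap_mulmx => //; exact: polmap_adj.
apply: (@closedp_ext _ _ _ ([set z : X | forall i, [/\ (ru i z <= g)%MS,
    is_trig_mx (z.2.2.1 *m vec_mx (ru i z) *m \adj z.2.2.1), mem s z.1 (ru i z) &
    forall j, mem s z.1 (bracket (ru i z) (rw j z))]] `&`
  [set z : X | forall i j, mem s z.1 (mxvec (sig i z.2.2.2 *m vec_mx (rw j z) *m sig' i z.2.2.2))])).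
  split=> -[w [u [x y]]] /=; rewrite /ru /rw /=; have [m0 mD] := mem_linear s w.
    move=> [h1 h2]; split; last first.
      move=> i; apply/linear_rows => [|c v v' hv hv'|j].
      - by rewrite !(linear0, mulmx0, mul0mx).
      - rewrite linearP mulmxDr mulmxDl -scalemxAr -scalemxAl linearP; exact: mD.
      - exact: h2.
    apply/linear_rows => [|c v v' [vg vT vm vb] [vg' vT' vm' vb']|i].
    - split; rewrite ?sub0mx // => v' _.
      by rewrite /bracket !(linear0, mulmx0, mul0mx, subrr).
    - split.
      + by apply: addmx_sub => //; apply: scalemx_sub.
      + by apply: addmx_sub => //; apply: scalemx_sub.
      + exact: mD.
      + move=> v'' hv''; rewrite bracketDl; apply: mD; [exact: vb|exact: vb'].
    - have [rg /TP rT rm rb] := h1 i; split=> //.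
      apply/linear_rows => [|c v v' hv hv'|j]; last exact: rb.
        by rewrite /bracket !(linear0, mulmx0, mul0mx, subrr).
      by rewrite bracketDr; exact: mD.
  move=> [h1 h2]; split=> [i|i j]; last by apply: h2; exact: row_sub.
  have [|rg /TP rT rm rb] := h1 (row i (fspan d u)); first exact: row_sub.
  by split=> // j; apply: rb; exact: row_sub.
apply: closedp_and.
  apply: closedpI => i.
  pose F k : set X := match k with
    | 0%N => [set z | (ru i z <= g)%MS]
    | 1%N => [set z | is_trig_mx (z.2.2.1 *m vec_mx (ru i z) *m \adj z.2.2.1)]
    | 2%N => [set z | mem s z.1 (ru i z)]
    | _ => [set z | forall j, mem s z.1 (bracket (ru i z) (rw j z))] end.
  apply: (@closedp_ext _ _ _ [set z | forall k, F k z]).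
    split=> z /=; last by move=> [h0 h1 h2 h3] [|[|[|k]]].
    by move=> h; split; [exact: h 0%N|exact: h 1%N|exact: h 2%N|exact: h 3%N].
  apply: closedpI => -[|[|[|k]]] /=.
  - exact: closedp_submx.
  - by apply: closedp_trig; exact: polmap_flag.
  - exact: cmem.
  apply: closedpI => j; apply: cmem; apply: polmap_mxvec.
  by apply: polmap_submx; apply: polmap_mulmx; exact: polmap_vec_mx.
apply: closedpI => i; apply: closedpI => j; apply: cmem; apply: polmap_mxvec.
apply: polmap_mulmx; last exact: (polmap_comp py (psig' i)).
by apply: polmap_mulmx; [exact: (polmap_comp py (psig i))|exact: polmap_vec_mx].
Qed.

Definition reducible_points : set Y := [set y | exists s : 'I_(\rank g),
  exists2 x, x \in unitmx & exists2 u, u \in unitmx & exists2 w, w \in unitmx &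
  crit s (w, (u, (x, y)))].

Let rank_g_leq (s : 'I_(\rank g)) : (s <= N)%N.
Proof. by apply: leq_trans (ltnW (ltn_ord s)) _; exact: rank_leq_row. Qed.

(** [s] takes finitely many values, and [w], [u], [x] matter only up to triangular factors, so
    [flags_complete] eliminates each of them in turn. *)
Lemma closedp_reducible : closedp reducible_points.
Proof.
apply: closedp_bigU => s; have sN := rank_g_leq s.
have c1 := @flags_complete K N _ _ (crit s) (@closedp_crit s).
have {}c1 : closedp (K := K) [set z : 'M[K]_N * ('M[K]_n * Y) |
    exists2 w, w \in unitmx & crit s (w, z)].
  apply: c1 => l w [u [x y]] ul tl uw [h1 h2].
  have meml v : mem s w v -> mem s (l *m w) v.
    move/(memP _ sN uw) => hv; apply/memP => //; first by rewrite unitmx_mul ul.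
    by rewrite (fspan_trig s ul uw tl).
  split=> [v /h1[vg vT vm vb]|i v'].
    split=> //; first exact: meml.
    by move=> v'; rewrite (fspan_trig s ul uw tl) => /vb/meml.
  by rewrite (fspan_trig s ul uw tl) => /h2-/(_ i)/meml.
have c2 := @flags_complete K N _ _ _ c1.
have {}c2 : closedp (K := K) [set z : 'M[K]_n * Y | exists2 u, u \in unitmx &
    exists2 w, w \in unitmx & crit s (w, (u, z))].
  apply: c2 => l u [x y] ul tl uu [w uw [h1 h2]]; exists w => //; split=> // v.
  by rewrite (fspan_trig d ul uu tl) => /h1.
apply: (@flags_complete K n _ _ _ c2) => l x y ul tl ux [u uu [w uw [h1 h2]]].
exists u; first exact: uu.
exists w; first exact: uw.
split; last exact: h2.
by move=> v /h1[vg vT vm vb]; split; [exact: vg|exact: flag_mx_trig|exact: vm|exact: vb].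
Qed.

Variables (y : Y) (h : 'I_m -> G).
Hypothesis sigE : forall i, sig i y = r (h i).
Hypothesis sigE' : forall i, sig' i y = r (h i)^-1%g.

Lemma parabolic_reducible P : csub P -> P <> setT -> (exists2 A, is_borelG A & A `<=` P) ->
  (forall i, P (h i)) -> reducible_points y.
Proof.
move=> cP nP [_ /borelP[x [ux rx ->]] BP] hP.
have [W WP] := Lie_mx P.
have Wg : (W <= g)%MS.
  apply/rV_subP => v vW; rewrite -[v]vec_mxK; apply/gP; apply: (Lie_mono (S := P)) => //.
  by apply/WP; rewrite vec_mxK.
(* Equality of the Lie algebras would force the connected group [G] into [P]. *)
have sg : (\rank W < \rank g)%N.
  have [le eq] := mxrank_leqif_sup Wg; rewrite ltn_neqAle le andbT eq.
  apply/negP => gW; apply: nP; apply/seteqP; split=> // z _.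
  apply: (connG_sub_Lie char0 r1 rM (@csubT _ _ _ r) connT cP) => // xi /gP hxi.
  by apply/WP; exact: submx_trans gW.
have [u uu eu] := frame_exists (b x); have [w uw ew] := frame_exists W.
rewrite rx in eu.
exists (Ordinal sg), x => //; exists u => //; exists w => //.
have sN := rank_g_leq (Ordinal sg); rewrite /= in sN.
have Lie_b v : (v <= b x)%MS -> (v <= W)%MS.
  move=> vb; rewrite -[v]vec_mxK; apply/WP; apply: (Lie_mono BP); apply/(Lie_B _ ux).
  by rewrite vec_mxK.
split=> [v|i v']; rewrite ?eu ?ew => hv.
  have := hv; rewrite sub_capmx => /andP[vg vT]; split=> //.
    by apply/memP => //; rewrite ew; exact: Lie_b.
  move=> v'; rewrite ew => hv'; apply/memP => //; rewrite ew; apply/WP.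
  by apply: (Lie_bracket r1 rM cP.1); apply/WP; rewrite vec_mxK //; exact: Lie_b.
apply/memP => //; rewrite ew sigE sigE'; apply/WP; apply: (Lie_conj r1 rM cP.1) => //.
by apply/WP; rewrite vec_mxK.
Qed.

Lemma reducible_parabolic : reducible_points y ->
  exists P, [/\ csub P, P <> setT, exists2 A, is_borelG A & A `<=` P & forall i, P (h i)].
Proof.
move=> [s [x ux [u uu [w uw [h1 h2]]]]]; have sN := rank_g_leq s.
set W := fspan s w in h1 h2.
have memW v : mem s w v -> (v <= W)%MS by move/(memP _ sN uw).
(* The frame spans [d] dimensions inside [b x], which has at most [d]; so it spans [b x], and [x] is
   the flag of a Borel subgroup. *)
have bu : (fspan d u <= b x)%MS.
  by apply/rV_subP => v /h1[vg vT _ _]; rewrite sub_capmx vg.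
have ub : (b x <= fspan d u)%MS.
  by have [_ <-] := mxrank_leqif_sup bu; rewrite eqn_leq (mxrankS bu) rank_fspan ?d_max.
have rx : \rank (b x) = d.
  by apply/eqP; rewrite eqn_leq d_max //= -{1}(rank_fspan dN uu) (mxrankS bu).
have cstab := csub_stab r1 rM iotaE W.
exists (stab r W); split=> //.
- move=> stT.
  have stW k : (W *m conj_mx r k <= W)%MS.
    apply/rV_subP => _ /submxP[a ->]; rewrite mulmxA -[a *m W]vec_mxK conj_mxE.
    have : stab r W k by rewrite stT.
    by apply; rewrite vec_mxK submxMl.
  suff gW : (g <= W)%MS.
    by have := mxrankS gW; rewrite rank_fspan // leqNgt ltn_ord.
  apply/rV_subP => v vg; rewrite -[v]vec_mxK; set xi := vec_mx v.
  have Lxi : Lie setT xi by apply/gP; rewrite vec_mxK.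
  have xiT : [set xi] `<=` Lie setT by move=> _ ->.
  set M := lie_group [set xi]; have cM : csub M by exact: csub_lie_group.
  have sM : csolv M.
    split=> //; first exact: (connG_lie_group char0 uK r1 rM rclosed xiT).
    exists 1%N => /= z dz; apply: dz => [|_ [k [l [Mk Ml ->]]]].
      split=> [|? ? -> ->|? ->] //; first by rewrite mulg1.
      by rewrite invg1.
    rewrite /= /commg /conjg.
    by rewrite (lie_group1_comm char0 uK r1 rM rclosed r_inj Lxi Mk Ml) mulKg mulVg.
  (* The flag [x] itself meets [W :&: g] in dimension [d]. The flag [y0] fixed by the commutative
     group [M] does too, so maximality of [d] forces [b y0], which contains [xi], into [W]. *)
  have [k _||y0 [uy fy My]] := @fixed_flagsub d (W :&: g)%MS M dN sM.
  - rewrite sub_capmx; apply/andP; split.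
      by apply: submx_trans (stW k); apply: submxMr; exact: capmxSl.
    by apply: submx_trans (g_conj k); apply: submxMr; exact: capmxSr.
  - exists x => //; exists u => // v' /h1[vg' vT' /memW vW' _].
    by rewrite sub_capmx vW' vg'.
  have [u' uu' hu'] := fy.
  have by_W : (b y0 <= fspan d u')%MS.
    have sub : (fspan d u' <= b y0)%MS.
      by apply/rV_subP => v' /hu'[]; rewrite !sub_capmx => /andP[_ ->].
    by have [_ <-] := mxrank_leqif_sup sub; rewrite eqn_leq (mxrankS sub) rank_fspan ?d_max.
  have : (mxvec xi <= b y0)%MS.
    apply: (flag_stab_b uy My); apply: (Lie_lie_group char0 uK r1 rM rclosed xiT).
    by [].
  move=> hxi; have := submx_trans hxi by_W => /hu'[].
  by rewrite sub_capmx => /andP[].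
- exists (B x); first exact: borel_B.
  apply: lie_group_min => // xi hxi.
  apply: (Lie_stab char0 uK r1 rM rclosed iotaE); first exact: b_sub_g hxi.
  move=> v hv; have [_ _ _ hb] := h1 _ (submx_trans hxi ub).
  by have := hb _ hv; rewrite /bracket !mxvecK => /memW.
- move=> i v hv; have := h2 i _ hv; rewrite mxvecK sigE sigE'.
  exact: memW.
Qed.

End Criterion.

End Borel.

(** * Openness of irreducibility *)

(** Cantor's nested intervals: if every colour class were contained in a finite list [s d],
    intervals avoiding [s 0], [s 1], ... successively would have a common point [c], which is in
    [s (f c)]. *)
Lemma uncountable_real (R : realType) : uncountable R.
Proof.
move=> f; apply: contrapT => /forallNP nf.
have /choice[s hs] : forall d, exists s : seq R, forall x, f x = d -> x \in s.
  move=> d; have /existsNP[r nr] := nf d.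
  pose good k := `[< exists s : seq R, [/\ uniq s, size s = k & {in s, forall x, f x = d}] >].
  have g0 : exists k, good k by exists 0%N; apply/asboolP; exists [::].
  have gr k : good k -> (k <= r)%N.
    move=> /asboolP[s [us <- hs]]; rewrite leqNgt; apply/negP => rs; apply: nr.
    exists (take r s); split; first exact: take_uniq.
      by rewrite size_take rs.
    by move=> x /mem_take/hs.
  case: (ex_maxnP g0 gr) => k /asboolP[s [us ks hs]] maxk; exists s => x fx.
  apply: contraT => xs; suff /maxk : good k.+1 by rewrite ltnn.
  apply/asboolP; exists (x :: s); split=> //=; rewrite ?xs ?ks //.
  by move=> z; rewrite inE => /predU1P[->//|/hs].
have avoid (t : seq R) (a b : R) : a < b -> exists a' b', [/\ a <= a', a' < b', b' <= b &
    forall x, x \in t -> ~ (a' <= x <= b')].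
  elim: t => [|z t IH] ab; first by exists a, b.
  have [a1 [b1 [aa1 ab1 b1b h1]]] := IH ab.
  (* The outer third on the side away from [z] misses it. *)
  have [zle|zgt] := leP z ((a1 + b1) / 2).
    exists ((a1 + b1 + b1) / 3), b1; split=> //; try lra.
    move=> x; rewrite inE => /predU1P[->|/h1 nx] /andP[lx xl]; first lra.
    by apply: nx; apply/andP; split=> //; lra.
  exists a1, ((a1 + a1 + b1) / 3); split=> //; try lra.
  move=> x; rewrite inE => /predU1P[->|/h1 nx] /andP[lx xl]; first lra.
  by apply: nx; apply/andP; split=> //; lra.
have /choice[step hstep] : forall kI : nat * (R * R), exists J : R * R, kI.2.1 < kI.2.2 ->
    [/\ kI.2.1 <= J.1, J.1 < J.2, J.2 <= kI.2.2 & forall x, x \in s kI.1 -> ~ (J.1 <= x <= J.2)].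
  move=> [k [a b]] /=; have [ab|] := boolP (a < b); last by exists (0, 0).
  by have [a' [b' h]] := avoid (s k) a b ab; exists (a', b').
pose I := fix I k := if k is k'.+1 then step (k', I k') else (0, 1) : R * R.
have I1 k : (I k).1 < (I k).2.
  by elim: k => [|k IH] /=; [exact: Num.Theory.ltr01|case: (hstep (k, I k) IH)].
have Ia k l : (k <= l)%N -> (I k).1 <= (I l).1.
  elim: l => [|l IH]; first by rewrite leqn0 => /eqP ->.
  rewrite leq_eqVlt => /predU1P[->//|/IH h]; apply: (le_trans h).
  by case: (hstep (l, I l) (I1 l)).
have Ib k l : (k <= l)%N -> (I l).2 <= (I k).2.
  elim: l => [|l IH]; first by rewrite leqn0 => /eqP ->.
  rewrite leq_eqVlt => /predU1P[->//|/IH]; apply: le_trans.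
  by case: (hstep (l, I l) (I1 l)).
have Iab k l : (I k).1 <= (I l).2.
  apply: le_trans (Ia _ _ (leq_maxl k l)) _; apply: le_trans (ltW (I1 _)) _.
  exact: Ib (leq_maxr k l).
pose c := sup (range (fun k => (I k).1)).
have supA : has_sup (range (fun k => (I k).1)).
  split; first by exists (I 0%N).1; exists 0%N.
  by exists (I 0%N).2 => _ [k _ <-].
have cI k : (I k).1 <= c <= (I k).2.
  apply/andP; split; first by apply: ub_le_sup; [exact: supA.2|exists k].
  by apply: ge_sup; [exact: supA.1|move=> _ [l _ <-]].
have [_ _ _ /(_ c)] := hstep (f c, I (f c)) (I1 _).
by move=> /(_ (hs _ _ erefl)); apply; exact: (cI (f c).+1).
Qed.

Lemma uncountable_complex (R : realType) : uncountable (complex R).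
Proof.
move=> f; have [d hd] := uncountable_real (fun x => f (x%:C)%C).
exists d => r; have [s [us <- hs]] := hd r.
exists (map (fun x => (x%:C)%C) s); split; last by move=> _ /mapP[x /hs <- ->].
  by rewrite map_inj_uniq // => x y [].
by rewrite size_map.
Qed.

Lemma pol_rowP (K : fieldType) m (f : 'rV[K]_m -> K) : pol f -> exists p, forall v, f v = evalrow p v.
Proof.
rewrite /evalrow; elim=> [a|_ [i [j ->]]|f1 f2 _ [p1 e1] _ [p2 e2]|f1 f2 _ [p1 e1] _ [p2 e2]].
- by exists a%:MP => v; rewrite mevalC.
- by exists 'X_j => v; rewrite mevalXU ord1.
- by exists (p1 + p2) => v; rewrite mevalD e1 e2.
- by exists (p1 * p2) => v; rewrite mevalM e1 e2.
Qed.

Lemma closedp_row (K : fieldType) m (A : set 'rV[K]_m) : closedp A -> algebraic_set A.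
Proof.
move=> cA; exists [set p | forall v, A v -> evalrow p v = 0].
apply/seteqP; split=> [v Av p|v hv]; first exact.
apply: contrapT => /cA[f [/pol_rowP[p ep] fA]]; rewrite ep hv ?eqxx // => a /fA.
by rewrite ep.
Qed.

(** [sig] and [sig'] are polynomial on the whole ambient affine space, so [reducible_points] is
    closed there; at a point of Hom they are the images of the generators and their inverses, and
    only there does the set mean reducibility. *)
Theorem irreducible_open (K : closedFieldType) (Gamma : groupType) k (gamma : 'I_k -> Gamma)
    (G : affine_group K) :
  [char K] =i pred0 -> uncountable K -> generates gamma -> zconnected (@ag_coord K G) setT ->
  zopen (@hom_coord K Gamma G k gamma)
    [set phi : {multiplicative Gamma -> G} | irreducible_rep phi].
Proof.
move=> char0 uK gen conT; have [n [r [rho [kappa [rM r1 rhoE kappaE]]]]] := linearization G.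
have rinj := r_inj kappaE; have rcl := linear_closed rhoE kappaE.
have [iota iotaE] := linear_inverse rhoE kappaE.
have connT := (zconnectedE rhoE kappaE setT).1 conT.
have csubE A := closed_subgroupE rhoE kappaE A.
have csolvE A : connected_solvable A <-> csolv r A.
  by split=> -[cA coA sA]; split=> //; [exact/csubE|exact/zconnectedE|exact/csubE|exact/(zconnectedE rhoE kappaE)].
have borelE A : is_borel A <-> is_borelG r A.
  by split=> -[sA maxA]; (split; first exact/csolvE) => M /csolvE; exact: maxA.
pose sig (i : 'I_k) (y : 'rV[K]_(k * ag_dim G)) : 'M[K]_n :=
  \matrix_(a, b) evalrow (rho a b) (row i (vec_mx y)).
pose sig' i y := map_mx (ev (sig i y)) iota.
have psig i : polmap (K := K) (sig i).
  apply: polmap_mx => a b; under eq_fun do rewrite mxE.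
  by apply: pol_evalrow; apply: polmap_row; apply: polmap_vec_mx; exact: polmap_id.
have psig' i : polmap (K := K) (sig' i).
  by apply: polmap_mx => a b; under eq_fun do rewrite mxE; exact: pol_ev.
have [S eS] := closedp_row (@closedp_reducible K n G r _ _ _ sig sig' psig psig').
have sigE (phi : {multiplicative Gamma -> G}) i : sig i (hom_coord gamma phi) = r (phi (gamma i)).
  apply/matrixP => a b; rewrite mxE rhoE; congr evalrow.
  by rewrite /hom_coord mxvecK; apply/rowP => j; rewrite !mxE.
have sigE' (phi : {multiplicative Gamma -> G}) i :
    sig' i (hom_coord gamma phi) = r (phi (gamma i))^-1%g by rewrite /sig' sigE.
exists S; rewrite -eS; apply/seteqP; split=> phi /=.
  move=> /existsNP[P /not_implyP[[cP [B bB BP]] /not_implyP[nP /contrapT hP]]].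
  apply: (parabolic_reducible char0 uK r1 rM rcl rinj iotaE connT (sigE phi) (sigE' phi) (P := P)) => //.
  - exact/csubE.
  - by exists B => //; apply/borelE.
  - by move=> i; apply: hP; exists (gamma i).
move=> /(reducible_parabolic char0 uK r1 rM rcl rinj iotaE (sigE phi) (sigE' phi)).
move=> [P [cP nP [B bB BP] hP]] irr; apply: (irr P) => //.
  by split; [exact/csubE|exists B => //; apply/borelE].
(* The preimage of [P] is a subgroup containing the generators, hence all of [Gamma]. *)
move=> _ [x _ <-]; have : subgroup_gen (range gamma) x by rewrite gen.
have [P1 PM PV] := cP.1.
move=> /(_ [set x | P (phi x)]); apply=> [|_ [i _ <-]]; last exact: hP.
have phi1 : phi 1%g = 1%g by apply: (mulgI (phi 1%g)); rewrite -gmulfM !mulg1.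
split=> [|a b Pa Pb|a Pa] /=; first by rewrite phi1.
  by rewrite gmulfM; exact: PM.
have -> : phi a^-1%g = (phi a)^-1%g by apply: (mulgI (phi a)); rewrite -gmulfM !mulgV.
exact: PV.
Qed.

Local Open Scope classical_set_scope.

(* [complex R] is the field of complex numbers over the real numbers [R]. *)
Theorem proposition27 (R : realType) (Gamma : groupType)
    (k : nat) (gamma : 'I_k -> Gamma) (G : affine_group (complex R)) :
  generates gamma ->
  reductive G ->
  zopen (@hom_coord (complex R) Gamma G k gamma)
    [set rho : {multiplicative Gamma -> G} | irreducible_rep rho].
Proof.
move=> gen [conn _]; apply: irreducible_open gen conn; last exact: uncountable_complex.
exact: Num.Theory.pchar_num.
Qed.
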